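(* Let $m\in\{1,2\}$ and $c(x)=x^m$. For every sufficiently small $\varepsilon>0$ there exist $C^1$ initial data $(\rho_0(x),u_0(x))$, depending only on the radius $x\in[1,3]$, and a time $T>0$ with $T=O(1)$, such that the Cauchy problem for $$(c(x)\bar\rho)_t+(c(x)\bar\rho u)_x=0,\qquad (c(x)\bar\rho u)_t+\bigl(c(x)\bar\rho u^2-c(x)\bar\rho^{-1}\bigr)_x=-c'(x)\bar\rho^{-1},$$ with initial data $(c\bar\rho,u)|_{t=0}=(\rho_0,u_0)$ on $[1,3]$, has a unique classical $C^1$ solution in $\Omega_{symm}$, where $\Omega_{symm}$ is the domain of dependence of the initial interval $x\in[1,3]$ for times $t\in(0,T)$. Moreover, writing $\rho=c\bar\rho$, there exists a point $(x^*,T)$ with $|x^*-2|=O(\varepsilon^{1/2})<O(1)$ such that $$\lim_{t\to T^-}u(x^*,t)=\infty,\quad \lim_{t\to T^-}\rho(x^*,t)=0,\quad \lim_{t\to T^-}\rho u(x^*,t)=B,\quad \lim_{t\to T^-}E(x^*,t)=\infty,$$ where $B$ is a finite constant and $E=\frac12\rho u^2+\frac12c^2\rho^{-1}$. The functions $\rho(x,t)$ and $-u(x,t)$ have uniform upper bounds on $\Omega_{symm}$ for $t\in[0,T)$.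
   Context: Solutions are classical $C^1$ solutions with $\bar\rho>0$. In terms of $\rho=c(x)\bar\rho$ the system is equivalent to $\rho_t+(\rho u)_x=0$, $(\rho u)_t+(\rho u^2-c^2\rho^{-1})_x=-cc'\rho^{-1}$. The characteristic speeds are $S=u+c\rho^{-1}$ and $R=u-c\rho^{-1}$; the plus and minus characteristics are the solutions of $\dot x_+=S(x_+,t)$ and $\dot x_-=R(x_-,t)$. The domain of dependence of $[1,3]$ is the region bounded on the left by the plus characteristic starting from $(1,0)$ and on the right by the minus characteristic starting from $(3,0)$. Constants implied in $O(\cdot)$ are independent of $\varepsilon$. *)

(* Defs.v *)
From Stdlib Require Import Reals Lra.
From Coquelicot Require Import Coquelicot.
Open Scope R_scope.

(** Points of the [(x,t)]-plane are pairs [p = (x, t) : R * R]. A field on a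
    region [D] is a total function whose values off [D] are irrelevant: all
    derivatives are taken relative to [D], which gives one-sided derivatives on
    the part of the boundary contained in [D]. *)

Definition is_derive_within (D : R -> Prop) (f : R -> R) (x l : R) : Prop :=
  @filterdiff R_AbsRing R_NormedModule R_NormedModule
    f (within D (locally x)) (fun h => h * l).

Definition C1_within (D : R -> Prop) (f : R -> R) : Prop :=
  exists df : R -> R,
    (forall x, D x -> is_derive_within D f x (df x)) /\ continuous_on D df.

Definition is_gradient_within (D : R * R -> Prop) (f : R * R -> R)
    (p : R * R) (fx ft : R) : Prop :=
  @filterdiff R_AbsRing (prod_NormedModule R_AbsRing R_NormedModule R_NormedModule)
    R_NormedModule f (within D (locally p)) (fun h => fst h * fx + snd h * ft).

Definition C1_within2 (D : R * R -> Prop) (f : R * R -> R) : Prop :=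
  exists fx ft : R * R -> R,
    (forall p, D p -> is_gradient_within D f p (fx p) (ft p)) /\
    continuous_on D fx /\ continuous_on D ft.

(** [q_t + f_x = s] on [D]. *)
Definition balance_law (D : R * R -> Prop) (q f s : R * R -> R) : Prop :=
  forall p, D p ->
    exists qx qt fx ft : R,
      is_gradient_within D q p qx qt /\
      is_gradient_within D f p fx ft /\
      qt + fx = s p.

Definition c (m : nat) (x : R) : R := x ^ m.

(** [rb] is the density [\bar\rho]; [rho] is [c \bar\rho]. *)
Definition rho (m : nat) (rb : R * R -> R) (p : R * R) : R := c m (fst p) * rb p.

Definition energy (m : nat) (rb u : R * R -> R) (p : R * R) : R :=
  / 2 * rho m rb p * u p ^ 2 + / 2 * c m (fst p) ^ 2 * / rho m rb p.

Definition speed_plus (m : nat) (rb u : R * R -> R) (p : R * R) : R :=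
  u p + c m (fst p) * / rho m rb p.

Definition speed_minus (m : nat) (rb u : R * R -> R) (p : R * R) : R :=
  u p - c m (fst p) * / rho m rb p.

Definition region (T : R) (xp xm : R -> R) (p : R * R) : Prop :=
  0 <= snd p < T /\ xp (snd p) <= fst p <= xm (snd p).

Definition classical_solution (m : nat) (D : R * R -> Prop)
    (rho0 u0 : R -> R) (rb u : R * R -> R) : Prop :=
  C1_within2 D rb /\ C1_within2 D u /\
  (forall p, D p -> 0 < rb p) /\
  balance_law D
    (fun p => c m (fst p) * rb p)
    (fun p => c m (fst p) * rb p * u p)
    (fun _ => 0) /\
  balance_law D
    (fun p => c m (fst p) * rb p * u p)
    (fun p => c m (fst p) * rb p * u p ^ 2 - c m (fst p) * / rb p)
    (fun p => - Derive (c m) (fst p) * / rb p) /\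
  (forall x, 1 <= x <= 3 -> rho m rb (x, 0) = rho0 x /\ u (x, 0) = u0 x).

(** [region T xp xm] is the domain of dependence of [[1,3]] up to time [T]
    for the fields [rb], [u]: [xp] is the plus characteristic from [(1,0)] and
    [xm] the minus characteristic from [(3,0)]. They stay at positive radius,
    where [c > 0], and do not cross, so that both lie in the region. *)
Definition dependence_boundary (m : nat) (T : R) (rb u : R * R -> R)
    (xp xm : R -> R) : Prop :=
  xp 0 = 1 /\ xm 0 = 3 /\
  forall t, 0 <= t < T ->
    0 < xp t <= xm t /\
    is_derive_within (fun s => 0 <= s < T) xp t (speed_plus m rb u (xp t, t)) /\
    is_derive_within (fun s => 0 <= s < T) xm t (speed_minus m rb u (xm t, t)).

Definition solution_on_dependence_domain (m : nat) (T : R) (rho0 u0 : R -> R)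
    (rb u : R * R -> R) (xp xm : R -> R) : Prop :=
  dependence_boundary m T rb u xp xm /\
  classical_solution m (region T xp xm) rho0 u0 rb u.

(** The domain of dependence is determined by the solution itself, so
    uniqueness has two halves: no other classical solution lives on the same
    domain, and no other classical solution on its own domain of dependence
    yields a different domain or different fields. *)
Definition unique_solution (m : nat) (T : R) (rho0 u0 : R -> R)
    (rb u : R * R -> R) (xp xm : R -> R) : Prop :=
  (forall rb' u' : R * R -> R,
     classical_solution m (region T xp xm) rho0 u0 rb' u' ->
     forall p, region T xp xm p -> rb' p = rb p /\ u' p = u p) /\
  (forall (rb' u' : R * R -> R) (xp' xm' : R -> R),
     solution_on_dependence_domain m T rho0 u0 rb' u' xp' xm' ->
     (forall t, 0 <= t < T -> xp' t = xp t /\ xm' t = xm t) /\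
     (forall p, region T xp xm p -> rb' p = rb p /\ u' p = u p)).

(* Main.v *)
Require Import Defs.
From Stdlib Require Import Reals Ranalysis5 Lra Lia Classical ClassicalEpsilon.
From Coquelicot Require Import Coquelicot.
Open Scope R_scope.

(** The Riemann speeds [S = u + 1 / rb] and [R = u - 1 / rb] satisfy
    [S_t + R S_x = m / (4 x) * (S ^ 2 - R ^ 2)] and
    [R_t + S R_x = - m / (4 x) * (S ^ 2 - R ^ 2)]. The ansatz
    [u = x / (1 + t) * U s], [rb = (1 + t) / x * B s] with [s = ln x + ln (1 + t) / 2] reduces
    them to a planar autonomous system. With [1 / S] as unknown that system is regular at
    [S = oo], and parametrizing its orbit by the time [eta] left before blow-up along a minus
    characteristic gives a profile on which [eta + ln (1 + t)] is constant along minus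
    characteristics, and [plus_time eta + ln (1 + t)] along plus characteristics. A small
    initial slope [q_init] makes the orbit long enough to reach back to [x = 1], while the
    singularity is met first at [x = 2], where the minus characteristic from [x = 3] ends. So
    one solution, blowing up at exactly [x = 2], serves every [eps].

    Uniqueness inside a given domain is a maximum principle: a positive maximum of the
    exponentially weighted differences of [S] and [R] over the past contradicts the linear
    transport equations they satisfy, because each characteristic can be followed backwards
    inside the domain. For another domain of dependence the two invariants above force its
    boundaries to be the same curves as long as they stay where the self-similar solution is
    defined, and a continuation argument shows that they always do. *)

(** * Gradients relative to a set *)

(** The weight [1 / 2] in [s] makes [r = - 1 / 2] on the singular curve [s = s_star], so this curve
    moves with speed [R]. Minus characteristics reach it tangentially but in finite time: [z] grows
    linearly in the remaining time [eta], the gap [s_star - s] only quadratically. At [t = 0] the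
    curve lies to the right of [x = 3], and the domain of dependence touches it only at its corner
    [(2, T)]. Two demands compete. A small [q] keeps the drift of [s] along the minus characteristic
    negligible against the decrease [- ln (1 + t) / 2] of [ln x], which takes it from 3 to 2. But
    the gap grows only at rate [q z], and it must climb to [ln 2 + th / 2] for the orbit to contain
    [x = 1]. So [q z] is bounded below by a tiny constant and the orbit is followed for a
    correspondingly huge time; only the finiteness of these numbers matters. Plus characteristics
    have speed [x / ((1 + t) z)], which is large near the singularity. The left boundary
    nevertheless outlives [T], because [z >= 4] on the long tail of the orbit. *)

Definition plane := prod_NormedModule R_AbsRing R_NormedModule R_NormedModule.

Lemma within_proper {T : UniformSpace} (D : T -> Prop) (p : T) :
  D p -> ProperFilter (within D (locally p)).
Proof.
  intros Dp. split.
  - intros P [e He]. exists p. apply He; [apply ball_center | exact Dp].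
  - apply within_filter, locally_filter.
Qed.

Lemma within_lim {T : UniformSpace} (D : T -> Prop) (p : T) :
  is_filter_lim (within D (locally p)) p.
Proof.
  intros P HP. exact (filter_le_within D P HP).
Qed.

Lemma gradient_cont D f p fx ft :
  is_gradient_within D f p fx ft ->
  filterlim f (within D (locally p)) (locally (f p)).
Proof.
  intros H.
  apply (@filterdiff_continuous_aux R_AbsRing plane R_NormedModule).
  - apply within_filter, locally_filter.
  - eexists; exact H.
  - exact (@within_lim plane D p).
Qed.

Lemma gradient_comp D f p fx ft (phi : R -> R) l :
  D p -> is_gradient_within D f p fx ft -> is_derive phi (f p) l ->
  is_gradient_within D (fun y => phi (f y)) p (l * fx) (l * ft).
Proof.
  intros Dp Hf Hphi.
  assert (PF : ProperFilter (within D (locally p))) by (exact (@within_proper plane D p Dp)).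
  apply (@filterdiff_ext_lin R_AbsRing plane R_NormedModule _ _ _
    (fun y => scal (fst y * fx + snd y * ft) l)).
  - apply (@filterdiff_comp R_AbsRing plane R_NormedModule R_NormedModule _ _
      f phi (fun y => fst y * fx + snd y * ft) (fun y => scal y l)).
    + exact Hf.
    + apply (@filterdiff_locally R_AbsRing R_NormedModule R_NormedModule _ _
        phi (f p)).
      * intros P HP. exact (gradient_cont _ _ _ _ _ Hf P HP).
      * exact Hphi.
  - intros y. unfold scal; simpl; unfold mult; simpl. ring.
Qed.

Lemma gradient_plus D f g p fx ft gx gt :
  is_gradient_within D f p fx ft -> is_gradient_within D g p gx gt ->
  is_gradient_within D (fun y => f y + g y) p (fx + gx) (ft + gt).
Proof.
  intros Hf Hg.
  pose proof (@within_filter _ D _ (@filter_filter _ _ (@locally_filter plane p))) as FF.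
  apply (@filterdiff_ext_lin R_AbsRing plane R_NormedModule _ _ _
    (fun y => plus (fst y * fx + snd y * ft) (fst y * gx + snd y * gt))).
  - now apply (@filterdiff_plus_fct R_AbsRing plane R_NormedModule _ _ f g).
  - intros y. unfold plus; simpl. ring.
Qed.

Lemma gradient_mult D f g p fx ft gx gt :
  D p -> is_gradient_within D f p fx ft -> is_gradient_within D g p gx gt ->
  is_gradient_within D (fun y => f y * g y) p
    (fx * g p + f p * gx) (ft * g p + f p * gt).
Proof.
  intros Dp Hf Hg.
  assert (PF : ProperFilter (within D (locally p))) by (exact (@within_proper plane D p Dp)).
  apply (@filterdiff_ext_lin R_AbsRing plane R_NormedModule _ _ _
    (fun y => plus (mult (fst y * fx + snd y * ft) (snd (f p, g p)))
                   (mult (fst (f p, g p)) (fst y * gx + snd y * gt)))).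
  - apply (@filterdiff_comp_2 R_AbsRing plane R_NormedModule R_NormedModule
      R_NormedModule _ _ f g mult _ _
      (fun a b => plus (mult a (snd (f p, g p))) (mult (fst (f p, g p)) b))).
    + exact Hf.
    + exact Hg.
    + apply (@filterdiff_mult R_AbsRing).
      * apply filtermap_proper_filter, PF.
      * intros P HP.
        apply (filterlim_pair f g (gradient_cont _ _ _ _ _ Hf)
          (gradient_cont _ _ _ _ _ Hg)).
        destruct HP as [e He].
        exists (fun a => ball (f p) e a) (fun b => ball (g p) e b).
        -- now exists e.
        -- now exists e.
        -- intros a b Ha Hb. apply He. now split.
      * intros; apply Rmult_comm.
  - intros y. unfold plus, mult; simpl. unfold mult; simpl. ring.
Qed.

Lemma gradient_fst D p : is_gradient_within D fst p 1 0.
Proof.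
  pose proof (@within_filter _ D _ (@filter_filter _ _ (@locally_filter plane p))) as FF.
  apply (@filterdiff_ext_lin R_AbsRing plane R_NormedModule _ _ _ fst).
  - apply filterdiff_linear, is_linear_fst.
  - intros y. simpl. ring.
Qed.

Lemma gradient_snd D p : is_gradient_within D snd p 0 1.
Proof.
  pose proof (@within_filter _ D _ (@filter_filter _ _ (@locally_filter plane p))) as FF.
  apply (@filterdiff_ext_lin R_AbsRing plane R_NormedModule _ _ _ snd).
  - apply filterdiff_linear, is_linear_snd.
  - intros y. simpl. ring.
Qed.

Lemma gradient_eq D f p fx ft gx gt :
  is_gradient_within D f p fx ft -> fx = gx -> ft = gt ->
  is_gradient_within D f p gx gt.
Proof. now intros H <- <-. Qed.

(** The remainder is measured in the sum of the coordinate distances, which dominates the Euclidean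
    norm, so that later estimates can be made coordinatewise. *)
Lemma gradient_eps D f p fx ft :
  D p -> is_gradient_within D f p fx ft ->
  forall e, 0 < e -> exists d, 0 < d /\ forall x t, D (x, t) ->
    Rabs (x - fst p) < d -> Rabs (t - snd p) < d ->
    Rabs (f (x, t) - f p - ((x - fst p) * fx + (t - snd p) * ft))
      <= e * (Rabs (x - fst p) + Rabs (t - snd p)).
Proof.
  intros Dp [_ H] e He.
  destruct (H p (@within_lim plane D p) (mkposreal e He)) as [d Hd].
  exists d. split; [apply cond_pos|].
  intros x t Dxt Hx Ht.
  assert (B : @ball (prod_UniformSpace R_UniformSpace R_UniformSpace) p d (x, t)).
  { split; assumption. }
  specialize (Hd (x, t) B Dxt).
  change (Rabs (f (x, t) - f p - ((x - fst p) * fx + (t - snd p) * ft)) <=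
    e * sqrt (Rabs (x - fst p) ^ 2 + Rabs (t - snd p) ^ 2)) in Hd.
  eapply Rle_trans; [exact Hd|].
  apply Rmult_le_compat_l; [lra|].
  set (a := Rabs (x - fst p)). set (b := Rabs (t - snd p)).
  assert (0 <= a) by apply Rabs_pos. assert (0 <= b) by apply Rabs_pos.
  rewrite <- (sqrt_pow2 (a + b)) by lra.
  apply sqrt_le_1_alt. nra.
Qed.

Lemma derive_within_eps D f x l :
  D x -> is_derive_within D f x l ->
  forall e, 0 < e -> exists d, 0 < d /\ forall y, D y -> Rabs (y - x) < d ->
    Rabs (f y - f x - (y - x) * l) <= e * Rabs (y - x).
Proof.
  intros Dx [_ H] e He.
  destruct (H x (@within_lim R_UniformSpace D x) (mkposreal e He)) as [d Hd].
  exists d. split; [apply cond_pos|].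
  intros y Dy Hy. exact (Hd y Hy Dy).
Qed.

Lemma derive_within_opp D f x l :
  is_derive_within D f x l -> is_derive_within D (fun y => - f y) x (- l).
Proof.
  intros H.
  pose proof (@within_filter R D _ (@filter_filter _ _ (@locally_filter R_UniformSpace x))) as FF.
  eapply filterdiff_ext_lin.
  - exact (@filterdiff_opp_fct R_AbsRing R_NormedModule R_NormedModule _ FF f _ H).
  - intros y. unfold opp; simpl. ring.
Qed.

Lemma derive_within_cont D f x l :
  D x -> is_derive_within D f x l ->
  forall e, 0 < e -> exists d, 0 < d /\ forall y, D y -> Rabs (y - x) < d ->
    Rabs (f y - f x) < e.
Proof.
  intros Dx H e He.
  destruct (derive_within_eps _ _ _ _ Dx H 1 Rlt_0_1) as [d [Hd Hf]].
  pose proof (Rabs_pos l) as Hl.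
  exists (Rmin d (e / (2 * (1 + Rabs l)))).
  assert (0 < e / (2 * (1 + Rabs l))) by (apply Rdiv_lt_0_compat; lra).
  split; [now apply Rmin_glb_lt|].
  intros y Dy Hy.
  assert (H1 := Rlt_le_trans _ _ _ Hy (Rmin_l _ _)).
  assert (H2 := Rlt_le_trans _ _ _ Hy (Rmin_r _ _)).
  specialize (Hf y Dy H1).
  replace (f y - f x) with ((f y - f x - (y - x) * l) + (y - x) * l) by ring.
  eapply Rle_lt_trans; [apply Rabs_triang|].
  rewrite Rabs_mult.
  assert (Rabs (y - x) * (2 * (1 + Rabs l)) < e).
  { apply (Rmult_lt_compat_r (2 * (1 + Rabs l))) in H2; [|lra].
    now replace (e / (2 * (1 + Rabs l)) * (2 * (1 + Rabs l))) with e in H2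
      by (field; lra). }
  pose proof (Rabs_pos (y - x)). nra.
Qed.

(** Speeds [v] with which a point [(x0, t0)] can be followed backwards in time
    inside a region whose lateral boundaries have speeds [a] and [b] at [t0]. *)
Definition admissible (T : R) (xp xm : R -> R) (t0 x0 v : R) : Prop :=
  exists a b,
    is_derive_within (fun s => 0 <= s < T) xp t0 a /\
    is_derive_within (fun s => 0 <= s < T) xm t0 b /\
    (x0 = xp t0 -> v <= a) /\ (x0 = xm t0 -> b <= v).

(** If the point lies on the curve, then [v <= a] means that, backwards in time, the curve moves
    left at least as fast as the point, up to first order. If it lies strictly to the right,
    continuity alone leaves room. *)
Lemma backward_above T f t0 x0 v a e :
  0 < t0 < T -> is_derive_within (fun s => 0 <= s < T) f t0 a ->
  f t0 <= x0 -> (x0 = f t0 -> v <= a) -> 0 < e ->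
  exists h0, 0 < h0 /\ forall h, 0 < h < h0 -> h < t0 ->
    f (t0 - h) <= x0 - v * h + e * h.
Proof.
  intros Ht Ha Hx Hva He.
  assert (Dt : (fun s => 0 <= s < T) t0) by (simpl; lra).
  destruct (Req_dec x0 (f t0)) as [E|E].
  - destruct (derive_within_eps _ _ _ _ Dt Ha e He) as [d [Hd H]].
    exists d. split; [exact Hd|]. intros h Hh Hh'.
    assert (D' : 0 <= t0 - h < T) by lra.
    specialize (H (t0 - h) D').
    replace (t0 - h - t0) with (- h) in H by ring.
    rewrite Rabs_Ropp, (Rabs_pos_eq h) in H by lra.
    specialize (H (proj2 Hh)). apply Rabs_le_between in H.
    specialize (Hva E). nra.
  - destruct (derive_within_cont _ _ _ _ Dt Ha ((x0 - f t0) / 2))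
      as [d [Hd H]]; [lra|].
    pose proof (Rabs_pos v).
    assert (Hq : 0 < (x0 - f t0) / (2 * (1 + Rabs v)))
      by (apply Rdiv_lt_0_compat; lra).
    exists (Rmin d ((x0 - f t0) / (2 * (1 + Rabs v)))).
    split; [now apply Rmin_glb_lt|]. intros h Hh Hh'.
    assert (H1 := Rlt_le_trans _ _ _ (proj2 Hh) (Rmin_l _ _)).
    assert (H2 := Rlt_le_trans _ _ _ (proj2 Hh) (Rmin_r _ _)).
    specialize (H (t0 - h)).
    replace (t0 - h - t0) with (- h) in H by ring.
    rewrite Rabs_Ropp, (Rabs_pos_eq h) in H by lra.
    assert (H3 : Rabs (f (t0 - h) - f t0) < (x0 - f t0) / 2) by (apply H; lra).
    apply Rabs_lt_between in H3.
    apply (Rmult_lt_compat_r (2 * (1 + Rabs v))) in H2; [|lra].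
    replace ((x0 - f t0) / (2 * (1 + Rabs v)) * (2 * (1 + Rabs v)))
      with (x0 - f t0) in H2 by (field; lra).
    pose proof (Rle_abs v). nra.
Qed.

Lemma backward_curve T xp xm t0 x0 v :
  0 < t0 < T -> xp t0 <= x0 <= xm t0 ->
  (forall s, 0 <= s < T -> xp s <= xm s) ->
  admissible T xp xm t0 x0 v ->
  forall e, 0 < e -> exists h0, 0 < h0 /\ forall h, 0 < h < h0 ->
    exists y, region T xp xm (y, t0 - h) /\ Rabs (y - (x0 - v * h)) <= e * h.
Proof.
  intros Ht Hx Hle (a & b & Ha & Hb & Hva & Hvb) e He.
  destruct (backward_above T xp t0 x0 v a e Ht Ha (proj1 Hx) Hva He) as [h1 [Hh1 Hp]].
  destruct (backward_above T (fun t => - xm t) t0 (- x0) (- v) (- b) e Ht)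
    as [h2 [Hh2 Hm]]; [now apply derive_within_opp|lra| |exact He|].
  { intros E. apply Ropp_le_contravar, Hvb. lra. }
  exists (Rmin t0 (Rmin h1 h2)). split.
  { repeat apply Rmin_glb_lt; lra. }
  intros h Hh.
  assert (h < t0) by (eapply Rlt_le_trans; [apply Hh | apply Rmin_l]).
  assert (h < Rmin h1 h2) by (eapply Rlt_le_trans; [apply Hh | apply Rmin_r]).
  assert (h < h1) by (eapply Rlt_le_trans; [exact H0 | apply Rmin_l]).
  assert (h < h2) by (eapply Rlt_le_trans; [exact H0 | apply Rmin_r]).
  specialize (Hp h ltac:(lra) ltac:(lra)). specialize (Hm h ltac:(lra) ltac:(lra)).
  specialize (Hle (t0 - h) ltac:(lra)).
  (* The straight backward path may leave the region by at most [e * h] on either side; clamping it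
     to the time slice costs no more. *)
  exists (Rmax (xp (t0 - h)) (Rmin (xm (t0 - h)) (x0 - v * h))).
  assert (0 < e * h) by nra.
  split.
  - split; simpl; [lra|]. split; [apply Rmax_l|].
    apply Rmax_lub; [exact Hle | apply Rmin_l].
  - apply Rabs_le. unfold Rmax, Rmin.
    repeat destruct Rle_dec; lra.
Qed.

Lemma gradient_backward T xp xm f x0 t0 fx ft v :
  0 < t0 < T -> xp t0 <= x0 <= xm t0 ->
  (forall s, 0 <= s < T -> xp s <= xm s) ->
  admissible T xp xm t0 x0 v ->
  is_gradient_within (region T xp xm) f (x0, t0) fx ft ->
  forall e, 0 < e -> exists h0, 0 < h0 /\ forall h, 0 < h < h0 ->
    exists y, region T xp xm (y, t0 - h) /\
      Rabs (f (y, t0 - h) - f (x0, t0) + h * (ft + v * fx)) <= e * h.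
Proof.
  intros Ht Hx Hle Hv Hf e He.
  assert (Dp : region T xp xm (x0, t0)) by (split; simpl; lra).
  pose proof (Rabs_pos fx) as Hfx. pose proof (Rabs_pos v) as Hav.
  (* Half of [e] each: [e1] pays for the Taylor remainder, since [|y - x0| + h <= (2 + |v|) h], and
     [e2] for the deviation [w] of the path from the line of speed [v], multiplied by [|fx|]. *)
  set (e1 := e / (2 * (3 + Rabs v))).
  assert (He1 : 0 < e1) by (apply Rdiv_lt_0_compat; lra).
  assert (Ee1 : e1 * (2 * (3 + Rabs v)) = e) by (unfold e1; field; lra).
  set (e2 := Rmin 1 (e / (2 * (1 + Rabs fx)))).
  assert (He2 : 0 < e2) by (apply Rmin_glb_lt; [lra | apply Rdiv_lt_0_compat; lra]).
  assert (Ee2 : e2 * (2 * (1 + Rabs fx)) <= e).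
  { assert (e2 <= e / (2 * (1 + Rabs fx))) by apply Rmin_r.
    apply (Rmult_le_compat_r (2 * (1 + Rabs fx))) in H; [|lra].
    now replace (e / (2 * (1 + Rabs fx)) * (2 * (1 + Rabs fx))) with e in H
      by (field; lra). }
  assert (Hle1 : e2 <= 1) by apply Rmin_l.
  destruct (gradient_eps _ _ _ _ _ Dp Hf e1 He1) as [d [Hd Hg]]. simpl in Hg.
  destruct (backward_curve T xp xm t0 x0 v Ht Hx Hle Hv e2 He2) as [h1 [Hh1 Hc]].
  assert (Hdq : 0 < d / (2 + Rabs v)) by (apply Rdiv_lt_0_compat; lra).
  exists (Rmin h1 (d / (2 + Rabs v))). split; [now apply Rmin_glb_lt|].
  intros h Hh.
  assert (H1 : h < h1) by (eapply Rlt_le_trans; [apply Hh | apply Rmin_l]).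
  assert (H2 : h * (2 + Rabs v) < d).
  { assert (H2 : h < d / (2 + Rabs v))
      by (eapply Rlt_le_trans; [apply Hh | apply Rmin_r]).
    apply (Rmult_lt_compat_r (2 + Rabs v)) in H2; [|lra].
    now replace (d / (2 + Rabs v) * (2 + Rabs v)) with d in H2 by (field; lra). }
  destruct (Hc h ltac:(lra)) as [y [Hy Hyx]].
  exists y. split; [exact Hy|].
  set (w := y - (x0 - v * h)) in *.
  assert (Ey : y - x0 = w - v * h) by (unfold w; ring).
  assert (Hw : Rabs (y - x0) <= (1 + Rabs v) * h).
  { rewrite Ey. unfold Rminus. eapply Rle_trans; [apply Rabs_triang|].
    rewrite Rabs_Ropp, Rabs_mult, (Rabs_pos_eq h) by lra. nra. }
  assert (Et : Rabs (t0 - h - t0) = h).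
  { replace (t0 - h - t0) with (- h) by ring. rewrite Rabs_Ropp. apply Rabs_pos_eq. lra. }
  specialize (Hg y (t0 - h) Hy).
  rewrite Et in Hg.
  specialize (Hg ltac:(nra) ltac:(nra)).
  replace (f (y, t0 - h) - f (x0, t0) + h * (ft + v * fx)) with
    ((f (y, t0 - h) - f (x0, t0) - ((y - x0) * fx + (t0 - h - t0) * ft)) + w * fx)
    by (rewrite Ey; ring).
  eapply Rle_trans; [apply Rabs_triang|]. rewrite (Rabs_mult w).
  assert (Rabs w * Rabs fx <= e2 * h * Rabs fx) by (apply Rmult_le_compat_r; lra).
  assert (e1 * (Rabs (y - x0) + h) <= e1 * ((2 + Rabs v) * h)) by
    (apply Rmult_le_compat_l; nra).
  assert (e1 * ((3 + Rabs v) * h) = e / 2 * h) by (rewrite <- Ee1; field).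
  assert (e2 * h * (1 + Rabs fx) <= e / 2 * h) by nra.
  nra.
Qed.

Lemma abs_le_all_eq_0 a : (forall e, 0 < e -> Rabs a <= e) -> a = 0.
Proof.
  intros H. destruct (Req_dec a 0) as [E|E]; [exact E|exfalso].
  pose proof (Rabs_pos_lt a E). specialize (H (Rabs a / 2)). lra.
Qed.

(** Two independent directions inside the region suffice: a horizontal one, because the time slice
    is a nondegenerate interval, and the backward direction of an admissible speed. This also covers
    boundary points. *)
Lemma gradient_unique T xp xm f x0 t0 fx ft gx gt v :
  0 < t0 < T -> xp t0 <= x0 <= xm t0 ->
  (forall s, 0 <= s < T -> xp s < xm s) ->
  admissible T xp xm t0 x0 v ->
  is_gradient_within (region T xp xm) f (x0, t0) fx ft ->
  is_gradient_within (region T xp xm) f (x0, t0) gx gt ->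
  fx = gx /\ ft = gt.
Proof.
  intros Ht Hx Hlt Hv Hf Hg.
  assert (Hle : forall s, 0 <= s < T -> xp s <= xm s)
    by (intros; now apply Rlt_le, Hlt).
  assert (Dp : region T xp xm (x0, t0)) by (split; simpl; lra).
  assert (E : fx - gx = 0).
  { apply abs_le_all_eq_0. intros e He.
    destruct (gradient_eps _ _ _ _ _ Dp Hf (e / 2)) as [d1 [Hd1 H1]]; [lra|].
    destruct (gradient_eps _ _ _ _ _ Dp Hg (e / 2)) as [d2 [Hd2 H2]]; [lra|].
    simpl in H1, H2. specialize (Hlt t0 ltac:(lra)).
    assert (exists k, k <> 0 /\ Rabs k < d1 /\ Rabs k < d2 /\
      region T xp xm (x0 + k, t0)) as (k & Hk & Hk1 & Hk2 & Dk).
    { set (k0 := Rmin (Rmin d1 d2) (xm t0 - xp t0) / 2).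
      assert (K : 0 < Rmin (Rmin d1 d2) (xm t0 - xp t0))
        by (repeat apply Rmin_glb_lt; lra).
      pose proof (Rmin_l (Rmin d1 d2) (xm t0 - xp t0)) as K1.
      pose proof (Rmin_r (Rmin d1 d2) (xm t0 - xp t0)) as K2.
      pose proof (Rmin_l d1 d2) as K3. pose proof (Rmin_r d1 d2) as K4.
      destruct (Rle_dec (x0 + k0) (xm t0)) as [L|L].
      - exists k0. rewrite Rabs_pos_eq by (unfold k0; lra).
        split; [unfold k0; lra|]. split; [unfold k0; lra|]. split; [unfold k0; lra|].
        split; simpl; unfold k0 in *; lra.
      - exists (- k0). rewrite Rabs_Ropp, Rabs_pos_eq by (unfold k0; lra).
        split; [unfold k0; lra|]. split; [unfold k0; lra|]. split; [unfold k0; lra|].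
        split; simpl; unfold k0 in *; lra. }
    assert (E0 : t0 - t0 = 0) by ring.
    assert (Ek : x0 + k - x0 = k) by ring.
    specialize (H1 (x0 + k) t0 Dk). specialize (H2 (x0 + k) t0 Dk).
    rewrite E0, Ek, Rabs_R0 in H1, H2.
    specialize (H1 Hk1 Hd1). specialize (H2 Hk2 Hd2).
    apply (Rmult_le_reg_r (Rabs k)); [now apply Rabs_pos_lt|].
    rewrite <- Rabs_mult.
    replace ((fx - gx) * k) with
      ((f (x0 + k, t0) - f (x0, t0) - (k * gx + 0 * gt)) -
       (f (x0 + k, t0) - f (x0, t0) - (k * fx + 0 * ft))) by ring.
    unfold Rminus at 1. eapply Rle_trans; [apply Rabs_triang|].
    rewrite Rabs_Ropp. lra. }
  assert (E' : (ft + v * fx) - (gt + v * gx) = 0).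
  { apply abs_le_all_eq_0. intros e He.
    (* The zero function [f - f] has the difference of the two gradients as a gradient, and its
       increments along the backward path vanish. *)
    assert (Hdiff : is_gradient_within (region T xp xm) (fun p => f p + -1 * f p)
      (x0, t0) (fx + -1 * gx) (ft + -1 * gt)).
    { apply gradient_plus; [exact Hf|].
      apply (gradient_comp _ f _ gx gt (fun a => -1 * a)); [exact Dp|exact Hg|].
      auto_derive; [exact I|ring]. }
    destruct (gradient_backward T xp xm _ x0 t0 _ _ v Ht Hx Hle Hv Hdiff e He)
      as [h0 [Hh0 H]].
    destruct (H (h0 / 2) ltac:(lra)) as [y [_ Hy]].
    apply (Rmult_le_reg_r (h0 / 2)); [lra|].
    rewrite <- (Rabs_pos_eq (h0 / 2)) at 1 by lra.
    rewrite <- Rabs_mult.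
    replace ((ft + v * fx - (gt + v * gx)) * (h0 / 2)) with
      (f (y, t0 - h0 / 2) + -1 * f (y, t0 - h0 / 2) - (f (x0, t0) + -1 * f (x0, t0)) +
       h0 / 2 * (ft + -1 * gt + v * (fx + -1 * gx))) by ring.
    exact Hy. }
  split; [lra|]. replace gx with fx in E' by lra. lra.
Qed.

(** Were the derivative along the speed [v] negative, following that direction backwards would reach
    a larger value in the past. *)
Lemma gradient_at_past_max T xp xm f x0 t0 fx ft v :
  0 < t0 < T -> xp t0 <= x0 <= xm t0 ->
  (forall s, 0 <= s < T -> xp s <= xm s) ->
  admissible T xp xm t0 x0 v ->
  is_gradient_within (region T xp xm) f (x0, t0) fx ft ->
  (forall p, region T xp xm p -> snd p <= t0 -> f p <= f (x0, t0)) ->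
  0 <= ft + v * fx.
Proof.
  intros Ht Hx Hle Hv Hf Hmax.
  destruct (Rle_dec 0 (ft + v * fx)) as [L|L]; [exact L|exfalso].
  destruct (gradient_backward T xp xm f x0 t0 fx ft v Ht Hx Hle Hv Hf
    (- (ft + v * fx) / 2)) as [h0 [Hh0 H]]; [lra|].
  destruct (H (h0 / 2) ltac:(lra)) as [y [Dy Hy]].
  specialize (Hmax _ Dy ltac:(simpl; lra)).
  apply Rabs_le_between in Hy. nra.
Qed.

Lemma classical_choice {A B : Type} (P : A -> B -> Prop) :
  (forall x, exists y, P x y) -> exists f, forall x, P x (f x).
Proof.
  intros H. exists (fun x => proj1_sig (constructive_indefinite_description _ (H x))).
  intros x. apply proj2_sig.
Qed.

(** * Compactness of time slabs *)

Definition slab (T : R) (xp xm : R -> R) (tau : R) (p : R * R) : Prop :=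
  region T xp xm p /\ snd p <= tau.

Definition near (d : R) (p q : R * R) : Prop :=
  Rabs (fst q - fst p) < d /\ Rabs (snd q - snd p) < d.

Definition continuous_lateral (T : R) (xp xm : R -> R) : Prop :=
  forall v, 0 <= v < T -> forall e, 0 < e -> exists d, 0 < d /\
    forall t, 0 <= t < T -> Rabs (t - v) < d ->
      Rabs (xp t - xp v) < e /\ Rabs (xm t - xm v) < e.

(** The slab is the image of a rectangle under [pt], where compactness of gauges applies. The gauge
    at a point is chosen below [/ (1 + |B|)], so it encodes the local bound as well as the
    neighbourhood, and a positive lower bound on gauges is an upper bound on [f]. *)
Lemma slab_locally_bounded T xp xm tau (f : R * R -> R) :
  0 <= tau < T -> (forall t, 0 <= t < T -> xp t <= xm t) ->
  continuous_lateral T xp xm ->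
  (forall p, slab T xp xm tau p -> exists d B, 0 < d /\
     forall q, slab T xp xm tau q -> near d p q -> f q <= B) ->
  exists M, forall p, slab T xp xm tau p -> f p <= M.
Proof.
  intros Ht Hle Hc Hf.
  set (pt := fun u v : R => ((1 - u) * xp v + u * xm v, v)).
  assert (G : forall u v, exists d : posreal, 0 <= u <= 1 -> 0 <= v <= tau ->
    forall u' v', 0 <= u' <= 1 -> 0 <= v' <= tau ->
      Rabs (u' - u) < d -> Rabs (v' - v) < d -> f (pt u' v') <= / d).
  { intros u v.
    destruct (classic (0 <= u <= 1 /\ 0 <= v <= tau)) as [[Hu Hv]|N].
    2: { exists (mkposreal 1 Rlt_0_1). intros; tauto. }
    assert (Sp : forall u v, 0 <= u <= 1 -> 0 <= v <= tau ->
      slab T xp xm tau (pt u v)).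
    { intros u1 v1 Hu1 Hv1. specialize (Hle v1 ltac:(lra)).
      split; [split|]; simpl; nra. }
    destruct (Hf (pt u v) (Sp u v Hu Hv)) as (d & B & Hd & HB).
    destruct (Hc v ltac:(lra) (d / 3)) as (d1 & Hd1 & H1); [lra|].
    set (w := Rabs (xm v - xp v)).
    assert (Hw : 0 <= w) by apply Rabs_pos.
    set (d2 := d / (3 * (1 + w))).
    assert (Hd2 : 0 < d2) by (apply Rdiv_lt_0_compat; lra).
    assert (Ed2 : d2 * (3 * (1 + w)) = d) by (unfold d2; field; lra).
    set (d3 := / (1 + Rabs B)).
    pose proof (Rabs_pos B) as HB0.
    assert (Hd3 : 0 < d3) by (apply Rinv_0_lt_compat; lra).
    assert (Hm : 0 < Rmin (Rmin d d1) (Rmin d2 d3)) by (repeat apply Rmin_glb_lt; lra).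
    exists (mkposreal _ Hm). intros _ _ u' v' Hu' Hv' Au Av. simpl in *.
    pose proof (Rmin_l (Rmin d d1) (Rmin d2 d3)).
    pose proof (Rmin_r (Rmin d d1) (Rmin d2 d3)).
    pose proof (Rmin_l d d1). pose proof (Rmin_r d d1).
    pose proof (Rmin_l d2 d3). pose proof (Rmin_r d2 d3).
    set (de := Rmin (Rmin d d1) (Rmin d2 d3)) in *.
    apply Rle_trans with B.
    - apply HB; [now apply Sp|].
      destruct (H1 v' ltac:(lra) ltac:(lra)) as [Xp Xm].
      split; simpl; [|lra].
      replace ((1 - u') * xp v' + u' * xm v' - ((1 - u) * xp v + u * xm v)) with
        ((1 - u') * (xp v' - xp v) + (u' * (xm v' - xm v) + (u' - u) * (xm v - xp v)))
        by ring.
      eapply Rle_lt_trans; [apply Rabs_triang|].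
      eapply Rle_lt_trans; [apply Rplus_le_compat_l, Rabs_triang|].
      rewrite !Rabs_mult, (Rabs_pos_eq (1 - u')), (Rabs_pos_eq u') by lra.
      fold w. pose proof (Rabs_pos (xp v' - xp v)). pose proof (Rabs_pos (xm v' - xm v)).
      pose proof (Rabs_pos (u' - u)).
      assert (Rabs (u' - u) * w <= d2 * w) by (apply Rmult_le_compat_r; lra).
      nra.
    - apply Rle_trans with (1 + Rabs B); [pose proof (Rle_abs B); lra|].
      rewrite <- (Rinv_inv (1 + Rabs B)). fold d3.
      apply Rinv_le_contravar; lra. }
  destruct (classical_choice (fun (uv : R * R) (d : posreal) => 0 <= fst uv <= 1 -> 0 <= snd uv <= tau ->
    forall u' v', 0 <= u' <= 1 -> 0 <= v' <= tau ->
      Rabs (u' - fst uv) < d -> Rabs (v' - snd uv) < d -> f (pt u' v') <= / d))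
    as [delta0 Hdelta0].
  { intros [u v]. exact (G u v). }
  set (delta := fun u v => delta0 (u, v)).
  assert (Hdelta := fun u v => Hdelta0 (u, v)). simpl in Hdelta.
  change (forall u v, 0 <= u <= 1 -> 0 <= v <= tau ->
    forall u' v', 0 <= u' <= 1 -> 0 <= v' <= tau ->
      Rabs (u' - u) < delta u v -> Rabs (v' - v) < delta u v ->
      f (pt u' v') <= / delta u v) in Hdelta.
  destruct (compactness_value_2d 0 1 0 tau delta) as [d Hd].
  exists (/ d). intros [x t] [[Dt Dx] Dtau]. simpl in *.
  apply Rnot_lt_le. intros Hlt.
  assert (exists u, 0 <= u <= 1 /\ pt u t = (x, t)) as (u & Hu & Eu).
  { destruct (Req_dec (xp t) (xm t)) as [E|E].
    - exists 0. split; [lra|]. unfold pt. f_equal. lra.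
    - specialize (Hle t Dt). exists ((x - xp t) / (xm t - xp t)). split.
      + split; [apply Rdiv_le_0_compat; lra|].
        apply (Rmult_le_reg_r (xm t - xp t)); [lra|].
        replace ((x - xp t) / (xm t - xp t) * (xm t - xp t)) with (x - xp t)
          by (field; lra). lra.
      + unfold pt. f_equal. field. lra. }
  apply (Hd u t Hu ltac:(lra)).
  intros (u0 & v0 & Hu0 & Hv0 & Au & Av & Hle0).
  specialize (Hdelta u0 v0 Hu0 Hv0 u t Hu ltac:(lra) Au Av).
  rewrite Eu in Hdelta.
  assert (/ delta u0 v0 <= / d) by
    (apply Rinv_le_contravar; [apply cond_pos | exact Hle0]).
  lra.
Qed.

Definition continuous_slab (T : R) (xp xm : R -> R) (tau : R) (f : R * R -> R) :=
  forall p, slab T xp xm tau p -> forall e, 0 < e -> exists d, 0 < d /\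
    forall q, slab T xp xm tau q -> near d p q -> Rabs (f q - f p) < e.

Lemma slab_bounded T xp xm tau f :
  0 <= tau < T -> (forall t, 0 <= t < T -> xp t <= xm t) ->
  continuous_lateral T xp xm -> continuous_slab T xp xm tau f ->
  exists M, forall p, slab T xp xm tau p -> f p <= M.
Proof.
  intros Ht Hle Hc Hf.
  apply (slab_locally_bounded T xp xm tau f Ht Hle Hc).
  intros p Hp. destruct (Hf p Hp 1 Rlt_0_1) as (d & Hd & H).
  exists d, (f p + 1). split; [exact Hd|]. intros q Hq N.
  specialize (H q Hq N). apply Rabs_lt_between in H. lra.
Qed.

(** If the supremum [M] were not attained, [/ (M - f)] would be locally bounded, hence bounded,
    which keeps [f] away from [M]. *)
Lemma slab_max T xp xm tau f :
  0 <= tau < T -> (forall t, 0 <= t < T -> xp t <= xm t) ->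
  continuous_lateral T xp xm -> continuous_slab T xp xm tau f ->
  exists p, slab T xp xm tau p /\ forall q, slab T xp xm tau q -> f q <= f p.
Proof.
  intros Ht Hle Hc Hf.
  assert (Hne : slab T xp xm tau (xp 0, 0)).
  { specialize (Hle 0 ltac:(lra)). split; [split|]; simpl; lra. }
  destruct (slab_bounded T xp xm tau f Ht Hle Hc Hf) as [M0 HM0].
  destruct (completeness (fun y => exists p, slab T xp xm tau p /\ y = f p))
    as [M [Hub Hlub]].
  { exists M0. intros y (p & Hp & ->). now apply HM0. }
  { exists (f (xp 0, 0)), (xp 0, 0). now split. }
  apply NNPP. intros N.
  assert (Hlt : forall p, slab T xp xm tau p -> f p < M).
  { intros p Hp. destruct (Rle_lt_or_eq_dec (f p) M) as [L|E]; [|exact L|].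
    - apply Hub. now exists p.
    - exfalso. apply N. exists p. split; [exact Hp|]. intros q Hq.
      rewrite E. apply Hub. now exists q. }
  destruct (slab_locally_bounded T xp xm tau (fun p => / (M - f p)) Ht Hle Hc)
    as [L HL].
  { intros p Hp. specialize (Hlt p Hp) as Hp'.
    destruct (Hf p Hp ((M - f p) / 2)) as (d & Hd & H); [lra|].
    exists d, (/ ((M - f p) / 2)). split; [exact Hd|]. intros q Hq Nq.
    specialize (H q Hq Nq). apply Rabs_lt_between in H.
    apply Rinv_le_contravar; lra. }
  assert (L0 : 0 < L).
  { specialize (HL _ Hne). specialize (Hlt _ Hne).
    assert (0 < / (M - f (xp 0, 0))) by (apply Rinv_0_lt_compat; lra). lra. }
  assert (M <= M - / L).
  { apply Hlub. intros y (p & Hp & ->). specialize (HL p Hp). specialize (Hlt p Hp).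
    assert (/ L <= M - f p).
    { rewrite <- (Rinv_inv (M - f p)). apply Rinv_le_contravar; [|exact HL].
      apply Rinv_0_lt_compat. lra. }
    lra. }
  assert (0 < / L) by now apply Rinv_0_lt_compat. lra.
Qed.

Lemma filterlim_continuous_slab T xp xm tau f :
  (forall p, region T xp xm p ->
    filterlim f (within (region T xp xm) (locally p)) (locally (f p))) ->
  continuous_slab T xp xm tau f.
Proof.
  intros H p [Dp Tp] e He.
  destruct (H p Dp (fun y => Rabs (y - f p) < e)) as [d Hd].
  { exists (mkposreal e He). intros y Hy. exact Hy. }
  exists d. split; [apply cond_pos|].
  intros q [Dq _] [N1 N2]. apply Hd; [split; assumption | exact Dq].
Qed.

Lemma derive_within_continuous_lateral T xp xm (a b : R -> R) :
  (forall t, 0 <= t < T ->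
    is_derive_within (fun s => 0 <= s < T) xp t (a t) /\
    is_derive_within (fun s => 0 <= s < T) xm t (b t)) ->
  continuous_lateral T xp xm.
Proof.
  intros H v Hv e He. destruct (H v Hv) as [Ha Hb].
  destruct (derive_within_cont _ _ _ _ (Hv : (fun s => 0 <= s < T) v) Ha e He)
    as [d1 [Hd1 H1]].
  destruct (derive_within_cont _ _ _ _ (Hv : (fun s => 0 <= s < T) v) Hb e He)
    as [d2 [Hd2 H2]].
  exists (Rmin d1 d2). split; [now apply Rmin_glb_lt|].
  intros t Ht At. split.
  - apply H1; [exact Ht|]. eapply Rlt_le_trans; [exact At | apply Rmin_l].
  - apply H2; [exact Ht|]. eapply Rlt_le_trans; [exact At | apply Rmin_r].
Qed.

Lemma slab_abs_bounded T xp xm tau f :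
  0 <= tau < T -> (forall t, 0 <= t < T -> xp t <= xm t) ->
  continuous_lateral T xp xm ->
  (forall p, region T xp xm p ->
    filterlim f (within (region T xp xm) (locally p)) (locally (f p))) ->
  exists M, forall p, slab T xp xm tau p -> Rabs (f p) <= M.
Proof.
  intros Ht Hle Hc Hf.
  apply (filterlim_continuous_slab T xp xm tau) in Hf.
  apply (slab_bounded T xp xm tau (fun p => Rabs (f p)) Ht Hle Hc).
  intros p Hp e He. destruct (Hf p Hp e He) as (d & Hd & H).
  exists d. split; [exact Hd|]. intros q Hq N.
  eapply Rle_lt_trans; [apply Rabs_triang_inv2 | now apply H].
Qed.

(** * Primitive form of the balance laws *)

Lemma Derive_c m x : Derive (c m) x = INR m * x ^ pred m.
Proof. unfold c. rewrite Derive_pow; [|auto_derive; trivial]. rewrite Derive_id. ring. Qed.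

Lemma c_pred m x : (1 <= m)%nat -> c m x = x * x ^ pred m.
Proof. intros H. unfold c. destruct m; [lia|]. reflexivity. Qed.

Lemma gradient_c D m p : D p ->
  is_gradient_within D (fun q => c m (fst q)) p (INR m * fst p ^ pred m) 0.
Proof.
  intros Dp. eapply gradient_eq.
  - apply (gradient_comp D fst p 1 0 (c m) (INR m * fst p ^ pred m) Dp (gradient_fst D p)).
    unfold c. auto_derive; [trivial|]. ring.
  - ring.
  - ring.
Qed.

Lemma gradient_opp D f p fx ft : D p ->
  is_gradient_within D f p fx ft ->
  is_gradient_within D (fun y => - f y) p (- fx) (- ft).
Proof.
  intros Dp Hf. eapply gradient_eq.
  - apply (gradient_comp D f p fx ft (fun a => - a) (-1) Dp Hf).
    auto_derive; trivial.
  - ring.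
  - ring.
Qed.

Lemma gradient_minus D f g p fx ft gx gt : D p ->
  is_gradient_within D f p fx ft -> is_gradient_within D g p gx gt ->
  is_gradient_within D (fun y => f y - g y) p (fx - gx) (ft - gt).
Proof.
  intros Dp Hf Hg. apply gradient_plus; [exact Hf | now apply gradient_opp].
Qed.

Lemma gradient_inv D f p fx ft : D p -> f p <> 0 ->
  is_gradient_within D f p fx ft ->
  is_gradient_within D (fun y => / f y) p (- fx / (f p) ^ 2) (- ft / (f p) ^ 2).
Proof.
  intros Dp H0 Hf. eapply gradient_eq.
  - apply (gradient_comp D f p fx ft (fun a => / a) (- / (f p) ^ 2) Dp Hf).
    auto_derive; [exact H0|]. field. exact H0.
  - field. exact H0.
  - field. exact H0.
Qed.

Lemma gradient_sqr D f p fx ft : D p ->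
  is_gradient_within D f p fx ft ->
  is_gradient_within D (fun y => f y ^ 2) p (2 * f p * fx) (2 * f p * ft).
Proof.
  intros Dp Hf.
  apply (gradient_comp D f p fx ft (fun a => a ^ 2) (2 * f p) Dp Hf).
  auto_derive; [trivial|]. ring.
Qed.

Lemma mass_gradient D m rb p bx bt : D p ->
  is_gradient_within D rb p bx bt ->
  is_gradient_within D (fun q => c m (fst q) * rb q) p
    (INR m * fst p ^ pred m * rb p + c m (fst p) * bx) (c m (fst p) * bt).
Proof.
  intros Dp Hb. eapply gradient_eq.
  - exact (gradient_mult D _ _ p _ _ _ _ Dp (gradient_c D m p Dp) Hb).
  - reflexivity.
  - cbv beta. ring.
Qed.

Lemma momentum_gradient D m rb u p bx bt ux ut : D p ->
  is_gradient_within D rb p bx bt -> is_gradient_within D u p ux ut ->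
  is_gradient_within D (fun q => c m (fst q) * rb q * u q) p
    ((INR m * fst p ^ pred m * rb p + c m (fst p) * bx) * u p + c m (fst p) * rb p * ux)
    (c m (fst p) * bt * u p + c m (fst p) * rb p * ut).
Proof.
  intros Dp Hb Hu.
  exact (gradient_mult D _ _ p _ _ _ _ Dp (mass_gradient D m rb p bx bt Dp Hb) Hu).
Qed.

(** Only the [x]-slope of the flux enters the balance law, so the [t]-slope is left unspecified. *)
Lemma momentum_flux_gradient D m rb u p bx bt ux ut : D p -> rb p <> 0 ->
  is_gradient_within D rb p bx bt -> is_gradient_within D u p ux ut ->
  exists ft, is_gradient_within D
    (fun q => c m (fst q) * rb q * u q ^ 2 - c m (fst q) * / rb q) p
    ((INR m * fst p ^ pred m * rb p + c m (fst p) * bx) * u p ^ 2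
      + c m (fst p) * rb p * (2 * u p * ux)
      - (INR m * fst p ^ pred m * / rb p + c m (fst p) * (- bx / rb p ^ 2))) ft.
Proof.
  intros Dp H0 Hb Hu. eexists.
  apply gradient_minus; [exact Dp| |].
  - apply (gradient_mult D _ _ p _ _ _ _ Dp (mass_gradient D m rb p bx bt Dp Hb)
      (gradient_sqr D u p ux ut Dp Hu)).
  - apply (gradient_mult D _ _ p _ _ _ _ Dp (gradient_c D m p Dp)
      (gradient_inv D rb p bx bt Dp H0 Hb)).
Qed.

(** The balance laws only assert that some relative gradients exist; uniqueness of gradients
    identifies them with those of the product rule. In the momentum law the source cancels the term
    in which [c] is differentiated in the pressure, and subtracting [u] times the mass equation
    leaves an equation free of [c]. *)
Lemma primitive_equations m T xp xm rb u x t bx bt ux ut v :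
  (1 <= m)%nat -> 0 < t < T -> xp t <= x <= xm t -> 0 < x ->
  (forall s, 0 <= s < T -> xp s < xm s) -> admissible T xp xm t x v ->
  0 < rb (x, t) ->
  balance_law (region T xp xm) (fun p => c m (fst p) * rb p)
    (fun p => c m (fst p) * rb p * u p) (fun _ => 0) ->
  balance_law (region T xp xm) (fun p => c m (fst p) * rb p * u p)
    (fun p => c m (fst p) * rb p * u p ^ 2 - c m (fst p) * / rb p)
    (fun p => - Derive (c m) (fst p) * / rb p) ->
  is_gradient_within (region T xp xm) rb (x, t) bx bt ->
  is_gradient_within (region T xp xm) u (x, t) ux ut ->
  bt + u (x, t) * bx + rb (x, t) * ux + INR m / x * rb (x, t) * u (x, t) = 0 /\
  ut + u (x, t) * ux + bx / rb (x, t) ^ 3 = 0.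
Proof.
  intros Hm Ht Hx Hx0 Hlt Hv Hrb B1 B2 Hb Hu.
  set (D := region T xp xm) in *.
  assert (Dp : D (x, t)) by (split; simpl; lra).
  destruct (B1 _ Dp) as (qx & qt & fx & ft & Q & F & E1).
  destruct (gradient_unique T xp xm _ x t _ _ _ _ v Ht Hx Hlt Hv Q
    (mass_gradient D m rb _ _ _ Dp Hb)) as [_ Eqt].
  destruct (gradient_unique T xp xm _ x t _ _ _ _ v Ht Hx Hlt Hv F
    (momentum_gradient D m rb u _ _ _ _ _ Dp Hb Hu)) as [Efx _].
  destruct (B2 _ Dp) as (qx' & qt' & fx' & ft' & Q' & F' & E2).
  destruct (gradient_unique T xp xm _ x t _ _ _ _ v Ht Hx Hlt Hv Q'
    (momentum_gradient D m rb u _ _ _ _ _ Dp Hb Hu)) as [_ Eqt'].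
  destruct (momentum_flux_gradient D m rb u _ _ _ _ _ Dp (Rgt_not_eq _ _ Hrb) Hb Hu)
    as [gt G].
  destruct (gradient_unique T xp xm _ x t _ _ _ _ v Ht Hx Hlt Hv F' G) as [Efx' _].
  simpl fst in *. rewrite Derive_c in E2.
  rewrite (c_pred m x Hm) in *.
  set (P := x ^ pred m) in *. set (b := rb (x, t)) in *. set (w := u (x, t)) in *.
  assert (HP : 0 < P) by now apply pow_lt.
  assert (X : x * P <> 0) by (apply Rgt_not_eq, Rmult_lt_0_compat; assumption).
  subst qt fx qt' fx'.
  assert (M : bt + w * bx + b * ux + INR m / x * b * w = 0).
  { apply (Rmult_eq_reg_l (x * P)); [|exact X].
    rewrite Rmult_0_r, <- E1. field. lra. }
  split; [exact M|].
  apply (Rmult_eq_reg_l (x * P * b)); [|apply Rmult_integral_contrapositive; split; lra].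
  rewrite Rmult_0_r.
  transitivity ((x * P * bt * w + x * P * b * ut +
     ((INR m * P * b + x * P * bx) * w ^ 2 + x * P * b * (2 * w * ux) -
      (INR m * P * / b + x * P * (- bx / b ^ 2))) - (- (INR m * P) * / b))
    - w * (x * P) * (bt + w * bx + b * ux + INR m / x * b * w)).
  - field. lra.
  - rewrite E2, M. ring.
Qed.

(** At a positive maximum of [exp (- k t) * (sg * V)] over the past, the transport
    derivative of [V] would have to be at least [k V]. *)
Lemma no_positive_past_max T xp xm tau V W x t Vx Vt v K sg :
  0 < t < T -> t <= tau -> xp t <= x <= xm t ->
  (forall s, 0 <= s < T -> xp s <= xm s) -> admissible T xp xm t x v ->
  is_gradient_within (region T xp xm) V (x, t) Vx Vt ->
  Rabs (Vt + v * Vx) <= K * (Rabs (V (x, t)) + Rabs W) ->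
  sg = 1 \/ sg = -1 -> 0 <= K ->
  0 < sg * V (x, t) -> Rabs W <= sg * V (x, t) ->
  (forall p, slab T xp xm tau p ->
     exp (- (2 * K + 1) * snd p) * (sg * V p)
       <= exp (- (2 * K + 1) * t) * (sg * V (x, t))) ->
  False.
Proof.
  intros Ht Htau Hx Hle Hv HV HVK Hsg HK Hpos HW Hmax.
  set (k := 2 * K + 1) in *.
  set (D := region T xp xm) in *.
  assert (Dp : D (x, t)) by (split; simpl; lra).
  assert (G : is_gradient_within D (fun p => exp (- k * snd p) * (sg * V p)) (x, t)
    (exp (- k * t) * (sg * Vx)) (exp (- k * t) * (sg * Vt - k * (sg * V (x, t))))).
  { eapply gradient_eq.
    - eapply (gradient_mult D (fun p => exp (- k * snd p)) (fun p => sg * V p) (x, t)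
        _ _ _ _ Dp).
      + apply (gradient_comp D snd (x, t) 0 1 (fun a => exp (- k * a))
          (- k * exp (- k * t)) Dp (gradient_snd D _)).
        auto_derive; [trivial|]. simpl. ring.
      + apply (gradient_comp D V (x, t) Vx Vt (fun a => sg * a) sg Dp HV).
        auto_derive; [trivial|]. ring.
    - cbv beta. simpl. ring.
    - cbv beta. simpl. ring. }
  assert (H := gradient_at_past_max T xp xm _ x t _ _ v Ht Hx Hle Hv G).
  cbv beta in H. simpl snd in H.
  assert (H1 : forall p, region T xp xm p -> snd p <= t ->
    exp (- k * snd p) * (sg * V p) <= exp (- k * t) * (sg * V (x, t))).
  { intros p Hp Hpt. apply Hmax. split; [exact Hp | lra]. }
  specialize (H H1).
  replace (exp (- k * t) * (sg * Vt - k * (sg * V (x, t))) +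
    v * (exp (- k * t) * (sg * Vx))) with
    (exp (- k * t) * (sg * (Vt + v * Vx) - k * (sg * V (x, t)))) in H by ring.
  pose proof (exp_pos (- k * t)) as Hexp.
  assert (H2 : 0 <= sg * (Vt + v * Vx) - k * (sg * V (x, t))).
  { apply (Rmult_le_reg_l (exp (- k * t))); [exact Hexp|]. now rewrite Rmult_0_r. }
  assert (Rabs (V (x, t)) = sg * V (x, t)).
  { destruct Hsg as [-> | ->].
    - rewrite Rabs_pos_eq; lra.
    - rewrite Rabs_left; lra. }
  assert (sg * (Vt + v * Vx) <= Rabs (Vt + v * Vx)).
  { pose proof (Rle_abs (Vt + v * Vx)). pose proof (Rle_abs (- (Vt + v * Vx))).
    rewrite Rabs_Ropp in *. destruct Hsg as [-> | ->]; lra. }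
  assert (K * (Rabs (V (x, t)) + Rabs W) <= K * (2 * (sg * V (x, t))))
    by (apply Rmult_le_compat_l; lra).
  unfold k in *. nra.
Qed.

Lemma exp_weight_slab T xp xm tau V k sg :
  (forall p, region T xp xm p -> exists fx ft,
     is_gradient_within (region T xp xm) V p fx ft) ->
  continuous_slab T xp xm tau (fun p => exp (k * snd p) * (sg * V p)).
Proof.
  intros H. apply filterlim_continuous_slab. intros p Dp.
  destruct (H p Dp) as (fx & ft & G).
  eapply gradient_cont.
  eapply (gradient_mult _ (fun p => exp (k * snd p)) (fun p => sg * V p) p _ _ _ _ Dp).
  - apply (gradient_comp _ snd p 0 1 (fun a => exp (k * a))
      (k * exp (k * snd p)) Dp (gradient_snd _ _)).
    auto_derive; [trivial|]. ring.
  - apply (gradient_comp _ V p fx ft (fun a => sg * a) sg Dp G).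
    auto_derive; [trivial|]. ring.
Qed.

(** Of the weighted maxima of [V], [- V], [W] and [- W] the largest is attained where its
    own field dominates the other one, so the coupling cannot make it positive. *)
Lemma coupled_transport_zero T xp xm tau V W r s K :
  0 <= tau < T -> (forall t, 0 <= t < T -> xp t <= xm t) ->
  continuous_lateral T xp xm -> 0 <= K ->
  (forall p, region T xp xm p -> exists fx ft,
     is_gradient_within (region T xp xm) V p fx ft /\
     (slab T xp xm tau p -> 0 < snd p -> admissible T xp xm (snd p) (fst p) (r p) /\
        Rabs (ft + r p * fx) <= K * (Rabs (V p) + Rabs (W p)))) ->
  (forall p, region T xp xm p -> exists fx ft,
     is_gradient_within (region T xp xm) W p fx ft /\
     (slab T xp xm tau p -> 0 < snd p -> admissible T xp xm (snd p) (fst p) (s p) /\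
        Rabs (ft + s p * fx) <= K * (Rabs (W p) + Rabs (V p)))) ->
  (forall p, region T xp xm p -> snd p = 0 -> V p = 0 /\ W p = 0) ->
  forall p, slab T xp xm tau p -> V p = 0 /\ W p = 0.
Proof.
  intros Ht Hle Hc HK HV HW H0.
  set (k := 2 * K + 1).
  assert (GV : forall p, region T xp xm p -> exists fx ft,
    is_gradient_within (region T xp xm) V p fx ft).
  { intros p Dp. destruct (HV p Dp) as (fx & ft & G & _). eauto. }
  assert (GW : forall p, region T xp xm p -> exists fx ft,
    is_gradient_within (region T xp xm) W p fx ft).
  { intros p Dp. destruct (HW p Dp) as (fx & ft & G & _). eauto. }
  destruct (slab_max T xp xm tau _ Ht Hle Hc (exp_weight_slab T xp xm tau V (- k) 1 GV))
    as (p1 & S1 & M1).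
  destruct (slab_max T xp xm tau _ Ht Hle Hc (exp_weight_slab T xp xm tau V (- k) (-1) GV))
    as (p2 & S2 & M2).
  destruct (slab_max T xp xm tau _ Ht Hle Hc (exp_weight_slab T xp xm tau W (- k) 1 GW))
    as (p3 & S3 & M3).
  destruct (slab_max T xp xm tau _ Ht Hle Hc (exp_weight_slab T xp xm tau W (- k) (-1) GW))
    as (p4 & S4 & M4).
  cbv beta in *.
  set (E := fun p : R * R => exp (- k * snd p)).
  assert (HE : forall p, 0 < E p) by (intros; apply exp_pos).
  change (forall q, slab T xp xm tau q -> E q * (1 * V q) <= E p1 * (1 * V p1)) in M1.
  change (forall q, slab T xp xm tau q -> E q * (-1 * V q) <= E p2 * (-1 * V p2)) in M2.
  change (forall q, slab T xp xm tau q -> E q * (1 * W q) <= E p3 * (1 * W p3)) in M3.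
  change (forall q, slab T xp xm tau q -> E q * (-1 * W q) <= E p4 * (-1 * W p4)) in M4.
  set (m1 := E p1 * (1 * V p1)) in *. set (m2 := E p2 * (-1 * V p2)) in *.
  set (m3 := E p3 * (1 * W p3)) in *. set (m4 := E p4 * (-1 * W p4)) in *.
  assert (core : forall V W r,
    (forall p, region T xp xm p -> exists fx ft,
     is_gradient_within (region T xp xm) V p fx ft /\
     (slab T xp xm tau p -> 0 < snd p -> admissible T xp xm (snd p) (fst p) (r p) /\
        Rabs (ft + r p * fx) <= K * (Rabs (V p) + Rabs (W p)))) ->
    (forall p, region T xp xm p -> snd p = 0 -> V p = 0) ->
    forall sg p, sg = 1 \/ sg = -1 -> slab T xp xm tau p ->
    (forall q, slab T xp xm tau q -> E q * (sg * V q) <= E p * (sg * V p)) ->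
    (forall q, slab T xp xm tau q -> E q * Rabs (W q) <= E p * (sg * V p)) ->
    E p * (sg * V p) <= 0).
  { clear - HK Hle HE Ht. intros V W r HV H0 sg p Hsg Sp HM HN.
    apply Rnot_lt_le. intros Hpos.
    assert (Hpos' : 0 < sg * V p).
    { specialize (HE p). apply (Rmult_lt_reg_l (E p)); [exact HE|]. now rewrite Rmult_0_r. }
    destruct (HV p (proj1 Sp)) as (fx & ft & G & A).
    assert (Htp : 0 < snd p).
    { destruct Sp as [Sp1 _]. destruct (Req_dec (snd p) 0) as [Z|Z].
      - rewrite (H0 p Sp1 Z) in Hpos'. lra.
      - destruct Sp1. lra. }
    destruct (A Sp Htp) as [Ad B].
    destruct p as [x t]. destruct Sp as [[Sp1 Sp2] Sp3]. simpl in *.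
    apply (no_positive_past_max T xp xm tau V (W (x, t)) x t fx ft (r (x, t)) K sg);
      try assumption; try lra.
    specialize (HN (x, t) (conj (conj Sp1 Sp2) Sp3)).
    apply (Rmult_le_reg_l (E (x, t))); [apply HE | exact HN]. }
  assert (absle : forall (F : R * R -> R) q M, E q * (1 * F q) <= M -> E q * (-1 * F q) <= M ->
    E q * Rabs (F q) <= M).
  { intros F q M A B. unfold Rabs. destruct Rcase_abs; [|].
    - replace (E q * - F q) with (E q * (-1 * F q)) by ring. exact B.
    - replace (E q * F q) with (E q * (1 * F q)) by ring. exact A. }
  assert (Z : m1 <= 0 /\ m2 <= 0 /\ m3 <= 0 /\ m4 <= 0).
  { assert (V0 : forall p, region T xp xm p -> snd p = 0 -> V p = 0) by (intros; now apply H0).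
    assert (W0 : forall p, region T xp xm p -> snd p = 0 -> W p = 0) by (intros; now apply H0).
    assert (C1 : m2 <= m1 -> m3 <= m1 -> m4 <= m1 -> m1 <= 0).
    { intros A2 A3 A4. apply (core V W r HV V0 1 p1); [now left|exact S1|exact M1|].
      intros q Sq. fold m1. apply absle; [specialize (M3 q Sq)|specialize (M4 q Sq)]; lra. }
    assert (C2 : m1 <= m2 -> m3 <= m2 -> m4 <= m2 -> m2 <= 0).
    { intros A2 A3 A4. apply (core V W r HV V0 (-1) p2); [now right|exact S2|exact M2|].
      intros q Sq. fold m2. apply absle; [specialize (M3 q Sq)|specialize (M4 q Sq)]; lra. }
    assert (C3 : m1 <= m3 -> m2 <= m3 -> m4 <= m3 -> m3 <= 0).
    { intros A2 A3 A4. apply (core W V s HW W0 1 p3); [now left|exact S3|exact M3|].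
      intros q Sq. fold m3. apply absle; [specialize (M1 q Sq)|specialize (M2 q Sq)]; lra. }
    assert (C4 : m1 <= m4 -> m2 <= m4 -> m3 <= m4 -> m4 <= 0).
    { intros A2 A3 A4. apply (core W V s HW W0 (-1) p4); [now right|exact S4|exact M4|].
      intros q Sq. fold m4. apply absle; [specialize (M1 q Sq)|specialize (M2 q Sq)]; lra. }
    destruct (Rle_dec m1 m2), (Rle_dec m3 m4), (Rle_dec m1 m3), (Rle_dec m1 m4),
      (Rle_dec m2 m3), (Rle_dec m2 m4); lra. }
  destruct Z as (Z1 & Z2 & Z3 & Z4).
  intros p Sp. specialize (HE p).
  split.
  - specialize (M1 p Sp). specialize (M2 p Sp).
    assert (E p * V p = 0) by lra. apply Rmult_integral in H. lra.
  - specialize (M3 p Sp). specialize (M4 p Sp).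
    assert (E p * W p = 0) by lra. apply Rmult_integral in H. lra.
Qed.

(** * Uniqueness of classical solutions *)

Lemma riemann_equations M x b u bx bt ux ut :
  0 < x -> 0 < b ->
  bt + u * bx + b * ux + M / x * b * u = 0 ->
  ut + u * ux + bx / b ^ 3 = 0 ->
  (ut + - bt / b ^ 2) + (u - / b) * (ux + - bx / b ^ 2)
    = M / (4 * x) * ((u + / b) ^ 2 - (u - / b) ^ 2) /\
  (ut - - bt / b ^ 2) + (u + / b) * (ux - - bx / b ^ 2)
    = M / (4 * x) * ((u - / b) ^ 2 - (u + / b) ^ 2).
Proof.
  intros Hx Hb E1 E2.
  assert (Ebt : bt = - (u * bx + b * ux + M / x * b * u)) by lra.
  assert (Eut : ut = - (u * ux + bx / b ^ 3)) by lra.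
  subst bt ut. split; field; lra.
Qed.

Lemma abs_add_le a b A B : Rabs a <= A -> Rabs b <= B -> Rabs (a + b) <= A + B.
Proof. intros. eapply Rle_trans; [apply Rabs_triang | lra]. Qed.

Lemma abs_sub_le a b A B : Rabs a <= A -> Rabs b <= B -> Rabs (a - b) <= A + B.
Proof. intros. apply abs_add_le; [assumption | now rewrite Rabs_Ropp]. Qed.

Lemma abs_mul_le a b A B : Rabs a <= A -> Rabs b <= B -> Rabs (a * b) <= A * B.
Proof.
  intros. rewrite Rabs_mult. apply Rmult_le_compat; auto using Rabs_pos.
Qed.

(** The difference of the sources factors through [S1 - S2] and [R1 - R2], and replacing the
    transport speed [R2] by [R1] costs [(R1 - R2) * S2x]. Hence only the slope of the second
    solution has to be bounded. *)
Lemma transport_difference_bound k K N B S1 S2 R1 R2 S1t S1x S2t S2x :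
  S1t + R1 * S1x = k * (S1 ^ 2 - R1 ^ 2) -> S2t + R2 * S2x = k * (S2 ^ 2 - R2 ^ 2) ->
  Rabs k <= K -> Rabs (S1 + S2) <= N -> Rabs (R1 + R2) <= N -> Rabs S2x <= B ->
  Rabs (S1t - S2t + R1 * (S1x - S2x)) <= (K * N + B) * (Rabs (S1 - S2) + Rabs (R1 - R2)).
Proof.
  intros E1 E2 Hk HS HR HB.
  replace (S1t - S2t + R1 * (S1x - S2x)) with
    (k * (S1 + S2) * (S1 - S2) - (k * (R1 + R2) * (R1 - R2) + S2x * (R1 - R2))).
  2: { transitivity (S1t + R1 * S1x - (S2t + R2 * S2x) - (R1 - R2) * S2x);
         [rewrite E1, E2|]; ring. }
  apply Rle_trans with (K * N * Rabs (S1 - S2) +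
    (K * N * Rabs (R1 - R2) + B * Rabs (R1 - R2))).
  - apply abs_sub_le; [|apply abs_add_le];
      repeat (apply abs_mul_le; [|try assumption; try apply Rle_refl]); assumption.
  - pose proof (Rabs_pos S2x). pose proof (Rabs_pos (S1 - S2)). nra.
Qed.

(** The roles are asymmetric: the lateral boundaries are characteristics of the first solution only.
    The differences of [S] and [R] are therefore transported with the speeds of the first solution,
    which are admissible up to the boundary, while the slopes that enter the bounds belong to the
    second. *)
Lemma classical_unique m T xp xm rho0 u0 rb1 u1 rb2 u2 :
  (1 <= m)%nat -> xp 0 = 1 -> xm 0 = 3 ->
  (forall t, 0 <= t < T -> 0 < xp t < xm t /\
     is_derive_within (fun s => 0 <= s < T) xp t (u1 (xp t, t) + / rb1 (xp t, t)) /\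
     is_derive_within (fun s => 0 <= s < T) xm t (u1 (xm t, t) - / rb1 (xm t, t))) ->
  classical_solution m (region T xp xm) rho0 u0 rb1 u1 ->
  classical_solution m (region T xp xm) rho0 u0 rb2 u2 ->
  forall p, region T xp xm p -> rb1 p = rb2 p /\ u1 p = u2 p.
Proof.
  intros Hm Hp0 Hm0 Hbd
    ((b1x & b1t & Gb1 & _ & _) & (u1x & u1t & Gu1 & _ & _) & Pos1 & Ba1 & Bb1 & I1)
    ((b2x & b2t & Gb2 & Cb2x & _) & (u2x & u2t & Gu2 & Cu2x & _) & Pos2 & Ba2 & Bb2 & I2)
    p Dp.
  set (D := region T xp xm) in *.
  assert (Hlt : forall t, 0 <= t < T -> xp t < xm t) by (intros; now apply Hbd).
  assert (Hle : forall t, 0 <= t < T -> xp t <= xm t) by (intros; now apply Rlt_le, Hlt).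
  assert (Hc : continuous_lateral T xp xm).
  { eapply derive_within_continuous_lateral. intros t Ht.
    exact (proj2 (Hbd t Ht)). }
  assert (Xpos : forall q, D q -> 0 < fst q).
  { intros q [Hq1 Hq2]. destruct (Hbd _ Hq1). lra. }
  assert (Gi1 : forall q, D q -> is_gradient_within D (fun y => / rb1 y) q
    (- b1x q / rb1 q ^ 2) (- b1t q / rb1 q ^ 2)).
  { intros q Dq. apply gradient_inv; [exact Dq| |now apply Gb1].
    specialize (Pos1 q Dq). lra. }
  assert (Gi2 : forall q, D q -> is_gradient_within D (fun y => / rb2 y) q
    (- b2x q / rb2 q ^ 2) (- b2t q / rb2 q ^ 2)).
  { intros q Dq. apply gradient_inv; [exact Dq| |now apply Gb2].
    specialize (Pos2 q Dq). lra. }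
  set (tau := snd p).
  assert (Htau : 0 <= tau < T) by (exact (proj1 Dp)).
  assert (bdd : forall f, (forall q, D q ->
      filterlim f (within D (locally q)) (locally (f q))) ->
    exists M, 0 <= M /\ forall q, slab T xp xm tau q -> Rabs (f q) <= M).
  { intros f Hf. destruct (slab_abs_bounded T xp xm tau f Htau Hle Hc Hf) as [M HM].
    exists M. split; [|exact HM].
    apply Rle_trans with (Rabs (f p)); [apply Rabs_pos|]. apply HM.
    split; [exact Dp | apply Rle_refl]. }
  destruct (bdd u1) as (M1 & N1 & B1);
    [intros q Dq; eapply gradient_cont; now apply Gu1|].
  destruct (bdd u2) as (M2 & N2 & B2);
    [intros q Dq; eapply gradient_cont; now apply Gu2|].
  destruct (bdd (fun y => / rb1 y)) as (M3 & N3 & B3);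
    [intros q Dq; exact (gradient_cont _ _ _ _ _ (Gi1 q Dq))|].
  destruct (bdd (fun y => / rb2 y)) as (M4 & N4 & B4);
    [intros q Dq; exact (gradient_cont _ _ _ _ _ (Gi2 q Dq))|].
  destruct (bdd u2x) as (M5 & N5 & B5); [exact Cu2x|].
  destruct (bdd b2x) as (M6 & N6 & B6); [exact Cb2x|].
  destruct (bdd (fun y => / fst y)) as (M7 & N7 & B7).
  { intros q Dq. specialize (Xpos q Dq).
    exact (gradient_cont _ _ _ _ _ (gradient_inv D fst q 1 0 Dq (Rgt_not_eq _ _ Xpos)
      (gradient_fst D q))). }
  set (K := INR m / 4 * M7). set (N := M1 + M3 + (M2 + M4)). set (B := M5 + M6 * (M4 * M4)).
  assert (HK : 0 <= K * N + B).
  { unfold K, N, B. pose proof (pos_INR m).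
    repeat first [apply Rplus_le_le_0_compat | apply Rmult_le_pos]; lra. }
  assert (Bd : forall q, slab T xp xm tau q ->
    Rabs (INR m / (4 * fst q)) <= K /\
    Rabs (u1 q + / rb1 q + (u2 q + / rb2 q)) <= N /\
    Rabs (u1 q - / rb1 q + (u2 q - / rb2 q)) <= N /\
    Rabs (u2x q + - b2x q / rb2 q ^ 2) <= B /\ Rabs (u2x q - - b2x q / rb2 q ^ 2) <= B).
  { intros q Sq. specialize (B1 q Sq). specialize (B2 q Sq). specialize (B3 q Sq).
    specialize (B4 q Sq). specialize (B5 q Sq). specialize (B6 q Sq).
    specialize (B7 q Sq). cbv beta in *.
    specialize (Xpos q (proj1 Sq)). specialize (Pos2 q (proj1 Sq)).
    replace (INR m / (4 * fst q)) with (INR m / 4 * / fst q) by (field; lra).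
    replace (- b2x q / rb2 q ^ 2) with (- (b2x q * (/ rb2 q * / rb2 q))) by (field; lra).
    assert (B8 : Rabs (b2x q * (/ rb2 q * / rb2 q)) <= M6 * (M4 * M4))
      by (apply abs_mul_le; [exact B6 | now apply abs_mul_le]).
    split; [|split; [|split; [|split]]].
    - apply abs_mul_le; [|exact B7].
      rewrite Rabs_pos_eq; [lra | pose proof (pos_INR m); lra].
    - apply abs_add_le; apply abs_add_le; assumption.
    - apply abs_add_le; apply abs_sub_le; assumption.
    - apply abs_add_le; [|rewrite Rabs_Ropp]; assumption.
    - apply abs_sub_le; [|rewrite Rabs_Ropp]; assumption. }
  set (V := fun q => u1 q + / rb1 q - (u2 q + / rb2 q)).
  set (W := fun q => u1 q - / rb1 q - (u2 q - / rb2 q)).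
  assert (Adm : forall q v, D q -> u1 q - / rb1 q <= v <= u1 q + / rb1 q ->
    admissible T xp xm (snd q) (fst q) v).
  { intros [x t] v [Dq1 Dq2] Hv. simpl in *. destruct (Hbd t Dq1) as (_ & Ha & Hb).
    exists (u1 (xp t, t) + / rb1 (xp t, t)), (u1 (xm t, t) - / rb1 (xm t, t)).
    split; [exact Ha|]. split; [exact Hb|].
    split; intros ->; lra. }
  assert (Eqs : forall q, D q -> 0 < snd q ->
    (b1t q + u1 q * b1x q + rb1 q * u1x q + INR m / fst q * rb1 q * u1 q = 0 /\
     u1t q + u1 q * u1x q + b1x q / rb1 q ^ 3 = 0) /\
    (b2t q + u2 q * b2x q + rb2 q * u2x q + INR m / fst q * rb2 q * u2 q = 0 /\
     u2t q + u2 q * u2x q + b2x q / rb2 q ^ 3 = 0)).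
  { intros [x t] Dq Hq. simpl in *.
    (* The velocity of the first solution lies between its two characteristic speeds, so it is
       admissible. This one direction makes the gradients of both solutions unique. *)
    assert (Hv : admissible T xp xm t x (u1 (x, t))).
    { apply (Adm (x, t) _ Dq). assert (0 < / rb1 (x, t)) by
        (apply Rinv_0_lt_compat, Pos1, Dq). lra. }
    assert (Dq' := Dq). destruct Dq' as [Dq1 Dq2]. simpl in *.
    split.
    - apply (primitive_equations m T xp xm rb1 u1 x t _ _ _ _ (u1 (x, t)));
        try assumption; try lra.
      + apply (Xpos _ Dq).
      + now apply Pos1.
      + now apply Gb1.
      + now apply Gu1.
    - apply (primitive_equations m T xp xm rb2 u2 x t _ _ _ _ (u1 (x, t)));
        try assumption; try lra.
      + apply (Xpos _ Dq).
      + now apply Pos2.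
      + now apply Gb2.
      + now apply Gu2. }
  assert (Z : V p = 0 /\ W p = 0).
  { apply (coupled_transport_zero T xp xm tau V W
      (fun q => u1 q - / rb1 q) (fun q => u1 q + / rb1 q) (K * N + B)); try assumption.
    - intros q Dq.
      exists ((u1x q + - b1x q / rb1 q ^ 2) - (u2x q + - b2x q / rb2 q ^ 2)),
        ((u1t q + - b1t q / rb1 q ^ 2) - (u2t q + - b2t q / rb2 q ^ 2)).
      split.
      + apply (gradient_minus D (fun y => u1 y + / rb1 y) (fun y => u2 y + / rb2 y));
          [exact Dq| |]; apply gradient_plus; auto.
      + intros Sq Hq.
        assert (Hw1 : 0 < / rb1 q) by (now apply Rinv_0_lt_compat, Pos1).
        split; [apply Adm; [exact Dq | lra]|].
        destruct (Eqs q Dq Hq) as [[E1 E2] [E3 E4]].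
        destruct (riemann_equations (INR m) (fst q) _ _ _ _ _ _ (Xpos q Dq) (Pos1 q Dq) E1 E2)
          as [F1 _].
        destruct (riemann_equations (INR m) (fst q) _ _ _ _ _ _ (Xpos q Dq) (Pos2 q Dq) E3 E4)
          as [F2 _].
        destruct (Bd q Sq) as (K1 & K2 & K3 & K4 & _).
        exact (transport_difference_bound _ _ _ _ _ _ _ _ _ _ _ _ F1 F2 K1 K2 K3 K4).
    - intros q Dq.
      exists ((u1x q - - b1x q / rb1 q ^ 2) - (u2x q - - b2x q / rb2 q ^ 2)),
        ((u1t q - - b1t q / rb1 q ^ 2) - (u2t q - - b2t q / rb2 q ^ 2)).
      split.
      + apply (gradient_minus D (fun y => u1 y - / rb1 y) (fun y => u2 y - / rb2 y));
          [exact Dq| |]; apply gradient_minus; auto.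
      + intros Sq Hq.
        assert (Hw1 : 0 < / rb1 q) by (now apply Rinv_0_lt_compat, Pos1).
        split; [apply Adm; [exact Dq | lra]|].
        destruct (Eqs q Dq Hq) as [[E1 E2] [E3 E4]].
        destruct (riemann_equations (INR m) (fst q) _ _ _ _ _ _ (Xpos q Dq) (Pos1 q Dq) E1 E2)
          as [_ F1].
        destruct (riemann_equations (INR m) (fst q) _ _ _ _ _ _ (Xpos q Dq) (Pos2 q Dq) E3 E4)
          as [_ F2].
        destruct (Bd q Sq) as (K1 & K2 & K3 & _ & K4).
        exact (transport_difference_bound _ _ _ _ _ _ _ _ _ _ _ _ F1 F2 K1 K3 K2 K4).
    - intros [x t] [Dq1 Dq2] Hq. simpl in *. subst t.
      destruct (I1 x ltac:(lra)) as [R1 U1]. destruct (I2 x ltac:(lra)) as [R2 U2].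
      assert (Eb : rb1 (x, 0) = rb2 (x, 0)).
      { unfold rho, c in R1, R2. simpl in R1, R2.
        apply (Rmult_eq_reg_l (x ^ m)); [congruence|].
        apply pow_nonzero. lra. }
      unfold V, W. rewrite Eb, U1, U2. split; ring.
    - split; [exact Dp | apply Rle_refl]. }
  destruct Z as [ZV ZW]. unfold V, W in *.
  split; [|lra].
  apply Rinv_eq_reg. lra.
Qed.

(** * Picard iteration *)

Definition lipschitz2 (L : R) (F : R -> R -> R) : Prop :=
  forall x y x' y', Rabs (F x y - F x' y') <= L * (Rabs (x - x') + Rabs (y - y')).

Lemma lipschitz2_continuous L F (f g : R -> R) t :
  lipschitz2 L F -> continuous f t -> continuous g t ->
  continuous (fun s => F (f s) (g s)) t.
Proof.
  intros HL Hf Hg P [e He].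
  assert (HL0 : 0 <= L).
  { specialize (HL 1 0 0 0). rewrite !Rminus_0_r, Rabs_R0, Rabs_R1 in HL.
    pose proof (Rabs_pos (F 1 0 - F 0 0)). lra. }
  assert (Hd : 0 < e / (2 * (1 + L))).
  { apply Rdiv_lt_0_compat; [apply cond_pos | lra]. }
  specialize (Hf (ball (f t) (mkposreal _ Hd)) (locally_ball _ _)).
  specialize (Hg (ball (g t) (mkposreal _ Hd)) (locally_ball _ _)).
  unfold filtermap in *. generalize (filter_and _ _ Hf Hg).
  apply filter_imp. intros s [H1 H2]. apply He.
  change (Rabs (f s - f t) < e / (2 * (1 + L))) in H1.
  change (Rabs (g s - g t) < e / (2 * (1 + L))) in H2.
  change (Rabs (F (f s) (g s) - F (f t) (g t)) < e).
  eapply Rle_lt_trans; [apply HL|].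
  assert (E : e / (2 * (1 + L)) * (2 * (1 + L)) = e) by (field; lra).
  pose proof (Rabs_pos (f s - f t)). pose proof (Rabs_pos (g s - g t)). nra.
Qed.

Lemma continuous_Rmax_0 t : continuous (fun s => Rmax 0 s) t.
Proof.
  intros P [e He]. exists e. intros s Hs. apply He.
  change (Rabs (Rmax 0 s - Rmax 0 t) < e). change (Rabs (s - t) < e) in Hs.
  eapply Rle_lt_trans; [|exact Hs].
  unfold Rmax; repeat destruct Rle_dec; unfold Rabs; repeat destruct Rcase_abs; lra.
Qed.

Lemma exp_mono a b : a <= b -> exp a <= exp b.
Proof. intros [H | ->]; [now apply Rlt_le, exp_increasing | lra]. Qed.

Section Picard.

Variables (L : R) (F1 F2 : R -> R -> R) (x0 y0 : R).
Hypothesis (HL : 0 < L) (H1 : lipschitz2 L F1) (H2 : lipschitz2 L F2).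

Fixpoint picard (n : nat) : (R -> R) * (R -> R) :=
  match n with
  | O => (fun _ => x0, fun _ => y0)
  | S n => let (f, g) := picard n in
      (fun t => x0 + RInt (fun s => F1 (f s) (g s)) 0 t,
       fun t => y0 + RInt (fun s => F2 (f s) (g s)) 0 t)
  end.

Lemma RInt_continuous (h : R -> R) t :
  (forall s, continuous h s) -> continuous (fun t => RInt h 0 t) t.
Proof.
  intros Hh. apply (ex_derive_continuous (fun t => RInt h 0 t)).
  exists (h t). apply (is_derive_RInt h (fun t => RInt h 0 t) 0 t); [|apply Hh].
  exists (mkposreal 1 Rlt_0_1). intros y _.
  apply (@RInt_correct R_CompleteNormedModule), (@ex_RInt_continuous R_CompleteNormedModule).
  intros; apply Hh.
Qed.

Lemma picard_continuous n t :
  continuous (fst (picard n)) t /\ continuous (snd (picard n)) t.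
Proof.
  revert t. induction n as [|n IH]; intros t; simpl.
  - split; apply continuous_const.
  - destruct (picard n) as [f g]. simpl in *. split.
    + apply (continuous_plus (fun _ => x0)); [apply continuous_const|].
      apply RInt_continuous. intros s. destruct (IH s).
      now apply (lipschitz2_continuous L).
    + apply (continuous_plus (fun _ => y0)); [apply continuous_const|].
      apply RInt_continuous. intros s. destruct (IH s).
      now apply (lipschitz2_continuous L).
Qed.

Lemma continuous_ex_RInt (h : R -> R) a b :
  (forall s, continuous h s) -> ex_RInt h a b.
Proof. intros Hh. apply (@ex_RInt_continuous R_CompleteNormedModule). intros; apply Hh. Qed.

(** The weight [exp (4 L t)] makes each Picard step a contraction by [1 / 2] on the whole
    half-line. *)
Lemma RInt_diff_exp_bound (F : R -> R -> R) (f g f' g' : R -> R) B t :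
  lipschitz2 L F -> 0 <= t ->
  (forall s, continuous f s) -> (forall s, continuous g s) ->
  (forall s, continuous f' s) -> (forall s, continuous g' s) ->
  (forall s, 0 <= s -> Rabs (f s - f' s) + Rabs (g s - g' s) <= B * exp (4 * L * s)) ->
  Rabs (RInt (fun s => F (f s) (g s)) 0 t - RInt (fun s => F (f' s) (g' s)) 0 t)
    <= B / 4 * exp (4 * L * t).
Proof.
  intros HF Ht Cf Cg Cf' Cg' HB.
  assert (CF : forall s, continuous (fun s => F (f s) (g s)) s)
    by (intros; now apply (lipschitz2_continuous L)).
  assert (CF' : forall s, continuous (fun s => F (f' s) (g' s)) s)
    by (intros; now apply (lipschitz2_continuous L)).
  assert (HB0 : 0 <= B).
  { specialize (HB 0 (Rle_refl 0)). rewrite Rmult_0_r, exp_0 in HB.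
    pose proof (Rabs_pos (f 0 - f' 0)). pose proof (Rabs_pos (g 0 - g' 0)). lra. }
  assert (I : is_RInt (fun s => L * (B * exp (4 * L * s))) 0 t
    (B / 4 * exp (4 * L * t) - B / 4 * exp (4 * L * 0))).
  { apply (is_RInt_derive (fun s => B / 4 * exp (4 * L * s))).
    - intros s _. auto_derive; [trivial|]. field.
    - intros s _. apply (ex_derive_continuous (fun s => L * (B * exp (4 * L * s)))).
      auto_derive. trivial. }
  assert (E : RInt (fun s => F (f s) (g s)) 0 t - RInt (fun s => F (f' s) (g' s)) 0 t
    = RInt (fun s => F (f s) (g s) - F (f' s) (g' s)) 0 t).
  { symmetry. apply (@RInt_minus R_CompleteNormedModule (fun s => F (f s) (g s))
      (fun s => F (f' s) (g' s)));
      now apply continuous_ex_RInt. }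
  rewrite E.
  apply Rle_trans with (B / 4 * exp (4 * L * t) - B / 4 * exp (4 * L * 0)).
  2: { rewrite Rmult_0_r, exp_0. lra. }
  apply (norm_RInt_le (V := R_NormedModule) (fun s => F (f s) (g s) - F (f' s) (g' s))
    (fun s => L * (B * exp (4 * L * s))) 0 t _ _ Ht).
  - intros s Hs. change (Rabs (F (f s) (g s) - F (f' s) (g' s)) <= L * (B * exp (4 * L * s))).
    eapply Rle_trans; [apply HF|]. apply Rmult_le_compat_l; [lra|]. apply HB, Hs.
  - apply (@RInt_correct R_CompleteNormedModule).
    apply (@ex_RInt_minus R_NormedModule (fun s => F (f s) (g s)) (fun s => F (f' s) (g' s)));
      now apply continuous_ex_RInt.
  - exact I.
Qed.

Definition picard_bound : R := (Rabs (F1 x0 y0) + Rabs (F2 x0 y0)) / (4 * L).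

(** Each component gains a factor [1 / 4] in the weighted norm, so their sum gains [1 / 2]. The
    first step is linear in [t] and is absorbed by [4 L t <= exp (4 L t)]. *)
Lemma picard_step n t : 0 <= t ->
  Rabs (fst (picard (S n)) t - fst (picard n) t) +
  Rabs (snd (picard (S n)) t - snd (picard n) t) <= picard_bound * / 2 ^ n * exp (4 * L * t).
Proof.
  revert t. induction n as [|n IH]; intros t Ht.
  - simpl. rewrite !RInt_const.
    change (Rabs (x0 + (t - 0) * F1 x0 y0 - x0) + Rabs (y0 + (t - 0) * F2 x0 y0 - y0)
      <= picard_bound * / 1 * exp (4 * L * t)).
    replace (x0 + (t - 0) * F1 x0 y0 - x0) with (t * F1 x0 y0) by ring.
    replace (y0 + (t - 0) * F2 x0 y0 - y0) with (t * F2 x0 y0) by ring.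
    rewrite !Rabs_mult, (Rabs_pos_eq t) by exact Ht.
    unfold picard_bound. set (A := Rabs (F1 x0 y0) + Rabs (F2 x0 y0)).
    assert (0 <= A) by (unfold A; pose proof (Rabs_pos (F1 x0 y0));
      pose proof (Rabs_pos (F2 x0 y0)); lra).
    replace (A / (4 * L) * / 1 * exp (4 * L * t)) with (A * (exp (4 * L * t) / (4 * L)))
      by (field; lra).
    assert (t <= exp (4 * L * t) / (4 * L)).
    { apply (Rmult_le_reg_r (4 * L)); [lra|].
      replace (exp (4 * L * t) / (4 * L) * (4 * L)) with (exp (4 * L * t)) by (field; lra).
      pose proof (exp_ineq1_le (4 * L * t)). lra. }
    replace (t * Rabs (F1 x0 y0) + t * Rabs (F2 x0 y0)) with (A * t) by (unfold A; ring).
    apply Rmult_le_compat_l; lra.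
  - pose proof (fun s => picard_continuous n s) as Cn.
    pose proof (fun s => picard_continuous (S n) s) as CSn.
    change (picard (S (S n))) with
      (let (f, g) := picard (S n) in
       (fun t => x0 + RInt (fun s => F1 (f s) (g s)) 0 t,
        fun t => y0 + RInt (fun s => F2 (f s) (g s)) 0 t)).
    assert (ES : fst (picard (S n)) t =
      x0 + RInt (fun s => F1 (fst (picard n) s) (snd (picard n) s)) 0 t /\
      snd (picard (S n)) t =
      y0 + RInt (fun s => F2 (fst (picard n) s) (snd (picard n) s)) 0 t).
    { simpl. destruct (picard n); simpl. now split. }
    destruct ES as [E1 E2]. rewrite E1, E2. clear E1 E2.
    destruct (picard (S n)) as [f' g']. destruct (picard n) as [f g]. simpl fst in *.
    simpl snd in *.
    assert (B : forall F, lipschitz2 L F ->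
      Rabs (RInt (fun s => F (f' s) (g' s)) 0 t - RInt (fun s => F (f s) (g s)) 0 t)
        <= picard_bound * / 2 ^ n / 4 * exp (4 * L * t)).
    { intros F HF. apply RInt_diff_exp_bound; try assumption;
        intros s; try apply Cn; try apply CSn. }
    pose proof (B F1 H1) as B1. pose proof (B F2 H2) as B2.
    replace (x0 + RInt (fun s => F1 (f' s) (g' s)) 0 t -
      (x0 + RInt (fun s => F1 (f s) (g s)) 0 t)) with
      (RInt (fun s => F1 (f' s) (g' s)) 0 t - RInt (fun s => F1 (f s) (g s)) 0 t) by ring.
    replace (y0 + RInt (fun s => F2 (f' s) (g' s)) 0 t -
      (y0 + RInt (fun s => F2 (f s) (g s)) 0 t)) with
      (RInt (fun s => F2 (f' s) (g' s)) 0 t - RInt (fun s => F2 (f s) (g s)) 0 t) by ring.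
    replace (picard_bound * / 2 ^ S n * exp (4 * L * t)) with
      (picard_bound * / 2 ^ n / 4 * exp (4 * L * t) + picard_bound * / 2 ^ n / 4 * exp (4 * L * t)).
    + lra.
    + simpl. field. apply pow_nonzero. lra.
Qed.

Lemma picard_bound_nonneg : 0 <= picard_bound.
Proof.
  apply Rdiv_le_0_compat; [|lra].
  pose proof (Rabs_pos (F1 x0 y0)). pose proof (Rabs_pos (F2 x0 y0)). lra.
Qed.

(** The geometric sum is kept in telescoped form so that the induction on [p] closes exactly. *)
Lemma picard_cauchy n p t : 0 <= t ->
  Rabs (fst (picard (n + p)) t - fst (picard n) t) +
  Rabs (snd (picard (n + p)) t - snd (picard n) t)
    <= 2 * picard_bound * (/ 2 ^ n - / 2 ^ (n + p)) * exp (4 * L * t).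
Proof.
  intros Ht. induction p as [|p IH].
  - rewrite Nat.add_0_r, !Rminus_diag, Rabs_R0. lra.
  - rewrite Nat.add_succ_r.
    pose proof (picard_step (n + p) t Ht) as Hs.
    set (a := fst (picard (S (n + p))) t) in *. set (b := fst (picard (n + p)) t) in *.
    set (a' := snd (picard (S (n + p))) t) in *. set (b' := snd (picard (n + p)) t) in *.
    set (d := fst (picard n) t) in *. set (d' := snd (picard n) t) in *.
    pose proof (Rabs_triang (a - b) (b - d)) as T1.
    pose proof (Rabs_triang (a' - b') (b' - d')) as T2.
    replace (a - b + (b - d)) with (a - d) in T1 by ring.
    replace (a' - b' + (b' - d')) with (a' - d') in T2 by ring.
    replace (2 * picard_bound * (/ 2 ^ n - / 2 ^ S (n + p)) * exp (4 * L * t)) with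
      (2 * picard_bound * (/ 2 ^ n - / 2 ^ (n + p)) * exp (4 * L * t) +
       picard_bound * / 2 ^ (n + p) * exp (4 * L * t)).
    + lra.
    + simpl. field. split; apply pow_nonzero; lra.
Qed.

Lemma half_pow_pos n : 0 < / 2 ^ n.
Proof. apply Rinv_0_lt_compat, pow_lt. lra. Qed.

Lemma half_pow_small e B : 0 < e -> 0 <= B -> exists N, forall n, (N <= n)%nat -> B * / 2 ^ n < e.
Proof.
  intros He HB.
  destruct (pow_lt_1_zero (/ 2)) with (y := e / (1 + B)) as [N HN].
  - rewrite Rabs_pos_eq; lra.
  - apply Rdiv_lt_0_compat; lra.
  - exists N. intros n Hn. specialize (HN n Hn).
    rewrite pow_inv, Rabs_pos_eq in HN.
    2: { apply Rlt_le, Rinv_0_lt_compat, pow_lt; lra. }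
    assert (0 < / 2 ^ n) by (apply Rinv_0_lt_compat, pow_lt; lra).
    apply (Rmult_lt_compat_r (1 + B)) in HN; [|lra].
    replace (e / (1 + B) * (1 + B)) with e in HN by (field; lra). nra.
Qed.

Lemma picard_limit t : 0 <= t -> exists x y, forall n,
  Rabs (x - fst (picard n) t) <= 2 * picard_bound * / 2 ^ n * exp (4 * L * t) /\
  Rabs (y - snd (picard n) t) <= 2 * picard_bound * / 2 ^ n * exp (4 * L * t).
Proof.
  intros Ht. pose proof picard_bound_nonneg as HM.
  assert (C : forall n p,
    Rabs (fst (picard (n + p)) t - fst (picard n) t) <= 2 * picard_bound * / 2 ^ n * exp (4 * L * t) /\
    Rabs (snd (picard (n + p)) t - snd (picard n) t) <= 2 * picard_bound * / 2 ^ n * exp (4 * L * t)).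
  { intros n p. pose proof (picard_cauchy n p t Ht) as H.
    pose proof (Rabs_pos (fst (picard (n + p)) t - fst (picard n) t)).
    pose proof (Rabs_pos (snd (picard (n + p)) t - snd (picard n) t)).
    pose proof (half_pow_pos (n + p)) as Hp.
    pose proof (exp_pos (4 * L * t)) as HE.
    set (h := / 2 ^ (n + p)) in *. set (h' := / 2 ^ n) in *.
    assert (0 <= picard_bound * h * exp (4 * L * t)) by (apply Rmult_le_pos; [apply Rmult_le_pos|]; lra).
    lra. }
  assert (lim : forall w : nat -> R,
    (forall n p, Rabs (w (n + p)%nat - w n) <= 2 * picard_bound * / 2 ^ n * exp (4 * L * t)) ->
    exists l, forall n, Rabs (l - w n) <= 2 * picard_bound * / 2 ^ n * exp (4 * L * t)).
  { intros w Hw.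
    assert (Cw : ex_lim_seq_cauchy w).
    { intros e.
      destruct (half_pow_small (e / 2) (2 * picard_bound * exp (4 * L * t))) as [N HN].
      - pose proof (cond_pos e). lra.
      - pose proof (exp_pos (4 * L * t)). apply Rmult_le_pos; lra.
      - exists N. intros n p Hn Hp.
        assert (G : forall k, (N <= k)%nat -> Rabs (w k - w N) < e / 2).
        { intros k Hk. replace k with (N + (k - N))%nat by lia.
          eapply Rle_lt_trans; [apply Hw|]. specialize (HN N (Nat.le_refl N)).
          eapply Rle_lt_trans; [|exact HN]. right. ring. }
        replace (w n - w p) with ((w n - w N) - (w p - w N)) by ring.
        eapply Rle_lt_trans; [apply Rabs_triang|]. rewrite Rabs_Ropp.
        pose proof (G n Hn). pose proof (G p Hp). lra. }
    apply ex_lim_seq_cauchy_corr in Cw. destruct Cw as [l Hl].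
    exists l. intros n.
    assert (Hl' : is_lim_seq (fun p => Rabs (w (n + p)%nat - w n)) (Rabs (l - w n))).
    { apply (is_lim_seq_abs _ (l - w n)).
      apply is_lim_seq_minus'; [|apply is_lim_seq_const].
      apply (is_lim_seq_ext (fun p => w (p + n)%nat)).
      - intros p. now rewrite Nat.add_comm.
      - now apply is_lim_seq_incr_n with (N := n) in Hl. }
    apply (is_lim_seq_le _ _ (Rabs (l - w n)) (2 * picard_bound * / 2 ^ n * exp (4 * L * t))
      (fun p => Hw n p) Hl' (is_lim_seq_const _)). }
  destruct (lim (fun n => fst (picard n) t)) as [x Hx]; [intros; apply C|].
  destruct (lim (fun n => snd (picard n) t)) as [y Hy]; [intros; apply C|].
  exists x, y. intros n. now split.
Qed.

(** The limit is frozen at its initial value for negative times, through [Rmax 0 t]. This makes it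
    continuous on the whole line and spares all later arguments one-sided continuity at 0. *)
Lemma picard_solution : exists x y : R -> R,
  x 0 = x0 /\ y 0 = y0 /\ (forall t, continuous x t) /\ (forall t, continuous y t) /\
  forall t, 0 < t -> is_derive x t (F1 (x t) (y t)) /\ is_derive y t (F2 (x t) (y t)).
Proof.
  destruct (classical_choice (fun t (xy : R * R) => forall n,
      Rabs (fst xy - fst (picard n) (Rmax 0 t)) <= 2 * picard_bound * / 2 ^ n * exp (4 * L * Rmax 0 t) /\
      Rabs (snd xy - snd (picard n) (Rmax 0 t)) <= 2 * picard_bound * / 2 ^ n * exp (4 * L * Rmax 0 t)))
    as [X HX].
  { intros t. destruct (picard_limit (Rmax 0 t) (Rmax_l 0 t)) as (a & b & H).
    exists (a, b). exact H. }
  pose proof picard_bound_nonneg as HM.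
  set (x := fun t => fst (X t)). set (y := fun t => snd (X t)).
  assert (cont : forall (w : R -> R) (p : nat -> R -> R),
    (forall t n, Rabs (w t - p n (Rmax 0 t)) <= 2 * picard_bound * / 2 ^ n * exp (4 * L * Rmax 0 t)) ->
    (forall n t, continuous (p n) t) -> forall t, continuous w t).
  { intros w p Hw Hp t P [e He].
    (* The weight is bounded on all [s <= t + 1], so the iterates converge uniformly near [t] and
       the limit inherits their continuity. *)
    set (E := exp (4 * L * Rmax 0 (t + 1))).
    assert (HE : 0 < E) by apply exp_pos.
    destruct (half_pow_small (e / 3) (2 * picard_bound * E)) as [N HN].
    { pose proof (cond_pos e). lra. }
    { apply Rmult_le_pos; lra. }
    specialize (HN N (Nat.le_refl N)).
    assert (U : forall s, s <= t + 1 -> Rabs (w s - p N (Rmax 0 s)) < e / 3).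
    { intros s Hs. eapply Rle_lt_trans; [apply Hw|]. eapply Rle_lt_trans; [|exact HN].
      replace (2 * picard_bound * E * / 2 ^ N) with (2 * picard_bound * / 2 ^ N * E) by ring.
      apply Rmult_le_compat_l.
      - pose proof (half_pow_pos N). apply Rmult_le_pos; lra.
      - apply exp_mono. apply Rmult_le_compat_l; [lra|].
        apply Rmax_lub; [apply Rmax_l|]. eapply Rle_trans; [exact Hs | apply Rmax_r]. }
    assert (C : continuous (fun s => p N (Rmax 0 s)) t).
    { apply (continuous_comp (fun s => Rmax 0 s) (p N)); [|apply Hp].
      apply continuous_Rmax_0. }
    assert (He3 : 0 < e / 3) by (pose proof (cond_pos e); lra).
    specialize (C (ball (p N (Rmax 0 t)) (mkposreal _ He3)) (locally_ball _ _)).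
    assert (Q : locally t (fun s => s <= t + 1)).
    { exists (mkposreal 1 Rlt_0_1). intros s Hs.
      change (Rabs (s - t) < 1) in Hs. apply Rabs_lt_between in Hs. lra. }
    unfold filtermap in *. generalize (filter_and _ _ C Q). apply filter_imp.
    intros s [A1 A2]. apply He.
    change (Rabs (p N (Rmax 0 s) - p N (Rmax 0 t)) < e / 3) in A1.
    change (Rabs (w s - w t) < e).
    replace (w s - w t) with ((w s - p N (Rmax 0 s)) +
      ((p N (Rmax 0 s) - p N (Rmax 0 t)) - (w t - p N (Rmax 0 t)))) by ring.
    eapply Rle_lt_trans; [apply Rabs_triang|].
    eapply Rle_lt_trans; [apply Rplus_le_compat_l, Rabs_triang|].
    rewrite Rabs_Ropp.
    pose proof (U s A2). pose proof (U t ltac:(lra)). lra. }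
  assert (Cx : forall t, continuous x t).
  { apply (cont x (fun n => fst (picard n))); [intros; apply HX | intros; apply picard_continuous]. }
  assert (Cy : forall t, continuous y t).
  { apply (cont y (fun n => snd (picard n))); [intros; apply HX | intros; apply picard_continuous]. }
  assert (CF : forall F, lipschitz2 L F -> forall s, continuous (fun s => F (x s) (y s)) s)
    by (intros; now apply (lipschitz2_continuous L)).
  assert (B : forall n t, 0 <= t ->
      Rabs (x t - fst (picard n) t) <= 2 * picard_bound * / 2 ^ n * exp (4 * L * t) /\
      Rabs (y t - snd (picard n) t) <= 2 * picard_bound * / 2 ^ n * exp (4 * L * t)).
  { intros n t Ht. specialize (HX t n). now rewrite (Rmax_right 0 t Ht) in HX. }
  (* Passage to the limit in the integral equation: iterate [S N] is close to [w], and its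
     integrand, built from iterate [N], is close to the limiting one. *)
  assert (G : forall F (w : R -> R) (p : nat -> R -> R) w0, lipschitz2 L F ->
    (forall n t, 0 <= t -> Rabs (w t - p n t) <= 2 * picard_bound * / 2 ^ n * exp (4 * L * t)) ->
    (forall n t, p (S n) t = w0 + RInt (fun s => F (fst (picard n) s) (snd (picard n) s)) 0 t) ->
    forall t, 0 <= t -> w t = w0 + RInt (fun s => F (x s) (y s)) 0 t).
  { intros F w p w0 HF Hw Hp t Ht.
    apply Rminus_diag_uniq. apply Rabs_eq_0. apply Rle_antisym; [|apply Rabs_pos].
    apply Rnot_lt_le. intros Hpos.
    set (E := exp (4 * L * t)). assert (HE : 0 < E) by apply exp_pos.
    destruct (half_pow_small (Rabs (w t - (w0 + RInt (fun s => F (x s) (y s)) 0 t)))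
      (2 * picard_bound * E) Hpos) as [N HN]; [apply Rmult_le_pos; lra|].
    specialize (HN N (Nat.le_refl N)). revert HN. apply Rle_not_lt.
    replace (w t - (w0 + RInt (fun s => F (x s) (y s)) 0 t)) with
      ((w t - p (S N) t) + (RInt (fun s => F (fst (picard N) s) (snd (picard N) s)) 0 t
        - RInt (fun s => F (x s) (y s)) 0 t)) by (rewrite Hp; ring).
    eapply Rle_trans; [apply Rabs_triang|].
    assert (P1 := Hw (S N) t Ht). fold E in P1.
    assert (P2 : Rabs (RInt (fun s => F (fst (picard N) s) (snd (picard N) s)) 0 t
        - RInt (fun s => F (x s) (y s)) 0 t) <= 4 * picard_bound * / 2 ^ N / 4 * E).
    { apply RInt_diff_exp_bound; try assumption; try (intros; apply picard_continuous).
      intros s Hs. destruct (B N s Hs) as [Bx By].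
      rewrite (Rabs_minus_sym (x s)) in Bx. rewrite (Rabs_minus_sym (y s)) in By. lra. }
    assert (E2 : 2 * picard_bound * / 2 ^ S N * E = picard_bound * / 2 ^ N * E).
    { simpl. field. apply pow_nonzero. lra. }
    rewrite E2 in P1.
    replace (2 * picard_bound * E * / 2 ^ N) with
      (picard_bound * / 2 ^ N * E + 4 * picard_bound * / 2 ^ N / 4 * E)
      by (field; apply pow_nonzero; lra).
    lra. }
  assert (Gx : forall t, 0 <= t -> x t = x0 + RInt (fun s => F1 (x s) (y s)) 0 t).
  { apply (G F1 x (fun n => fst (picard n)) x0 H1); [intros; now apply B|].
    intros n t. simpl. now destruct (picard n). }
  assert (Gy : forall t, 0 <= t -> y t = y0 + RInt (fun s => F2 (x s) (y s)) 0 t).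
  { apply (G F2 y (fun n => snd (picard n)) y0 H2); [intros; now apply B|].
    intros n t. simpl. now destruct (picard n). }
  assert (D : forall F w0 (w : R -> R), lipschitz2 L F ->
    (forall t, 0 <= t -> w t = w0 + RInt (fun s => F (x s) (y s)) 0 t) ->
    forall t, 0 < t -> is_derive w t (F (x t) (y t))).
  { intros F w0 w HF Hw t Ht.
    apply (is_derive_ext_loc (fun t => w0 + RInt (fun s => F (x s) (y s)) 0 t)).
    - exists (mkposreal t Ht). intros s Hs. change (Rabs (s - t) < t) in Hs.
      apply Rabs_lt_between in Hs. symmetry. apply Hw. lra.
    - assert (DR : is_derive (fun t => RInt (fun s => F (x s) (y s)) 0 t) t (F (x t) (y t))).
      { apply (is_derive_RInt (fun s => F (x s) (y s))
          (fun t => RInt (fun s => F (x s) (y s)) 0 t) 0 t); [|now apply CF].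
        exists (mkposreal 1 Rlt_0_1). intros s _.
        apply (@RInt_correct R_CompleteNormedModule), continuous_ex_RInt. now apply CF. }
      assert (K := is_derive_plus (fun _ : R => w0) _ t zero _ (is_derive_const w0 t) DR).
      rewrite plus_zero_l in K. exact K. }
  exists x, y. split.
  { rewrite Gx by lra. rewrite RInt_point. apply Rplus_0_r. }
  split.
  { rewrite Gy by lra. rewrite RInt_point. apply Rplus_0_r. }
  split; [exact Cx|]. split; [exact Cy|].
  intros t Ht. split; [now apply (D F1 x0) | now apply (D F2 y0)].
Qed.

End Picard.

(** * Calculus on the line *)

Lemma continuous_eps (f : R -> R) t : continuous f t ->
  forall e, 0 < e -> exists d, 0 < d /\ forall s, Rabs (s - t) < d -> Rabs (f s - f t) < e.
Proof.
  intros H e He.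
  destruct (H (ball (f t) (mkposreal e He)) (locally_ball _ _)) as [d Hd].
  exists d. split; [apply cond_pos|]. intros s Hs. exact (Hd s Hs).
Qed.

Lemma growth_ge (f df : R -> R) a b k : a <= b -> (forall t, continuous f t) ->
  (forall t, a < t < b -> is_derive f t (df t) /\ k <= df t) ->
  k * (b - a) <= f b - f a.
Proof.
  intros Hab Hc Hd.
  destruct (Req_dec a b) as [E|E]; [subst; lra|].
  destruct (MVT_gen f a b (fun t => if Rlt_dec a t then if Rlt_dec t b then df t else k else k))
    as [x [_ Hx]].
  - rewrite Rmin_left, Rmax_right by lra. intros t Ht.
    destruct (Rlt_dec a t); [|lra]. destruct (Rlt_dec t b); [|lra]. now apply Hd.
  - intros t _. apply continuity_pt_filterlim, Hc.
  - rewrite Hx. apply Rmult_le_compat_r; [lra|].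
    destruct (Rlt_dec a x); [|lra]. destruct (Rlt_dec x b); [|lra]. now apply Hd.
Qed.

Lemma growth_le (f df : R -> R) a b k : a <= b -> (forall t, continuous f t) ->
  (forall t, a < t < b -> is_derive f t (df t) /\ df t <= k) ->
  f b - f a <= k * (b - a).
Proof.
  intros Hab Hc Hd.
  assert (H := growth_ge (fun t => - f t) (fun t => - df t) a b (- k) Hab).
  apply Ropp_le_cancel. replace (- (f b - f a)) with (- f b - - f a) by ring.
  replace (- (k * (b - a))) with (- k * (b - a)) by ring. apply H.
  - intros t. apply (continuous_opp f), Hc.
  - intros t Ht. destruct (Hd t Ht). split; [|lra]. now apply (is_derive_opp f).
Qed.

(** The time is the supremum of those at which [f] is at least [k]. *)
Lemma last_time (f : R -> R) a b k : a <= b -> (forall t, continuous f t) ->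
  k <= f a -> f b < k ->
  exists a1, a <= a1 < b /\ f a1 = k /\ forall t, a1 < t <= b -> f t < k.
Proof.
  intros Hab Hc Ha Hb.
  destruct (completeness (fun t => a <= t <= b /\ k <= f t)) as [s [Hub Hlub]].
  { exists b. intros t Ht. lra. }
  { exists a. lra. }
  assert (Hs : a <= s <= b).
  { split; [apply Hub; lra|]. apply Hlub. intros t Ht. lra. }
  assert (L : forall t, s < t <= b -> f t < k).
  { intros t Ht. apply Rnot_le_lt. intros K.
    assert (t <= s) by (apply Hub; lra). lra. }
  assert (G1 : k <= f s).
  { apply Rnot_lt_le. intros K.
    destruct (continuous_eps f s (Hc s) (k - f s)) as [d [Hd H]]; [lra|].
    assert (s <= s - d / 2).
    { apply Hlub. intros t [Ht1 Ht2]. apply Rnot_lt_le. intros K'.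
      assert (t <= s) by (apply Hub; lra).
      assert (Rabs (f t - f s) < k - f s) by (apply H, Rabs_lt_between; lra).
      apply Rabs_lt_between in H1. lra. }
    lra. }
  assert (s < b) by (destruct Hs as [_ [|E]]; [assumption | subst; lra]).
  exists s. split; [lra|]. split; [|exact L].
  apply Rle_antisym; [|exact G1].
  apply Rnot_lt_le. intros K.
  destruct (continuous_eps f s (Hc s) (f s - k)) as [d [Hd H1]]; [lra|].
  set (t := s + Rmin (d / 2) (b - s)).
  assert (0 < Rmin (d / 2) (b - s)) by (apply Rmin_glb_lt; lra).
  pose proof (Rmin_l (d / 2) (b - s)). pose proof (Rmin_r (d / 2) (b - s)).
  assert (f t < k) by (apply L; unfold t; lra).
  assert (Rabs (f t - f s) < f s - k) by (apply H1, Rabs_lt_between; unfold t; lra).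
  apply Rabs_lt_between in H5. lra.
Qed.

Lemma first_time (f : R -> R) a b k : a <= b -> (forall t, continuous f t) ->
  f a < k -> k <= f b ->
  exists a1, a < a1 <= b /\ f a1 = k /\ forall t, a <= t < a1 -> f t < k.
Proof.
  intros Hab Hc Ha Hb.
  destruct (last_time (fun t => f (- t)) (- b) (- a) k) as [s (Hs & E & H)].
  - lra.
  - intros t. apply (continuous_comp Ropp f); [|apply Hc].
    apply (ex_derive_continuous (fun t => - t)). auto_derive. trivial.
  - now rewrite Ropp_involutive.
  - now rewrite Ropp_involutive.
  - exists (- s). split; [lra|]. split; [exact E|]. intros t Ht.
    specialize (H (- t)). rewrite Ropp_involutive in H. apply H. lra.
Qed.

(** After the last time at level [k] the function would first run through values just below [k],
    where it cannot decrease. Only the sign of the derivative in a strip of width [w] under the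
    barrier is needed, which lets the a priori bounds use that the solution is near the barrier. *)
Lemma barrier_ge (f df : R -> R) a b k w : a <= b -> (forall t, continuous f t) -> 0 < w ->
  (forall t, a < t < b -> is_derive f t (df t)) ->
  (forall t, a < t < b -> k - w < f t < k -> 0 <= df t) ->
  k <= f a -> k <= f b.
Proof.
  intros Hab Hc Hw Hd Hb Ha. apply Rnot_lt_le. intros K.
  destruct (last_time f a b k Hab Hc Ha K) as (s & Hs & E & L).
  destruct (continuous_eps f s (Hc s) w Hw) as [d [Hd0 H]].
  set (t := s + Rmin (d / 2) (b - s)).
  assert (0 < Rmin (d / 2) (b - s)) by (apply Rmin_glb_lt; lra).
  pose proof (Rmin_l (d / 2) (b - s)). pose proof (Rmin_r (d / 2) (b - s)).
  assert (f t < k) by (apply L; unfold t; lra).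
  assert (0 * (t - s) <= f t - f s).
  { apply (growth_ge f df); [unfold t; lra|exact Hc|].
    intros x Hx. assert (a < x < b) by (unfold t in *; lra).
    split; [now apply Hd|]. apply Hb; [assumption|].
    assert (Rabs (f x - f s) < w) by (apply H, Rabs_lt_between; unfold t in *; lra).
    apply Rabs_lt_between in H5. split; [lra|]. apply L. lra. }
  lra.
Qed.

(** Up to a first zero, [y] times [exp (- p_min t)] is nondecreasing, hence stays at least [y 0]. *)
Lemma linear_growth_pos (y p : R -> R) h : (forall t, continuous y t) ->
  (forall t, 0 <= t <= h -> continuous p t) ->
  (forall t, 0 < t < h -> is_derive y t (y t * p t)) ->
  0 < y 0 -> forall t, 0 <= t <= h -> 0 < y t.
Proof.
  intros Hc Hp Hd H0 t Ht. apply Rnot_le_lt. intros K.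
  destruct (first_time (fun t => - y t) 0 t 0) as (s & Hs & E & L); [lra| |lra|lra|].
  { intros x. apply (continuous_opp y), Hc. }
  destruct (continuity_ab_min p 0 h) as [mx [Hmx _]]; [lra| |].
  { intros x Hx. apply continuity_pt_filterlim, Hp, Hx. }
  set (k := - p mx).
  assert (0 * (s - 0) <= y s * exp (k * s) - y 0 * exp (k * 0)).
  { apply (growth_ge (fun t => y t * exp (k * t))
      (fun t => y t * p t * exp (k * t) + y t * (k * exp (k * t)))).
    - lra.
    - intros x. apply (continuous_mult y); [apply Hc|].
      apply (ex_derive_continuous (fun t => exp (k * t))). auto_derive. trivial.
    - intros x Hx. split.
      + apply (is_derive_mult y (fun t => exp (k * t)) x); [apply Hd; lra| |intros; apply Rmult_comm].
        auto_derive; [trivial|]. ring.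
      + specialize (L x ltac:(lra)). specialize (Hmx x ltac:(lra)).
        pose proof (exp_pos (k * x)).
        replace (y x * p x * exp (k * x) + y x * (k * exp (k * x))) with
          (y x * (p x - p mx) * exp (k * x)) by (unfold k; ring).
        apply Rmult_le_pos; [apply Rmult_le_pos|]; lra. }
  rewrite Rmult_0_r, exp_0 in H. assert (y s = 0) by lra. rewrite H1 in H. lra.
Qed.

(** The supremum of the initial segments on which [P] holds belongs to them, and could be pushed
    further unless it is [h]. *)
Lemma continuous_induction (P : R -> Prop) h :
  (forall t, 0 <= t <= h -> (forall s, 0 <= s < t -> P s) ->
     P t /\ exists e, 0 < e /\ forall s, t < s < t + e -> P s) ->
  forall t, 0 <= t <= h -> P t.
Proof.
  intros H t Ht.
  destruct (completeness (fun t => 0 <= t <= h /\ forall s, 0 <= s <= t -> P s))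
    as [m [Hub Hlub]].
  { exists h. intros x Hx. lra. }
  { exists 0. split; [lra|]. intros s Hs. replace s with 0 by lra.
    apply H; [lra|]. intros; lra. }
  assert (Hm0 : 0 <= m).
  { apply Hub. split; [lra|]. intros s Hs. replace s with 0 by lra.
    apply H; [lra|]. intros; lra. }
  assert (Hmh : m <= h) by (apply Hlub; intros x Hx; lra).
  assert (B : forall s, 0 <= s < m -> P s).
  { intros s Hs. apply NNPP. intros N.
    assert (m <= s); [|lra]. apply Hlub. intros x [Hx1 Hx2].
    apply Rnot_lt_le. intros K. apply N, Hx2. lra. }
  destruct (H m ltac:(lra) B) as [Pm [e [He E]]].
  destruct (Rle_dec h m) as [L|L].
  - destruct (Req_dec t m) as [->|N]; [exact Pm | apply B; lra].
  - exfalso. assert (Rmin h (m + e / 2) <= m).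
    { apply Hub. split.
      - split; [apply Rmin_glb; lra | apply Rmin_l].
      - intros s Hs. pose proof (Rmin_r h (m + e / 2)).
        destruct (Rlt_dec s m); [apply B; lra|].
        destruct (Req_dec s m) as [->|]; [exact Pm|]. apply E. lra. }
    assert (m < Rmin h (m + e / 2)) by (apply Rmin_glb_lt; lra). lra.
Qed.

(** * Bounded Lipschitz functions of two variables *)

Definition bounded_lipschitz (F : R -> R -> R) : Prop :=
  exists L B, 0 <= L /\ lipschitz2 L F /\ forall x y, Rabs (F x y) <= B.

Lemma bounded_lipschitz_const a : bounded_lipschitz (fun _ _ => a).
Proof.
  exists 0, (Rabs a). split; [lra|]. split; [|intros; lra].
  intros x y x' y'. rewrite Rminus_diag, Rabs_R0. lra.
Qed.

Lemma bounded_lipschitz_plus F G : bounded_lipschitz F -> bounded_lipschitz G ->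
  bounded_lipschitz (fun x y => F x y + G x y).
Proof.
  intros (L & B & H0 & H1 & H2) (L' & B' & H0' & H1' & H2').
  exists (L + L'), (B + B'). split; [lra|]. split.
  - intros x y x' y'. specialize (H1 x y x' y'). specialize (H1' x y x' y').
    replace (F x y + G x y - (F x' y' + G x' y')) with
      ((F x y - F x' y') + (G x y - G x' y')) by ring.
    eapply Rle_trans; [apply Rabs_triang|]. lra.
  - intros x y. specialize (H2 x y). specialize (H2' x y).
    eapply Rle_trans; [apply Rabs_triang|]. lra.
Qed.

Lemma bounded_lipschitz_mult F G : bounded_lipschitz F -> bounded_lipschitz G ->
  bounded_lipschitz (fun x y => F x y * G x y).
Proof.
  intros (L & B & H0 & H1 & H2) (L' & B' & H0' & H1' & H2').
  assert (0 <= B) by (specialize (H2 0 0); pose proof (Rabs_pos (F 0 0)); lra).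
  assert (0 <= B') by (specialize (H2' 0 0); pose proof (Rabs_pos (G 0 0)); lra).
  exists (L * B' + B * L'), (B * B'). split; [nra|]. split.
  - intros x y x' y'. specialize (H1 x y x' y'). specialize (H1' x y x' y').
    replace (F x y * G x y - F x' y' * G x' y') with
      ((F x y - F x' y') * G x y + F x' y' * (G x y - G x' y')) by ring.
    eapply Rle_trans; [apply Rabs_triang|]. rewrite !Rabs_mult.
    set (d := Rabs (x - x') + Rabs (y - y')) in *.
    assert (Rabs (F x y - F x' y') * Rabs (G x y) <= (L * d) * B')
      by (apply Rmult_le_compat; auto using Rabs_pos).
    assert (Rabs (F x' y') * Rabs (G x y - G x' y') <= B * (L' * d))
      by (apply Rmult_le_compat; auto using Rabs_pos).
    lra.
  - intros x y. rewrite Rabs_mult. apply Rmult_le_compat; auto using Rabs_pos.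
Qed.

Lemma bounded_lipschitz_inv F d : 0 < d -> (forall x y, d <= F x y) ->
  bounded_lipschitz F -> bounded_lipschitz (fun x y => / F x y).
Proof.
  intros Hd HF (L & B & H0 & H1 & H2).
  exists (L * (/ d * / d)), (/ d).
  assert (Hd' : 0 < / d) by (now apply Rinv_0_lt_compat).
  assert (I : forall x y, 0 < / F x y <= / d).
  { intros x y. specialize (HF x y). split; [apply Rinv_0_lt_compat; lra|].
    apply Rinv_le_contravar; lra. }
  split; [repeat apply Rmult_le_pos; lra|]. split.
  - intros x y x' y'. specialize (H1 x y x' y').
    replace (/ F x y - / F x' y') with
      ((F x' y' - F x y) * (/ F x y * / F x' y')).
    2: { pose proof (HF x y). pose proof (HF x' y'). field. lra. }
    rewrite Rabs_mult, Rabs_minus_sym.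
    replace (L * (/ d * / d) * (Rabs (x - x') + Rabs (y - y'))) with
      (L * (Rabs (x - x') + Rabs (y - y')) * (/ d * / d)) by ring.
    pose proof (I x y). pose proof (I x' y').
    apply Rmult_le_compat; auto using Rabs_pos.
    rewrite Rabs_pos_eq by (apply Rmult_le_pos; lra).
    apply Rmult_le_compat; lra.
  - intros x y. specialize (I x y). rewrite Rabs_pos_eq; lra.
Qed.

Definition clip (a b x : R) : R := Rmax a (Rmin b x).

Lemma clip_bounds a b x : a <= b -> a <= clip a b x <= b.
Proof. intros. unfold clip, Rmax, Rmin. repeat destruct Rle_dec; lra. Qed.

Lemma clip_id a b x : a <= x <= b -> clip a b x = x.
Proof. intros. unfold clip, Rmax, Rmin. repeat destruct Rle_dec; lra. Qed.

Lemma clip_lipschitz a b x y : a <= b -> Rabs (clip a b x - clip a b y) <= Rabs (x - y).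
Proof.
  intros. unfold clip, Rmax, Rmin, Rabs.
  repeat destruct Rle_dec; repeat destruct Rcase_abs; lra.
Qed.

Lemma bounded_lipschitz_clip_fst a b : a <= b -> bounded_lipschitz (fun x _ => clip a b x).
Proof.
  intros H. exists 1, (Rabs a + Rabs b). split; [lra|]. split.
  - intros x y x' y'. pose proof (clip_lipschitz a b x x' H). pose proof (Rabs_pos (y - y')). lra.
  - intros x _. pose proof (clip_bounds a b x H).
    pose proof (Rle_abs a). pose proof (Rle_abs b). pose proof (Rle_abs (- a)).
    pose proof (Rle_abs (- b)). rewrite Rabs_Ropp in *. pose proof (Rabs_pos a).
    pose proof (Rabs_pos b). apply Rabs_le. lra.
Qed.

Lemma bounded_lipschitz_clip_snd a b : a <= b -> bounded_lipschitz (fun _ y => clip a b y).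
Proof.
  intros H. destruct (bounded_lipschitz_clip_fst a b H) as (L & B & H0 & H1 & H2).
  exists L, B. split; [exact H0|]. split.
  - intros x y x' y'. specialize (H1 y x y' x'). lra.
  - intros x y. apply (H2 y x).
Qed.

(** * The profile system *)

(** In the similarity variable [s = ln x + ln (1 + t) / 2] the characteristic speeds are
    [S = x / ((1 + t) z)] and [R = x r / (1 + t)], and [q = (r + 1 / 2) / z] stays regular
    at the singularity [z = 0]. Following a minus characteristic, along which
    [s' = r + 1 / 2 = q z] in logarithmic time [ln (1 + t)], backwards from the blow-up, the
    equations read [z' = prof_g], [q' = q * prof_n]; moreover
    [(1 - r z)' = (1 - r z) * prof_y]. *)
Definition prof_r (z q : R) : R := - / 2 + q * z.

Definition prof_g (k z q : R) : R :=
  k * (1 - (prof_r z q * z) ^ 2) + z * (1 - prof_r z q).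

(** The equation of [r] along plus characteristics gives [r'] in terms of [z] and [q], and
    [q' = (r' - q z') / z]. The terms of order zero in the numerator cancel, so the division leaves
    no pole at [z = 0]. *)
Definition prof_n (k z q : R) : R :=
  (2 * prof_r z q - 1 - prof_r z q * z - prof_g k z q / 2) / (1 + z / 2).

Definition prof_y (k z q : R) : R :=
  - ((k * (1 + prof_r z q * z) * (2 * prof_r z q + / 2 + prof_r z q * z / 2)
      + 3 / 2 * (prof_r z q * z)) / (1 + z / 2)).

(** While [q <= q_init] and [z <= 4], [q z] is at most [4 / 1000]. So [r <= 0] there, and the gap
    [mass_fun] grows slowly enough for the minus characteristic from 3 to arrive at 2 before time
    [6 / 5]. *)
Definition q_init : R := / 1000.

Lemma bounded_lipschitz_opp F : bounded_lipschitz F -> bounded_lipschitz (fun x y => - F x y).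
Proof.
  intros (L & B & A1 & A2 & A3). exists L, B. split; [exact A1|]. split.
  - intros x y x' y'. replace (- F x y - - F x' y') with (- (F x y - F x' y')) by ring.
    rewrite Rabs_Ropp. apply A2.
  - intros x y. rewrite Rabs_Ropp. apply A3.
Qed.

Lemma bounded_lipschitz_pow F n : bounded_lipschitz F -> bounded_lipschitz (fun x y => F x y ^ n).
Proof.
  intros H. induction n as [|n IH]; simpl.
  - apply bounded_lipschitz_const.
  - now apply bounded_lipschitz_mult.
Qed.

Ltac bounded_lipschitz_auto :=
  first [ assumption | apply bounded_lipschitz_const |
  lazymatch goal with
  | |- bounded_lipschitz (fun x y => @?F x y + @?G x y) =>
      apply (bounded_lipschitz_plus F G); cbv beta; bounded_lipschitz_auto
  | |- bounded_lipschitz (fun x y => @?F x y - @?G x y) =>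
      apply (bounded_lipschitz_plus F (fun x y => - G x y)); cbv beta; bounded_lipschitz_auto
  | |- bounded_lipschitz (fun x y => - @?F x y) =>
      apply (bounded_lipschitz_opp F); cbv beta; bounded_lipschitz_auto
  | |- bounded_lipschitz (fun x y => @?F x y * @?G x y) =>
      apply (bounded_lipschitz_mult F G); cbv beta; bounded_lipschitz_auto
  | |- bounded_lipschitz (fun x y => @?F x y / @?G x y) =>
      apply (bounded_lipschitz_mult F (fun x y => / G x y)); cbv beta; bounded_lipschitz_auto
  | |- bounded_lipschitz (fun x y => @?F x y ^ ?n) =>
      apply (bounded_lipschitz_pow F n); cbv beta; bounded_lipschitz_auto
  end ].

(** Clipping [z] from below at [-1] keeps the denominator [1 + z / 2] at least [1 / 2]. *)
Lemma truncated_lipschitz k b F : -1 <= b ->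
  F = prof_g k \/ F = prof_n k \/ F = prof_y k ->
  bounded_lipschitz (fun x y => F (clip (-1) b x) (clip (-1) 2 y)).
Proof.
  intros Hb HF.
  pose proof (bounded_lipschitz_clip_fst (-1) b Hb) as BZ.
  pose proof (bounded_lipschitz_clip_snd (-1) 2 ltac:(lra)) as BQ.
  assert (BI : bounded_lipschitz (fun x _ => / (1 + clip (-1) b x / 2))).
  { apply (bounded_lipschitz_inv (fun x _ => 1 + clip (-1) b x / 2) (/ 2)); [lra| |bounded_lipschitz_auto].
    intros x _. pose proof (clip_bounds (-1) b x Hb). lra. }
  destruct HF as [-> | [-> | ->]]; unfold prof_n, prof_y, prof_g, prof_r; bounded_lipschitz_auto.
Qed.

(** * A priori bounds on the truncated profile system *)

Section Profile.

Variables (k b : R) (z q : R -> R).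
Hypothesis (Hk : / 4 <= k <= / 2) (Hb : -1 <= b).
Hypothesis (Cz : forall t, continuous z t) (Cq : forall t, continuous q t).
Hypothesis (z0 : z 0 = 0) (q0 : q 0 = q_init).

Definition trunc (F : R -> R -> R) (t : R) : R := F (clip (-1) b (z t)) (clip (-1) 2 (q t)).

Hypothesis (Dz : forall t, 0 < t -> is_derive z t (trunc (prof_g k) t)).
Hypothesis (Dq : forall t, 0 < t ->
  is_derive q t (clip (-1) 2 (q t) * trunc (prof_n k) t)).

Definition boxed (t : R) : Prop := -1 <= z t <= b /\ -1 <= q t <= 2.

Lemma trunc_boxed F t : boxed t -> trunc F t = F (z t) (q t).
Proof. intros [H1 H2]. unfold trunc. now rewrite !clip_id. Qed.

Lemma trunc_continuous F t :
  F = prof_g k \/ F = prof_n k \/ F = prof_y k -> continuous (trunc F) t.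
Proof.
  intros HF. destruct (truncated_lipschitz k b F Hb HF) as (L & B & _ & HL & _).
  apply (lipschitz2_continuous L (fun x y => F (clip (-1) b x) (clip (-1) 2 y)) z q);
    [exact HL | apply Cz | apply Cq].
Qed.

Variable h : R.
Hypothesis Box : forall t, 0 <= t < h -> boxed t.

Lemma prof_derive_z t : 0 < t < h -> is_derive z t (prof_g k (z t) (q t)).
Proof. intros Ht. rewrite <- trunc_boxed by (apply Box; lra). apply Dz. lra. Qed.

Lemma prof_derive_q t : 0 < t < h -> is_derive q t (q t * prof_n k (z t) (q t)).
Proof.
  intros Ht. assert (B : boxed t) by (apply Box; lra).
  assert (D := Dq t ltac:(lra)). rewrite (trunc_boxed _ _ B), clip_id in D by apply B.
  exact D.
Qed.

Lemma prof_q_pos t : 0 <= t <= h -> 0 < q t.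
Proof.
  apply (linear_growth_pos q (trunc (prof_n k))); [exact Cq| | |].
  - intros s _. apply trunc_continuous. tauto.
  - intros s Hs. rewrite trunc_boxed by (apply Box; lra). now apply prof_derive_q.
  - rewrite q0. unfold q_init. lra.
Qed.

(** At [z = 0] the slope is [k > 0]; for [- 1 / 10 < z < 0] and [q <= 2] the term
    [k (1 - (r z) ^ 2)] still beats [z (1 - r)]. *)
Lemma prof_z_nonneg t : 0 <= t <= h -> 0 <= z t.
Proof.
  intros Ht. apply (barrier_ge z (trunc (prof_g k)) 0 t 0 (/ 10)); try lra; [exact Cz| |].
  - intros s Hs. apply Dz. lra.
  - intros s Hs Hzs. assert (B : boxed s) by (apply Box; lra).
    rewrite trunc_boxed by exact B.
    pose proof (prof_q_pos s ltac:(lra)) as Hq. destruct B as [_ [_ B]].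
    unfold prof_g, prof_r.
    set (x := z s) in *. set (y := q s) in *.
    assert (R1 : - / 5 <= y * x <= 0) by nra.
    set (r := - / 2 + y * x). assert (Hr : - 7 / 10 <= r <= - / 2) by (unfold r; lra).
    assert (R2 : 0 <= r * x <= 7 / 100) by nra.
    assert ((r * x) ^ 2 <= 1 / 100) by nra. nra.
Qed.

Lemma prof_r_ge t : 0 <= t <= h -> - / 2 <= prof_r (z t) (q t).
Proof.
  intros Ht. pose proof (prof_q_pos t Ht). pose proof (prof_z_nonneg t Ht).
  unfold prof_r. nra.
Qed.

Lemma prof_derive_y t : 0 < t < h ->
  is_derive (fun s => 1 - prof_r (z s) (q s) * z s) t
    ((1 - prof_r (z t) (q t) * z t) * prof_y k (z t) (q t)).
Proof.
  intros Ht. pose proof (prof_derive_z t Ht) as D1. pose proof (prof_derive_q t Ht) as D2.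
  pose proof (prof_z_nonneg t ltac:(lra)) as Hz.
  unfold prof_r. auto_derive.
  - repeat split; eexists; eassumption.
  - replace (Derive (fun x => z x) t) with (prof_g k (z t) (q t))
      by (symmetry; now apply is_derive_unique).
    replace (Derive (fun x => q x) t) with (q t * prof_n k (z t) (q t))
      by (symmetry; now apply is_derive_unique).
    unfold prof_y, prof_n, prof_g, prof_r. field. lra.
Qed.

(** The quantity [1 - r z] is a positive multiple of [S - R] wherever [z > 0]. Both sources contain
    the factor [S - R], so it obeys a linear equation and keeps its sign; this is what makes the
    density positive. *)
Lemma prof_y_pos t : 0 <= t <= h -> 0 < 1 - prof_r (z t) (q t) * z t.
Proof.
  apply (linear_growth_pos (fun s => 1 - prof_r (z s) (q s) * z s) (trunc (prof_y k))).
  - intros s. unfold prof_r.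
    apply (continuous_minus (fun _ => 1)); [apply continuous_const|].
    apply (continuous_mult (fun s => - / 2 + q s * z s)); [|apply Cz].
    apply (continuous_plus (fun _ => - / 2)); [apply continuous_const|].
    apply (continuous_mult q); [apply Cq | apply Cz].
  - intros s _. apply trunc_continuous. tauto.
  - intros s Hs. rewrite trunc_boxed by (apply Box; lra). now apply prof_derive_y.
  - rewrite z0. unfold prof_r. lra.
Qed.

Lemma prof_g_le t : 0 <= t <= h -> prof_g k (z t) (q t) <= / 2 + 3 / 2 * z t.
Proof.
  intros Ht. pose proof (prof_r_ge t Ht). pose proof (prof_z_nonneg t Ht).
  unfold prof_g. set (r := prof_r (z t) (q t)) in *.
  pose proof (pow2_ge_0 (r * z t)). nra.
Qed.

(** Adding [1 / 3] turns [z' <= 1 / 2 + 3 / 2 z] into the homogeneous inequality for [z + 1 / 3]. *)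
Lemma prof_z_le t : 0 <= t <= h -> z t <= (exp (3 / 2 * t) - 1) / 3.
Proof.
  intros Ht.
  assert (H : (fun s => (z s + / 3) * exp (- (3 / 2) * s)) t -
              (fun s => (z s + / 3) * exp (- (3 / 2) * s)) 0 <= 0 * (t - 0)).
  { apply (growth_le (fun s => (z s + / 3) * exp (- (3 / 2) * s))
      (fun s => prof_g k (z s) (q s) * exp (- (3 / 2) * s) +
      (z s + / 3) * (- (3 / 2) * exp (- (3 / 2) * s)))); [lra| |].
    - intros s. apply (continuous_mult (fun s => z s + / 3)).
      + apply (continuous_plus z); [apply Cz | apply continuous_const].
      + apply (ex_derive_continuous (fun s => exp (- (3 / 2) * s))). auto_derive. trivial.
    - intros s Hs. split.
      + apply (is_derive_mult (fun s => z s + / 3) (fun s => exp (- (3 / 2) * s)) s);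
          [| |intros; apply Rmult_comm].
        * rewrite <- (Rplus_0_r (prof_g k (z s) (q s))).
          apply (is_derive_plus z (fun _ => / 3)); [apply prof_derive_z; lra|].
          apply (@is_derive_const R_AbsRing R_NormedModule).
        * auto_derive; [trivial|]. ring.
      + pose proof (prof_g_le s ltac:(lra)). pose proof (exp_pos (- (3 / 2) * s)). nra. }
  cbv beta in H. rewrite z0, Rmult_0_r, exp_0 in H.
  assert (E : exp (- (3 / 2) * t) * exp (3 / 2 * t) = 1).
  { rewrite <- exp_plus. replace (- (3 / 2) * t + 3 / 2 * t) with 0 by ring. apply exp_0. }
  pose proof (exp_pos (3 / 2 * t)).
  assert ((z t + / 3) * (exp (- (3 / 2) * t) * exp (3 / 2 * t)) <= / 3 * exp (3 / 2 * t)) by nra.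
  rewrite E in H1. lra.
Qed.

(** In the strip above [q_init] one still has [q z < 1 / 2], so [- 1 / 2 <= r <= 0], and [prof_n] is
    not positive there: [- r z <= z / 2] is absorbed by [z (1 - r) / 2], and
    [k (r z) ^ 2 / 2 <= z ^ 2 / 16 <= 1] by the constant [- 1]. *)
Lemma prof_q_head t : 0 <= t <= h -> (forall s, 0 <= s < t -> z s < 4) -> q t <= q_init.
Proof.
  intros Ht Hh.
  assert (- q_init <= - q t); [|lra].
  apply (barrier_ge (fun s => - q s) (fun s => - (q s * prof_n k (z s) (q s))) 0 t
    (- q_init) (/ 20)); try lra.
  - intros s. apply (continuous_opp q), Cq.
  - intros s Hs. apply (is_derive_opp q). apply prof_derive_q. lra.
  - intros s Hs Hqs. pose proof (prof_q_pos s ltac:(lra)) as Hq.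
    pose proof (prof_z_nonneg s ltac:(lra)) as Hz. specialize (Hh s ltac:(lra)).
    assert (prof_n k (z s) (q s) <= 0); [|nra].
    unfold prof_n. apply Rmult_le_0_r; [|apply Rlt_le, Rinv_0_lt_compat; lra].
    pose proof (prof_r_ge s ltac:(lra)) as Hr.
    assert (Hr' : prof_r (z s) (q s) <= 0) by (unfold prof_r, q_init in *; nra).
    unfold prof_g. set (r := prof_r (z s) (q s)) in *. set (x := z s) in *.
    assert (- x / 2 <= r * x <= 0) by nra.
    assert ((r * x) ^ 2 <= x ^ 2 / 4) by nra. nra.
Qed.

Lemma prof_g_head t : 0 <= t <= h -> z t <= 4 -> q t <= q_init -> / 4 <= prof_g k (z t) (q t).
Proof.
  intros Ht Hz4 Hq4. pose proof (prof_r_ge t Ht) as Hr.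
  pose proof (prof_z_nonneg t Ht) as Hz. pose proof (prof_q_pos t Ht) as Hq.
  assert (Hr' : prof_r (z t) (q t) <= 0) by (unfold prof_r, q_init in *; nra).
  unfold prof_g. set (r := prof_r (z t) (q t)) in *. set (x := z t) in *.
  assert (- x / 2 <= r * x <= 0) by nra.
  assert ((r * x) ^ 2 <= x ^ 2 / 4) by nra. nra.
Qed.

(** For [3 < z < 4] the product [X = r z] lies between [-2] and [1], and there
    [k (1 - X ^ 2) + z - X] is positive. *)
Lemma prof_z_tail a t : 0 <= a -> a <= t <= h -> 4 <= z a -> 4 <= z t.
Proof.
  intros Ha Ht H4.
  apply (barrier_ge z (fun s => prof_g k (z s) (q s)) a t 4 1); try lra; [exact Cz| |].
  - intros s Hs. apply prof_derive_z. lra.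
  - intros s Hs Hzs. pose proof (prof_y_pos s ltac:(lra)) as Hy.
    pose proof (prof_r_ge s ltac:(lra)) as Hr.
    unfold prof_g. set (r := prof_r (z s) (q s)) in *. set (x := z s) in *.
    replace (x * (1 - r)) with (x - r * x) by ring.
    assert (- 2 <= r * x) by nra. set (X := r * x) in *. nra.
Qed.

(** Before [z] reaches 4 the head estimate applies. Afterwards [z >= 4], and [1 - r z > 0] itself
    forces [q] to be small. *)
Lemma prof_q_lt t : 0 <= t <= h -> q t < 2.
Proof.
  intros Ht.
  destruct (classic (forall s, 0 <= s < t -> z s < 4)) as [A|A].
  - pose proof (prof_q_head t Ht A). unfold q_init in *. lra.
  - apply not_all_ex_not in A. destruct A as [s A].
    apply imply_to_and in A. destruct A as [Hs A].
    assert (4 <= z t) by (apply (prof_z_tail s); lra).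
    pose proof (prof_y_pos t Ht) as Hy. unfold prof_r in Hy.
    apply Rnot_le_lt. intros K. nra.
Qed.

End Profile.

(** Before time [16] the solution satisfies [q' >= - 10 q], and [z] reaches [4]. *)
Definition delta_low : R := 4 * q_init * exp (- 160).

(** Long enough for [mass_fun] to gain [2], more than the value [ln 2 + th / 2] that
    corresponds to [x = 1]. *)
Definition horizon : R := 16 + 2 / delta_low.

Lemma delta_low_pos : 0 < delta_low <= / 2.
Proof.
  unfold delta_low, q_init. pose proof (exp_pos (- 160)).
  assert (exp (- 160) < exp 0) by (apply exp_increasing; lra).
  rewrite exp_0 in H0. lra.
Qed.

Lemma horizon_gt : 16 < horizon.
Proof.
  unfold horizon. pose proof delta_low_pos.
  assert (0 < 2 / delta_low) by (apply Rdiv_lt_0_compat; lra). lra.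
Qed.

(** Collects the estimates of the truncated system in a form that no longer mentions the
    truncation. *)
Definition prof_trajectory (k : R) (z q : R -> R) : Prop :=
  (forall t, continuous z t) /\ (forall t, continuous q t) /\ z 0 = 0 /\ q 0 = q_init /\
  (forall t, 0 < t < horizon -> is_derive z t (prof_g k (z t) (q t)) /\
     is_derive q t (q t * prof_n k (z t) (q t))) /\
  (forall t, 0 <= t <= horizon -> 0 < q t /\ 0 <= z t /\
     0 < 1 - prof_r (z t) (q t) * z t /\ - / 2 <= prof_r (z t) (q t)) /\
  (forall t, 0 <= t <= horizon -> z t <= (exp (3 / 2 * t) - 1) / 3) /\
  (forall t, 0 <= t <= horizon -> (forall s, 0 <= s < t -> z s < 4) -> q t <= q_init) /\
  (forall t, 0 <= t <= horizon -> z t <= 4 -> q t <= q_init ->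
     / 4 <= prof_g k (z t) (q t)) /\
  (forall a t, 0 <= a -> a <= t <= horizon -> 4 <= z a -> 4 <= z t).

(** A bootstrap: as long as the clipping has been inactive, the a priori bounds put the solution
    strictly inside the box on its upper sides and away from [-1], so it stays inactive a little
    longer. *)
Lemma prof_trajectory_exists k : / 4 <= k <= / 2 -> exists z q, prof_trajectory k z q.
Proof.
  intros Hk.
  pose proof horizon_gt as Hh.
  (* Larger than the bound [(exp (3 / 2 t) - 1) / 3] on [z] for every [t <= horizon]. *)
  set (b := exp (3 / 2 * horizon)).
  assert (Hb1 : 1 < b).
  { rewrite <- exp_0. apply exp_increasing. lra. }
  assert (Hb : -1 <= b) by lra.
  destruct (truncated_lipschitz k b (prof_g k) Hb) as (L1 & B1 & HL1 & Lip1 & _); [tauto|].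
  assert (bounded_lipschitz (fun x y => clip (-1) 2 y *
    prof_n k (clip (-1) b x) (clip (-1) 2 y))) as (L2 & B2 & HL2 & Lip2 & _).
  { apply (bounded_lipschitz_mult (fun _ y => clip (-1) 2 y)).
    - apply bounded_lipschitz_clip_snd. lra.
    - apply (truncated_lipschitz k b (prof_n k) Hb). tauto. }
  set (L := 1 + L1 + L2).
  destruct (picard_solution L
    (fun x y => prof_g k (clip (-1) b x) (clip (-1) 2 y))
    (fun x y => clip (-1) 2 y * prof_n k (clip (-1) b x) (clip (-1) 2 y)) 0 q_init)
    as (z & q & z0 & q0 & Cz & Cq & D).
  { unfold L. lra. }
  { intros x y x' y'. eapply Rle_trans; [apply Lip1|]. apply Rmult_le_compat_r; [|unfold L; lra].
    pose proof (Rabs_pos (x - x')). pose proof (Rabs_pos (y - y')). lra. }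
  { intros x y x' y'. eapply Rle_trans; [apply Lip2|]. apply Rmult_le_compat_r; [|unfold L; lra].
    pose proof (Rabs_pos (x - x')). pose proof (Rabs_pos (y - y')). lra. }
  assert (Dz : forall t, 0 < t -> is_derive z t (trunc b z q (prof_g k) t))
    by (intros t Ht; apply (D t Ht)).
  assert (Dq : forall t, 0 < t ->
    is_derive q t (clip (-1) 2 (q t) * trunc b z q (prof_n k) t))
    by (intros t Ht; apply (D t Ht)).
  assert (Box : forall t, 0 <= t <= horizon -> boxed b z q t).
  { apply continuous_induction. intros t Ht Bt.
    assert (Q1 : 0 < q t) by (apply (prof_q_pos k b z q Hk Hb Cz Cq q0 Dq t Bt); lra).
    assert (Q2 : q t < 2)
      by (apply (prof_q_lt k b z q Hk Hb Cz Cq z0 q0 Dz Dq t Bt); lra).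
    assert (Z1 : 0 <= z t) by (apply (prof_z_nonneg k b z q Hk Hb Cz Cq z0 q0 Dz Dq t Bt); lra).
    assert (Z2 : z t < b).
    { eapply Rle_lt_trans;
        [apply (prof_z_le k b z q Hk Hb Cz Cq z0 q0 Dz Dq t Bt); lra|].
      assert (exp (3 / 2 * t) <= b) by (apply exp_mono; lra). lra. }
    split; [split; lra|].
    destruct (continuous_eps z t (Cz t) (Rmin 1 (b - z t))) as [d1 [Hd1 H1]];
      [apply Rmin_glb_lt; lra|].
    destruct (continuous_eps q t (Cq t) (Rmin 1 (2 - q t))) as [d2 [Hd2 H2]];
      [apply Rmin_glb_lt; lra|].
    exists (Rmin d1 d2). split; [now apply Rmin_glb_lt|]. intros s Hs.
    pose proof (Rmin_l d1 d2). pose proof (Rmin_r d1 d2).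
    specialize (H1 s ltac:(apply Rabs_lt_between; lra)).
    specialize (H2 s ltac:(apply Rabs_lt_between; lra)).
    pose proof (Rmin_l 1 (b - z t)). pose proof (Rmin_r 1 (b - z t)).
    pose proof (Rmin_l 1 (2 - q t)). pose proof (Rmin_r 1 (2 - q t)).
    apply Rabs_lt_between in H1. apply Rabs_lt_between in H2. split; lra. }
  assert (Bx : forall t, 0 <= t < horizon -> boxed b z q t) by (intros; apply Box; lra).
  exists z, q.
  split; [exact Cz|]. split; [exact Cq|]. split; [exact z0|]. split; [exact q0|].
  split; [|split; [|split; [|split; [|split]]]].
  - intros t Ht. split.
    + exact (prof_derive_z k b z q Dz _ Bx t Ht).
    + exact (prof_derive_q k b z q Dq _ Bx t Ht).
  - intros t Ht. split; [|split; [|split]].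
    + exact (prof_q_pos k b z q Hk Hb Cz Cq q0 Dq _ Bx t Ht).
    + exact (prof_z_nonneg k b z q Hk Hb Cz Cq z0 q0 Dz Dq _ Bx t Ht).
    + exact (prof_y_pos k b z q Hk Hb Cz Cq z0 q0 Dz Dq _ Bx t Ht).
    + exact (prof_r_ge k b z q Hk Hb Cz Cq z0 q0 Dz Dq _ Bx t Ht).
  - intros t Ht. exact (prof_z_le k b z q Hk Hb Cz Cq z0 q0 Dz Dq _ Bx t Ht).
  - intros t Ht. exact (prof_q_head k b z q Hk Hb Cz Cq z0 q0 Dz Dq _ Bx t Ht).
  - intros t Ht. exact (prof_g_head k b z q Hk Hb Cz Cq z0 q0 Dz Dq _ Bx t Ht).
  - intros a t Ha Ht. exact (prof_z_tail k b z q Hk Hb Cz Cq z0 q0 Dz Dq _ Bx a t Ha Ht).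
Qed.

(** * Inversion of monotone functions and parametrization of the orbit *)

Lemma strict_growth (f df : R -> R) a b : a < b -> (forall t, continuous f t) ->
  (forall t, a < t < b -> is_derive f t (df t) /\ 0 < df t) -> f a < f b.
Proof.
  intros Hab Hc Hd.
  set (c := (a + b) / 2). set (d := (c + b) / 2).
  assert (H1 : 0 * (c - a) <= f c - f a).
  { apply (growth_ge f df); [unfold c; lra|exact Hc|].
    intros t Ht. destruct (Hd t) as [A B]; [unfold c in *; lra|]. split; [exact A | lra]. }
  assert (H2 : 0 * (b - c) <= f b - f c).
  { apply (growth_ge f df); [unfold c; lra|exact Hc|].
    intros t Ht. destruct (Hd t) as [A B]; [unfold c in *; lra|]. split; [exact A | lra]. }
  destruct (Rle_lt_or_eq_dec (f a) (f b)) as [L|E]; [lra|exact L|exfalso].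
  (* otherwise [f] is constant on [[a,b]], contradicting the positive derivative at [c] *)
  destruct (Hd c) as [Dc Pc]; [unfold c; lra|].
  assert (K : is_derive f c 0).
  { apply (is_derive_ext_loc (fun _ => f a)).
    - assert (Hp : 0 < (b - a) / 2) by lra.
      exists (mkposreal _ Hp). intros y Hy. change (Rabs (y - c) < (b - a) / 2) in Hy.
      apply Rabs_lt_between in Hy.
      assert (0 * (y - a) <= f y - f a).
      { apply (growth_ge f df); [unfold c in *; lra|exact Hc|].
        intros t Ht. destruct (Hd t) as [A B]; [unfold c in *; lra|]. split; [exact A | lra]. }
      assert (0 * (b - y) <= f b - f y).
      { apply (growth_ge f df); [unfold c in *; lra|exact Hc|].
        intros t Ht. destruct (Hd t) as [A B]; [unfold c in *; lra|]. split; [exact A | lra]. }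
      lra.
    - apply (@is_derive_const R_AbsRing R_NormedModule). }
  apply is_derive_unique in K. apply is_derive_unique in Dc. lra.
Qed.

Lemma inverse_function (f df : R -> R) h : 0 < h -> (forall t, continuous f t) ->
  (forall t, 0 < t < h -> is_derive f t (df t) /\ 0 < df t) ->
  exists g : R -> R,
    (forall t, 0 <= t <= h -> g (f t) = t) /\
    (forall y, f 0 < y < f h -> 0 < g y < h /\ f (g y) = y /\ is_derive g y (/ df (g y))).
Proof.
  intros Hh Hc Hd.
  assert (mono : forall s t, 0 <= s -> s < t -> t <= h -> f s < f t).
  { intros s t Hs Hst Ht. apply (strict_growth f df); [exact Hst|exact Hc|].
    intros x Hx. apply Hd. lra. }
  (* Any preimage in the interval is chosen, with default 0 outside the range; strict monotonicity
     makes the choice unique. *)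
  destruct (classical_choice (fun y t => (exists s, 0 <= s <= h /\ f s = y) ->
    0 <= t <= h /\ f t = y)) as [g Hg].
  { intros y. destruct (classic (exists s, 0 <= s <= h /\ f s = y)) as [[s Hs]|N].
    - exists s. now intros _.
    - exists 0. tauto. }
  assert (Gf : forall t, 0 <= t <= h -> g (f t) = t).
  { intros t Ht. destruct (Hg (f t)) as [B E]; [now exists t|].
    destruct (Rtotal_order (g (f t)) t) as [L|[E'|L]]; [|exact E'|].
    - specialize (mono (g (f t)) t). lra.
    - specialize (mono t (g (f t))). lra. }
  assert (Gy : forall y, f 0 <= y <= f h -> 0 <= g y <= h /\ f (g y) = y).
  { intros y Hy. apply Hg. destruct (Req_dec y (f 0)) as [->|N].
    - exists 0. split; [lra | reflexivity].
    - destruct (first_time f 0 h y) as (s & Hs & E & _); [lra|exact Hc|lra|lra|].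
      exists s. split; [lra | exact E]. }
  exists g. split; [exact Gf|]. intros y Hy.
  destruct (Gy y ltac:(lra)) as [B0 E].
  assert (B : 0 < g y < h).
  { split; apply Rnot_le_lt; intros K.
    - replace (g y) with 0 in E by lra. lra.
    - replace (g y) with h in E by lra. lra. }
  split; [exact B|]. split; [exact E|].
  assert (Cg : continuity_pt g y).
  { apply (continuity_pt_recip_interv f g 0 h Hh).
    - intros s x Hs Hsx Hx. now apply mono.
    - intros x Hx1 Hx2. now apply Gy.
    - intros x Hx1 Hx2. now apply Gy.
    - intros x _. apply continuity_pt_filterlim, Hc.
    - exact Hy. }
  set (d := Rmin (g y) (h - g y) / 2).
  assert (Hd0 : 0 < Rmin (g y) (h - g y)) by (apply Rmin_glb_lt; lra).
  pose proof (Rmin_l (g y) (h - g y)). pose proof (Rmin_r (g y) (h - g y)).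
  assert (Hl : derivable_pt_lim f (g y) (df (g y))) by (apply is_derive_Reals, Hd, B).
  assert (Pf : forall x, g (f (g y - d)) <= x <= g (f (g y + d)) -> derivable_pt f x).
  { intros x. rewrite !Gf by (unfold d; lra). intros Hx. exists (df x).
    apply is_derive_Reals, Hd. unfold d in Hx. lra. }
  assert (Pg : g (f (g y - d)) <= g y <= g (f (g y + d)))
    by (rewrite !Gf by (unfold d; lra); unfold d; lra).
  assert (Ed : derive_pt f (g y) (Pf (g y) Pg) = df (g y)) by now apply derive_pt_eq_0.
  apply is_derive_Reals. rewrite <- Ed, <- Rdiv_1_l.
  assert (Ml : f (g y - d) < f (g y)) by (apply mono; unfold d; lra).
  assert (Mr : f (g y) < f (g y + d)) by (apply mono; unfold d; lra).
  assert (f 0 < f (g y - d)) by (apply mono; unfold d; lra).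
  assert (f (g y + d) < f h) by (apply mono; unfold d; lra).
  apply (derivable_pt_lim_recip_interv f g (f (g y - d)) (f (g y + d))).
  - exact Cg.
  - lra.
  - lra.
  - intros x Hx. exact (proj2 (Gy x ltac:(lra))).
  - rewrite Ed. apply Rgt_not_eq, Hd, B.
Qed.

(** Since [s] changes at rate [q z] along a minus characteristic, this is the gap [s_star - s] at
    profile time [t]. *)
Definition mass_fun (z q : R -> R) (t : R) : R := RInt (fun s => q s * z s) 0 t.

(** [Rabs] only makes the integrand continuous on the whole line. *)
Definition plus_time (z q : R -> R) (t : R) : R :=
  RInt (fun s => q s * z s ^ 2 * / (1 + Rabs (z s) / 2)) 0 t.

Lemma is_derive_RInt_0 (f : R -> R) t : (forall s, continuous f s) ->
  is_derive (fun t => RInt f 0 t) t (f t).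
Proof.
  intros Hf. apply (is_derive_RInt f (fun t => RInt f 0 t) 0 t); [|apply Hf].
  exists (mkposreal 1 Rlt_0_1). intros s _.
  apply (@RInt_correct R_CompleteNormedModule), continuous_ex_RInt, Hf.
Qed.

Lemma is_derive_continuous (f : R -> R) t l : is_derive f t l -> continuous f t.
Proof. intros H. apply (ex_derive_continuous f). now exists l. Qed.

Lemma is_derive_minus_R (f g : R -> R) t a b :
  is_derive f t a -> is_derive g t b -> is_derive (fun t => f t - g t) t (a - b).
Proof. apply (is_derive_minus f g). Qed.

Lemma is_derive_scal_R (f : R -> R) t l a :
  is_derive f t l -> is_derive (fun t => a * f t) t (a * l).
Proof. intros H. now apply (is_derive_scal f t a l). Qed.

(** [g] inverts [mass_fun], hence recovers the time to blow-up from [s* - s]. *)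
Definition mass_inverse (z q g : R -> R) : Prop :=
  (forall t, 0 <= t <= horizon -> g (mass_fun z q t) = t) /\
  (forall y, 0 < y < mass_fun z q horizon ->
     0 < g y < horizon /\ mass_fun z q (g y) = y /\ is_derive g y (/ (q (g y) * z (g y)))).

Section Data.

Variables (k : R) (z q : R -> R).
Hypothesis (Hk : / 4 <= k <= / 2) (HT : prof_trajectory k z q).

Let Cz : forall t, continuous z t := proj1 HT.
Let Cq : forall t, continuous q t := proj1 (proj2 HT).

Lemma mass_integrand_continuous s : continuous (fun s => q s * z s) s.
Proof. apply (continuous_mult q z); [apply Cq | apply Cz]. Qed.

Lemma plus_integrand_continuous s :
  continuous (fun s => q s * z s ^ 2 * / (1 + Rabs (z s) / 2)) s.
Proof.
  apply (continuous_mult (fun s => q s * z s ^ 2) (fun s => / (1 + Rabs (z s) / 2))).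
  - apply (continuous_mult q (fun s => z s ^ 2)); [apply Cq|].
    apply (continuous_comp z (fun y => y ^ 2)); [apply Cz|].
    apply (ex_derive_continuous (fun y => y ^ 2)). auto_derive. trivial.
  - apply (continuous_comp (fun s => Rabs (z s)) (fun y => / (1 + y / 2))).
    + apply (continuous_comp z Rabs); [apply Cz | apply continuous_Rabs].
    + apply (ex_derive_continuous (fun y => / (1 + y / 2))). auto_derive.
      pose proof (Rabs_pos (z s)). lra.
Qed.

Lemma mass_derive t : is_derive (mass_fun z q) t (q t * z t).
Proof. apply (is_derive_RInt_0 (fun s => q s * z s)), mass_integrand_continuous. Qed.

Lemma plus_derive t : 0 <= t <= horizon ->
  is_derive (plus_time z q) t (q t * z t ^ 2 * / (1 + z t / 2)).
Proof.
  intros Ht. pose proof HT as (_ & _ & _ & _ & _ & P & _).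
  destruct (P t Ht) as (_ & Hz & _).
  rewrite <- (Rabs_pos_eq (z t)) at 2 by exact Hz.
  apply (is_derive_RInt_0 (fun s => q s * z s ^ 2 * / (1 + Rabs (z s) / 2))).
  exact plus_integrand_continuous.
Qed.

Lemma mass_continuous t : continuous (mass_fun z q) t.
Proof. eapply is_derive_continuous, mass_derive. Qed.

Lemma plus_continuous t : continuous (plus_time z q) t.
Proof.
  eapply is_derive_continuous.
  apply (is_derive_RInt_0 (fun s => q s * z s ^ 2 * / (1 + Rabs (z s) / 2))).
  exact plus_integrand_continuous.
Qed.

Lemma mass_0 : mass_fun z q 0 = 0.
Proof. exact (RInt_point 0 (V := R_CompleteNormedModule) _). Qed.

Lemma plus_0 : plus_time z q 0 = 0.
Proof. exact (RInt_point 0 (V := R_CompleteNormedModule) _). Qed.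

Lemma exp_2_le : exp 2 <= 9.
Proof.
  replace 2 with (1 + 1) by ring. rewrite exp_plus. pose proof exp_le_3.
  pose proof (exp_pos 1). nra.
Qed.

(** With slope at least [1 / 4], [z] climbs to 4 by time 16. Up to time [6 / 5] the exponential
    bound gives [z <= (9 - 1) / 3 < 4], which leaves room for the blow-up time [th] inside the
    head. *)
Lemma head_exists : exists a, 6 / 5 < a <= 16 /\ z a = 4 /\ forall t, 0 <= t < a -> z t < 4.
Proof.
  pose proof HT as (_ & _ & z0 & q0 & D & P & ZL & QH & GH & ZT).
  pose proof horizon_gt as Hh.
  destruct (classic (exists s, 0 <= s <= 16 /\ 4 <= z s)) as [(s & Hs & H4)|N].
  - destruct (first_time z 0 s 4) as (a & Ha & Ea & La); [lra|exact Cz|lra|lra|].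
    exists a. split; [|split; [exact Ea | exact La]].
    split; [|lra]. apply Rnot_le_lt. intros K.
    pose proof (ZL a ltac:(lra)) as Z.
    assert (exp (3 / 2 * a) <= exp 2) by (apply exp_mono; lra).
    pose proof exp_2_le. lra.
  - exfalso.
    assert (L : forall s, 0 <= s <= 16 -> z s < 4).
    { intros s Hs. apply Rnot_le_lt. intros K. apply N. now exists s. }
    assert (/ 4 * (16 - 0) <= z 16 - z 0).
    { apply (growth_ge z (fun s => prof_g k (z s) (q s))); [lra|exact Cz|].
      intros t Ht. split; [apply D; lra|].
      assert (q t <= q_init) by (apply QH; [lra | intros; apply L; lra]).
      apply GH; [lra| |assumption]. apply Rlt_le, L. lra. }
    specialize (L 16). lra.
Qed.

Lemma z_pos t : 0 < t <= horizon -> 0 < z t.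
Proof.
  intros Ht. destruct head_exists as (a & Ha & Ea & La).
  pose proof HT as (_ & _ & z0 & q0 & D & P & ZL & QH & GH & ZT).
  destruct (Rle_dec a t) as [L|L].
  - assert (4 <= z t) by (apply (ZT a); lra). lra.
  - assert (/ 4 * (t - 0) <= z t - z 0); [|lra].
    apply (growth_ge z (fun s => prof_g k (z s) (q s))); [lra|exact Cz|].
    intros s Hs. split; [apply D; lra|].
    assert (q s <= q_init) by (apply QH; [lra | intros; apply La; lra]).
    apply GH; [lra| |assumption]. apply Rlt_le, La. lra.
Qed.

(** Two phases: up to [a] the decay of [q] is at most exponential with rate 10, so
    [q z >= delta_low] when [z = 4]. Afterwards [q z] cannot fall below that level, because
    [q z <= 1 / 2] gives [- 1 / 2 <= r <= 0], and then [q z] does not decrease. *)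
Lemma delta_tail a t : 0 < a <= 16 -> z a = 4 -> (forall t, 0 <= t < a -> z t < 4) ->
  a <= t <= horizon -> delta_low <= q t * z t.
Proof.
  intros Ha Ea La Ht.
  assert (Zp := z_pos).
  pose proof HT as (_ & _ & z0 & q0 & D & P & ZL & QH & GH & ZT).
  pose proof horizon_gt as Hh. pose proof delta_low_pos as Hdl.
  assert (E : 0 * (a - 0) <= q a * exp (10 * a) - q 0 * exp (10 * 0)).
  { apply (growth_ge (fun s => q s * exp (10 * s))
      (fun s => q s * prof_n k (z s) (q s) * exp (10 * s) + q s * (10 * exp (10 * s)))).
    - lra.
    - intros s. apply (continuous_mult q (fun s => exp (10 * s))); [apply Cq|].
      apply (ex_derive_continuous (fun s => exp (10 * s))). auto_derive. trivial.
    - intros s Hs. split.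
      + apply (is_derive_mult q (fun s => exp (10 * s)) s);
          [apply D; lra| |intros; apply Rmult_comm].
        auto_derive; [trivial|]. ring.
      + pose proof (exp_pos (10 * s)). destruct (P s) as (Q & Z & Y & R0); [lra|].
        (* The numerator exceeds [- 1 - 1 - 1 - 13 / 4], by [r >= - 1 / 2], [r z < 1], and
           [g <= 1 / 2 + 3 / 2 * 4]. *)
        assert (- 10 <= prof_n k (z s) (q s)).
        { unfold prof_n, Rdiv at 1.
          assert (Q4 : q s <= q_init) by (apply QH; [lra | intros; apply La; lra]).
          specialize (La s ltac:(lra)).
          assert (0 < / (1 + z s / 2) <= 1).
          { split; [apply Rinv_0_lt_compat; lra|]. rewrite <- Rinv_1.
            apply Rinv_le_contravar; lra. }
          assert (G : prof_g k (z s) (q s) <= 13 / 2).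
          { unfold prof_g. set (r := prof_r (z s) (q s)) in *.
            pose proof (pow2_ge_0 (r * z s)). nra. }
          set (n := 2 * prof_r (z s) (q s) - 1 - prof_r (z s) (q s) * z s -
            prof_g k (z s) (q s) / 2).
          assert (- 10 <= n) by (unfold n; lra). nra. }
        replace (q s * prof_n k (z s) (q s) * exp (10 * s) + q s * (10 * exp (10 * s))) with
          (q s * exp (10 * s) * (prof_n k (z s) (q s) + 10)) by ring.
        apply Rmult_le_pos; [apply Rmult_le_pos|]; lra. }
  rewrite q0, Rmult_0_r, exp_0 in E.
  assert (Qa : q_init * exp (- 160) <= q a).
  { assert (E1 : exp (10 * a) * exp (- (10 * a)) = 1) by
      (rewrite <- exp_plus, Rplus_opp_r; apply exp_0).
    assert (E2 : exp (- 160) <= exp (- (10 * a))) by (apply exp_mono; lra).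
    pose proof (exp_pos (- (10 * a))).
    assert (q_init * 1 * exp (- (10 * a)) <= q a * exp (10 * a) * exp (- (10 * a)))
      by (apply Rmult_le_compat_r; lra).
    assert (q_init * exp (- 160) <= q_init * exp (- (10 * a)))
      by (apply Rmult_le_compat_l; unfold q_init; lra).
    replace (q a * exp (10 * a) * exp (- (10 * a))) with
      (q a * (exp (10 * a) * exp (- (10 * a)))) in H0 by ring.
    rewrite E1 in H0. lra. }
  apply (barrier_ge (fun s => q s * z s)
    (fun s => q s * prof_n k (z s) (q s) * z s + q s * prof_g k (z s) (q s)) a t
    delta_low delta_low); try lra.
  - exact mass_integrand_continuous.
  - intros s Hs. destruct (D s) as [Dz Dq]; [lra|].
    apply (is_derive_mult q z s); [exact Dq|exact Dz|intros; apply Rmult_comm].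
  - intros s Hs Hds. destruct (P s) as (Q & Z & Y & R0); [lra|].
    specialize (Zp s ltac:(lra)).
    assert (Hr : prof_r (z s) (q s) <= 0) by (unfold prof_r; lra).
    replace (q s * prof_n k (z s) (q s) * z s + q s * prof_g k (z s) (q s)) with
      (q s * (k * (1 - (prof_r (z s) (q s) * z s) ^ 2)
         + prof_r (z s) (q s) * z s * (1 - z s)) * / (1 + z s / 2)).
    2: { unfold prof_n, prof_g. field. lra. }
    apply Rmult_le_pos; [|apply Rlt_le, Rinv_0_lt_compat; lra].
    apply Rmult_le_pos; [lra|].
    clear - Hr R0 Hk Zp. set (p := - prof_r (z s) (q s)).
    replace (prof_r (z s) (q s)) with (- p) by (unfold p; ring).
    assert (Hp : 0 <= p <= / 2) by (unfold p; lra).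
    set (x := z s) in *.
    (* discriminant: [p ^ 2 <= 4 k p (1 - k p)] *)
    assert (K : p <= 4 * k * (1 - k * p)) by nra.
    assert (C : 0 < 1 - k * p) by nra.
    replace (k * (1 - (- p * x) ^ 2) + - p * x * (1 - x)) with
      (k - p * x + p * (1 - k * p) * x ^ 2) by ring.
    apply (Rmult_le_reg_l (4 * (1 - k * p))); [lra|]. rewrite Rmult_0_r.
    replace (4 * (1 - k * p) * (k - p * x + p * (1 - k * p) * x ^ 2)) with
      (4 * k * (1 - k * p) - p + p * (1 - 2 * (1 - k * p) * x) ^ 2) by ring.
    pose proof (pow2_ge_0 (1 - 2 * (1 - k * p) * x)). nra.
  - unfold delta_low in *. rewrite Ea. lra.
Qed.

Lemma profile_times : exists a th e1,
  0 < th < 6 / 5 /\ th < a /\ a < e1 < horizon /\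
  (forall t, 0 <= t <= a -> q t <= q_init /\ z t <= 4) /\
  th / 2 - mass_fun z q th = ln (3 / 2) /\
  mass_fun z q e1 = ln 2 + th / 2 /\
  th < plus_time z q e1.
Proof.
  destruct head_exists as (a & Ha & Ea & La).
  pose proof (fun t => delta_tail a t ltac:(lra) Ea La) as DT.
  pose proof HT as (_ & _ & z0 & q0 & D & P & ZL & QH & GH & ZT).
  pose proof horizon_gt as Hh. pose proof delta_low_pos as Hdl.
  assert (Hd : forall t, 0 <= t <= a -> q t <= q_init /\ z t <= 4).
  { intros t Ht. split.
    - apply QH; [lra|]. intros s Hs. apply La. lra.
    - destruct (Req_dec t a) as [->|N]; [lra | apply Rlt_le, La; lra]. }
  assert (A_head : forall s t, 0 <= s <= t -> t <= a ->
    mass_fun z q t - mass_fun z q s <= 4 / 1000 * (t - s)).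
  { intros s t Hs Ht. apply (growth_le _ (fun s => q s * z s)); [lra|exact mass_continuous|].
    intros x Hx. split; [apply mass_derive|].
    destruct (Hd x) as [Q Z]; [lra|]. destruct (P x) as (Q' & Z' & _); [lra|].
    unfold q_init in *. nra. }
  assert (L1 : / 2 < ln 2) by apply ln_lt_2.
  assert (L2 : ln 2 < 1).
  { rewrite <- (ln_exp 1). apply ln_increasing; [lra|]. pose proof (exp_ineq1 1). lra. }
  assert (L3 : 0 < ln (3 / 2)) by (rewrite <- ln_1; apply ln_increasing; lra).
  assert (L4 : ln (3 / 2) < / 2).
  { rewrite <- (ln_exp (/ 2)). apply ln_increasing; [lra|]. pose proof (exp_ineq1 (/ 2)). lra. }
  destruct (first_time (fun t => t / 2 - mass_fun z q t) 0 (6 / 5) (ln (3 / 2)))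
    as (th & Hth & Eth & _); [lra| | | |].
  { intros t. apply (continuous_minus (fun t => t / 2) (mass_fun z q)); [|apply mass_continuous].
    apply (ex_derive_continuous (fun t => t / 2)). auto_derive. trivial. }
  { rewrite mass_0. lra. }
  { specialize (A_head 0 (6 / 5)). rewrite mass_0 in A_head. lra. }
  assert (Hth' : th < 6 / 5).
  { destruct (Req_dec th (6 / 5)) as [E|]; [exfalso | lra].
    specialize (A_head 0 (6 / 5)). rewrite mass_0 in A_head. rewrite E in Eth. lra. }
  assert (Aa : mass_fun z q a <= 8 / 100).
  { specialize (A_head 0 a). rewrite mass_0 in A_head. lra. }
  assert (AH : 2 <= mass_fun z q horizon - mass_fun z q a).
  { apply Rle_trans with (delta_low * (horizon - a)).
    - unfold horizon. apply Rle_trans with (delta_low * (2 / delta_low)).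
      + right. field. lra.
      + apply Rmult_le_compat_l; lra.
    - apply (growth_ge _ (fun s => q s * z s)); [lra|exact mass_continuous|].
      intros x Hx. split; [apply mass_derive|]. apply DT. lra. }
  assert (A0 : 0 <= mass_fun z q a).
  { assert (0 * (a - 0) <= mass_fun z q a - mass_fun z q 0); [|rewrite mass_0 in *; lra].
    apply (growth_ge _ (fun s => q s * z s)); [lra|exact mass_continuous|].
    intros x Hx. split; [apply mass_derive|]. destruct (P x) as (Q' & Z' & _); [lra|]. nra. }
  destruct (first_time (mass_fun z q) a horizon (ln 2 + th / 2))
    as (e1 & He1 & Ee1 & _); [lra|exact mass_continuous|lra|lra|].
  assert (He1' : e1 < horizon).
  { destruct (Req_dec e1 horizon) as [E|]; [exfalso; rewrite E in Ee1; lra | lra]. }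
  exists a, th, e1.
  split; [lra|]. split; [lra|]. split; [lra|]. split; [exact Hd|].
  split; [exact Eth|]. split; [exact Ee1|].
  (* For [z >= 4] one has [z / (1 + z / 2) >= 4 / 3], so [plus_time] gains at least [4 / 3] of the
     gain of [mass_fun]. With [mass_fun a <= 8 / 100], [ln 2 > 1 / 2] and [th < 6 / 5] this exceeds
     [th]. *)
  assert (Tp : 0 * (e1 - a) <=
    (plus_time z q e1 - 4 / 3 * mass_fun z q e1) - (plus_time z q a - 4 / 3 * mass_fun z q a)).
  { apply (growth_ge (fun t => plus_time z q t - 4 / 3 * mass_fun z q t)
      (fun s => q s * z s ^ 2 * / (1 + z s / 2) - 4 / 3 * (q s * z s))); [lra| |].
    - intros t. apply (continuous_minus (plus_time z q)); [apply plus_continuous|].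
      apply (continuous_mult (fun _ => 4 / 3) (mass_fun z q));
        [apply continuous_const | apply mass_continuous].
    - intros x Hx. destruct (P x) as (Q' & Z' & _); [lra|].
      assert (H4 : 4 <= z x) by (apply (ZT a); lra).
      split.
      + apply is_derive_minus_R; [apply plus_derive; lra|].
        apply is_derive_scal_R, mass_derive.
      + replace (q x * z x ^ 2 * / (1 + z x / 2) - 4 / 3 * (q x * z x)) with
          (q x * z x * (z x / 3 - 4 / 3) * / (1 + z x / 2)) by (field; lra).
        apply Rmult_le_pos; [|apply Rlt_le, Rinv_0_lt_compat; lra].
        apply Rmult_le_pos; [apply Rmult_le_pos|]; lra. }
  assert (T0 : 0 * (a - 0) <= plus_time z q a - plus_time z q 0).
  { apply (growth_ge _ (fun s => q s * z s ^ 2 * / (1 + z s / 2)));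
      [lra|exact plus_continuous|].
    intros x Hx. split; [apply plus_derive; lra|]. destruct (P x) as (Q' & Z' & _); [lra|].
    apply Rmult_le_pos; [|apply Rlt_le, Rinv_0_lt_compat; lra].
    apply Rmult_le_pos; [lra|]. apply pow2_ge_0. }
  rewrite plus_0 in T0. lra.
Qed.

Lemma prof_facts t : 0 < t < horizon ->
  0 < z t /\ 0 < q t /\ 0 < 1 - prof_r (z t) (q t) * z t /\ 0 < 1 + z t / 2 /\
  is_derive z t (prof_g k (z t) (q t)) /\ is_derive q t (q t * prof_n k (z t) (q t)).
Proof.
  intros Ht. pose proof (z_pos t ltac:(lra)) as Hz.
  pose proof HT as (_ & _ & _ & _ & D & P & _).
  destruct (D t Ht) as [D1 D2]. destruct (P t ltac:(lra)) as (Q & _ & Y & _).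
  split; [exact Hz|]. split; [exact Q|]. split; [exact Y|]. split; [lra|].
  now split.
Qed.

Lemma mass_inverse_exists : exists g, mass_inverse z q g.
Proof.
  pose proof horizon_gt.
  destruct (inverse_function (mass_fun z q) (fun t => q t * z t) horizon) as (g & G1 & G2);
    [lra| |..].
  - intros t. apply mass_continuous.
  - intros t Ht. split; [apply mass_derive|].
    destruct (prof_facts t Ht) as (Hz & Hq & _).
    now apply Rmult_lt_0_compat.
  - exists g. split; [exact G1|]. intros y Hy. apply G2.
    rewrite mass_0. exact Hy.
Qed.

Lemma plus_inverse_exists : exists g, (forall t, 0 <= t <= horizon -> g (plus_time z q t) = t) /\
    (forall y, 0 < y < plus_time z q horizon ->
      0 < g y < horizon /\ plus_time z q (g y) = y /\
      is_derive g y (/ (q (g y) * z (g y) ^ 2 * / (1 + z (g y) / 2)))).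
Proof.
  pose proof horizon_gt.
  destruct (inverse_function (plus_time z q)
    (fun t => q t * z t ^ 2 * / (1 + z t / 2)) horizon) as (g & G1 & G2); [lra| |..].
  - intros t. apply plus_continuous.
  - intros t Ht. split; [apply plus_derive; lra|].
    destruct (prof_facts t Ht) as (Hz & Hq & _ & Hd & _).
    apply Rmult_lt_0_compat; [|now apply Rinv_0_lt_compat].
    apply Rmult_lt_0_compat; [assumption|]. now apply pow_lt.
  - exists g. split; [exact G1|]. intros y Hy. apply G2.
    rewrite plus_0. exact Hy.
Qed.

End Data.

(** * Velocity and density profiles *)

Definition prof_U (z q : R) : R := (/ z + prof_r z q) / 2.

(** In terms of the scaled speeds [1 / z] and [r], the velocity profile is half their sum and
    [1 / B] half their difference. *)
Definition prof_B (z q : R) : R := 2 * z / (1 - prof_r z q * z).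

Definition prof_dr (k z q : R) : R := q * prof_n k z q * z + q * prof_g k z q.

(** The derivative with respect to [s], obtained from the one in profile time through
    [d eta / d s = - 1 / (q z)]. Likewise for [prof_B']. *)
Definition prof_U' (k z q : R) : R :=
  (prof_g k z q / z ^ 2 - prof_dr k z q) / (2 * (q * z)).

Definition prof_B' (k z q : R) : R :=
  - (2 * (prof_g k z q + z ^ 2 * prof_dr k z q) / (1 - prof_r z q * z) ^ 2) / (q * z).

Lemma prof_mass_equation k z q : 0 < z -> 0 < q -> 0 < 1 - prof_r z q * z ->
  prof_B z q + prof_B' k z q / 2 + prof_U z q * prof_B' k z q
    + prof_B z q * prof_U' k z q + 4 * k * prof_B z q * prof_U z q = 0.
Proof.
  intros Hz Hq Hy. unfold prof_B', prof_U', prof_dr, prof_n, prof_B, prof_U, prof_g, prof_r in *.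
  field. lra.
Qed.

Lemma prof_momentum_equation k z q : 0 < z -> 0 < q -> 0 < 1 - prof_r z q * z ->
  - prof_U z q + prof_U' k z q / 2 + prof_U z q * (prof_U z q + prof_U' k z q)
    + (prof_B' k z q - prof_B z q) / prof_B z q ^ 3 = 0.
Proof.
  intros Hz Hq Hy. unfold prof_B', prof_U', prof_dr, prof_n, prof_B, prof_U, prof_g, prof_r in *.
  field. repeat split; lra.
Qed.

(** * The self-similar solution *)

(** The primitive equations are invariant under [x -> a x], [1 + t -> b (1 + t)], [u -> (a / b) u],
    [rb -> (b / a) rb]. The ansatz consists of the fields fixed by the subgroup [a ^ 2 b = 1], which
    leaves this variable invariant. *)
Definition sim_var (p : R * R) : R := ln (fst p) + ln (1 + snd p) / 2.

Definition sim_u (U : R -> R) (p : R * R) : R := fst p * / (1 + snd p) * U (sim_var p).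

Definition sim_rb (B : R -> R) (p : R * R) : R := (1 + snd p) * / fst p * B (sim_var p).

Lemma gradient_1_snd D p : is_gradient_within D (fun y => 1 + snd y) p 0 1.
Proof.
  eapply gradient_eq.
  - apply (gradient_plus D (fun _ => 1) snd p 0 0 0 1); [|apply gradient_snd].
    pose proof (@within_filter _ D _ (@filter_filter _ _ (@locally_filter plane p))) as FF.
    apply (@filterdiff_ext_lin R_AbsRing plane R_NormedModule _ _ _ (fun _ => zero)).
    + apply filterdiff_const.
    + intros y. change (0 = fst y * 0 + snd y * 0). ring.
  - ring.
  - ring.
Qed.

Lemma gradient_sim_var D p : D p -> 0 < fst p -> 0 < 1 + snd p ->
  is_gradient_within D sim_var p (/ fst p) (/ (2 * (1 + snd p))).
Proof.
  intros Dp Hx Ht. eapply gradient_eq.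
  - apply (gradient_plus D (fun y => ln (fst y)) (fun y => ln (1 + snd y) / 2)).
    + apply (gradient_comp D fst p 1 0 ln (/ fst p) Dp (gradient_fst D p)).
      auto_derive; [exact Hx|]. ring.
    + apply (gradient_comp D (fun y => 1 + snd y) p 0 1 (fun y => ln y / 2)
        (/ (2 * (1 + snd p))) Dp (gradient_1_snd D p)).
      auto_derive; [exact Ht|]. field. lra.
  - ring.
  - ring.
Qed.

Lemma gradient_sim_comp D p (F : R -> R) F1 : D p -> 0 < fst p -> 0 < 1 + snd p ->
  is_derive F (sim_var p) F1 ->
  is_gradient_within D (fun y => F (sim_var y)) p (F1 / fst p) (F1 / (2 * (1 + snd p))).
Proof.
  intros Dp Hx Ht HF.
  exact (gradient_comp D sim_var p _ _ F F1 Dp (gradient_sim_var D p Dp Hx Ht) HF).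
Qed.

Lemma gradient_sim_u D p (U : R -> R) U1 : D p -> 0 < fst p -> 0 < 1 + snd p ->
  is_derive U (sim_var p) U1 ->
  is_gradient_within D (sim_u U) p
    (/ (1 + snd p) * (U (sim_var p) + U1))
    (fst p * / (1 + snd p) ^ 2 * (- U (sim_var p) + U1 / 2)).
Proof.
  intros Dp Hx Ht HU. eapply gradient_eq.
  - eapply (gradient_mult D (fun y => fst y * / (1 + snd y)) (fun y => U (sim_var y)) p
      (/ (1 + snd p)) (- (fst p * / (1 + snd p) ^ 2)) _ _ Dp).
    + eapply gradient_eq.
      * eapply (gradient_mult D fst (fun y => / (1 + snd y)) p 1 0 _ _ Dp (gradient_fst D p)
          (gradient_inv D (fun y => 1 + snd y) p 0 1 Dp (Rgt_not_eq _ _ Ht) (gradient_1_snd D p))).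
      * cbv beta. field. lra.
      * cbv beta. field. lra.
    + exact (gradient_sim_comp D p U U1 Dp Hx Ht HU).
  - cbv beta. field. lra.
  - cbv beta. field. lra.
Qed.

Lemma gradient_sim_rb D p (B : R -> R) B1 : D p -> 0 < fst p -> 0 < 1 + snd p ->
  is_derive B (sim_var p) B1 ->
  is_gradient_within D (sim_rb B) p
    ((1 + snd p) * / fst p ^ 2 * (B1 - B (sim_var p)))
    (/ fst p * (B (sim_var p) + B1 / 2)).
Proof.
  intros Dp Hx Ht HB. eapply gradient_eq.
  - eapply (gradient_mult D (fun y => (1 + snd y) * / fst y) (fun y => B (sim_var y)) p
      (- ((1 + snd p) * / fst p ^ 2)) (/ fst p) _ _ Dp).
    + eapply gradient_eq.
      * eapply (gradient_mult D (fun y => 1 + snd y) (fun y => / fst y) p 0 1 _ _ Dp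
          (gradient_1_snd D p)
          (gradient_inv D fst p 1 0 Dp (Rgt_not_eq _ _ Hx) (gradient_fst D p))).
      * cbv beta. field. lra.
      * cbv beta. field. lra.
    + exact (gradient_sim_comp D p B B1 Dp Hx Ht HB).
  - cbv beta. field. lra.
  - cbv beta. field. lra.
Qed.

Lemma sim_u_C1 D (U U1 : R -> R) :
  (forall p, D p -> 0 < fst p /\ 0 < 1 + snd p /\
     is_derive U (sim_var p) (U1 (sim_var p)) /\ ex_derive U1 (sim_var p)) ->
  C1_within2 D (sim_u U).
Proof.
  intros H.
  exists (fun p => / (1 + snd p) * (U (sim_var p) + U1 (sim_var p))),
    (fun p => fst p * / (1 + snd p) ^ 2 * (- U (sim_var p) + U1 (sim_var p) / 2)).
  split; [|split].
  - intros p Dp. destruct (H p Dp) as (Hx & Ht & HU & _).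
    now apply gradient_sim_u.
  - intros p Dp. destruct (H p Dp) as (Hx & Ht & HU & [U2 HU1]).
    eapply gradient_cont.
    eapply (gradient_mult D (fun p => / (1 + snd p)) (fun p => U (sim_var p) + U1 (sim_var p)) p
      _ _ _ _ Dp (gradient_inv D _ p 0 1 Dp (Rgt_not_eq _ _ Ht) (gradient_1_snd D p))
      (gradient_plus D _ _ p _ _ _ _ (gradient_sim_comp D p U _ Dp Hx Ht HU)
        (gradient_sim_comp D p U1 _ Dp Hx Ht HU1))).
  - intros p Dp. destruct (H p Dp) as (Hx & Ht & HU & [U2 HU1]).
    eapply gradient_cont.
    eapply (gradient_mult D (fun p => fst p * / (1 + snd p) ^ 2)
      (fun p => - U (sim_var p) + U1 (sim_var p) / 2) p _ _ _ _ Dp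
      (gradient_mult D fst (fun p => / (1 + snd p) ^ 2) p _ _ _ _ Dp (gradient_fst D p)
        (gradient_inv D _ p _ _ Dp (pow_nonzero _ 2 (Rgt_not_eq _ _ Ht))
          (gradient_sqr D _ p _ _ Dp (gradient_1_snd D p))))
      (gradient_plus D _ (fun p => U1 (sim_var p) / 2) p _ _ _ _
        (gradient_opp D _ p _ _ Dp (gradient_sim_comp D p U _ Dp Hx Ht HU))
        (gradient_comp D _ p _ _ (fun y => y / 2) (/ 2) Dp
          (gradient_sim_comp D p U1 _ Dp Hx Ht HU1) ltac:(auto_derive; [trivial | field])))).
Qed.

Lemma sim_rb_C1 D (B B1 : R -> R) :
  (forall p, D p -> 0 < fst p /\ 0 < 1 + snd p /\
     is_derive B (sim_var p) (B1 (sim_var p)) /\ ex_derive B1 (sim_var p)) ->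
  C1_within2 D (sim_rb B).
Proof.
  intros H.
  exists (fun p => (1 + snd p) * / fst p ^ 2 * (B1 (sim_var p) - B (sim_var p))),
    (fun p => / fst p * (B (sim_var p) + B1 (sim_var p) / 2)).
  split; [|split].
  - intros p Dp. destruct (H p Dp) as (Hx & Ht & HB & _).
    now apply gradient_sim_rb.
  - intros p Dp. destruct (H p Dp) as (Hx & Ht & HB & [B2 HB1]).
    eapply gradient_cont.
    eapply (gradient_mult D (fun p => (1 + snd p) * / fst p ^ 2)
      (fun p => B1 (sim_var p) - B (sim_var p)) p _ _ _ _ Dp
      (gradient_mult D (fun p => 1 + snd p) (fun p => / fst p ^ 2) p _ _ _ _ Dp
        (gradient_1_snd D p)
        (gradient_inv D _ p _ _ Dp (pow_nonzero _ 2 (Rgt_not_eq _ _ Hx))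
          (gradient_sqr D _ p _ _ Dp (gradient_fst D p))))
      (gradient_minus D _ _ p _ _ _ _ Dp (gradient_sim_comp D p B1 _ Dp Hx Ht HB1)
        (gradient_sim_comp D p B _ Dp Hx Ht HB))).
  - intros p Dp. destruct (H p Dp) as (Hx & Ht & HB & [B2 HB1]).
    eapply gradient_cont.
    eapply (gradient_mult D (fun p => / fst p) (fun p => B (sim_var p) + B1 (sim_var p) / 2) p
      _ _ _ _ Dp (gradient_inv D fst p 1 0 Dp (Rgt_not_eq _ _ Hx) (gradient_fst D p))
      (gradient_plus D _ (fun p => B1 (sim_var p) / 2) p _ _ _ _
        (gradient_sim_comp D p B _ Dp Hx Ht HB)
        (gradient_comp D _ p _ _ (fun y => y / 2) (/ 2) Dp
          (gradient_sim_comp D p B1 _ Dp Hx Ht HB1) ltac:(auto_derive; [trivial | field])))).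
Qed.

Lemma balance_of_primitive m D rb u : (1 <= m)%nat ->
  (forall p, D p -> 0 < fst p /\ 0 < rb p /\ exists bx bt ux ut,
     is_gradient_within D rb p bx bt /\ is_gradient_within D u p ux ut /\
     bt + u p * bx + rb p * ux + INR m / fst p * rb p * u p = 0 /\
     ut + u p * ux + bx / rb p ^ 3 = 0) ->
  balance_law D (fun p => c m (fst p) * rb p)
    (fun p => c m (fst p) * rb p * u p) (fun _ => 0) /\
  balance_law D (fun p => c m (fst p) * rb p * u p)
    (fun p => c m (fst p) * rb p * u p ^ 2 - c m (fst p) * / rb p)
    (fun p => - Derive (c m) (fst p) * / rb p).
Proof.
  intros Hm H. split; intros p Dp;
    destruct (H p Dp) as (Hx & Hb & bx & bt & ux & ut & Gb & Gu & E1 & E2).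
  - pose proof (mass_gradient D m rb p bx bt Dp Gb) as G1.
    pose proof (momentum_gradient D m rb u p bx bt ux ut Dp Gb Gu) as G2.
    eexists _, _, _, _. split; [exact G1|]. split; [exact G2|].
    rewrite (c_pred m _ Hm).
    transitivity (fst p * fst p ^ pred m *
      (bt + u p * bx + rb p * ux + INR m / fst p * rb p * u p)).
    + field. lra.
    + rewrite E1. ring.
  - pose proof (momentum_gradient D m rb u p bx bt ux ut Dp Gb Gu) as G1.
    destruct (momentum_flux_gradient D m rb u p bx bt ux ut Dp (Rgt_not_eq _ _ Hb) Gb Gu)
      as [ft G2].
    eexists _, _, _, _. split; [exact G1|]. split; [exact G2|].
    rewrite Derive_c, (c_pred m _ Hm).
    transitivity (fst p * fst p ^ pred m *
      (u p * (bt + u p * bx + rb p * ux + INR m / fst p * rb p * u p)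
       + rb p * (ut + u p * ux + bx / rb p ^ 3)) - INR m * fst p ^ pred m * / rb p).
    + field. lra.
    + rewrite E1, E2. ring.
Qed.

Lemma is_derive_is_derive_within (D : R -> Prop) (f : R -> R) x l :
  D x -> is_derive f x l -> is_derive_within D f x l.
Proof.
  intros Dx Hf. unfold is_derive_within.
  assert (PF : ProperFilter (within D (locally x))) by (now apply within_proper).
  apply (@filterdiff_locally R_AbsRing R_NormedModule R_NormedModule _ _ f x).
  - exact (@within_lim R_UniformSpace D x).
  - exact Hf.
Qed.

Lemma C1_within_of_derive (D : R -> Prop) (f df : R -> R) :
  (forall x, D x -> is_derive f x (df x) /\ ex_derive df x) -> C1_within D f.
Proof.
  intros H. exists df. split.
  - intros x Dx. now apply is_derive_is_derive_within; [|apply H].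
  - intros x Dx P HP. apply (filter_le_within D).
    destruct (H x Dx) as [_ H2].
    exact (ex_derive_continuous df x H2 P HP).
Qed.

Section Known.

Variables (m : nat) (z q g : R -> R) (sst : R).
Let k := INR m / 4.
Hypothesis (Hm : (1 <= m)%nat) (Hk : / 4 <= k <= / 2).
Hypothesis (HT : prof_trajectory k z q) (Hg : mass_inverse z q g).

Definition eta_of (s : R) : R := g (sst - s).

Definition sim_range (s : R) : Prop := 0 < sst - s < mass_fun z q horizon.

Definition Us (s : R) : R := prof_U (z (eta_of s)) (q (eta_of s)).
Definition Us' (s : R) : R := prof_U' k (z (eta_of s)) (q (eta_of s)).
Definition Bs (s : R) : R := prof_B (z (eta_of s)) (q (eta_of s)).
Definition Bs' (s : R) : R := prof_B' k (z (eta_of s)) (q (eta_of s)).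

Lemma eta_of_range s : sim_range s -> 0 < eta_of s < horizon.
Proof. intros H. destruct Hg as [_ Hg']. now apply Hg'. Qed.

Lemma eta_of_derive s : sim_range s ->
  is_derive eta_of s (- / (q (eta_of s) * z (eta_of s))).
Proof.
  intros H. destruct Hg as [_ Hg']. destruct (Hg' _ H) as (_ & _ & D).
  unfold eta_of.
  replace (- / (q (g (sst - s)) * z (g (sst - s)))) with
    (-1 * / (q (g (sst - s)) * z (g (sst - s)))) by ring.
  apply (is_derive_comp g (fun s => sst - s) s); [exact D|].
  auto_derive; [trivial|]. ring.
Qed.

Lemma prof_U_derive t : 0 < t < horizon ->
  is_derive (fun t => prof_U (z t) (q t)) t (- (q t * z t) * prof_U' k (z t) (q t)).
Proof.
  intros Ht. destruct (prof_facts k z q Hk HT t Ht) as (Hz & Hq & Hy & Hd & Dz & Dq).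
  unfold prof_U, prof_r. auto_derive.
  - repeat split; try (eexists; eassumption). lra.
  - replace (Derive (fun x => z x) t) with (prof_g k (z t) (q t))
      by (symmetry; now apply is_derive_unique).
    replace (Derive (fun x => q x) t) with (q t * prof_n k (z t) (q t))
      by (symmetry; now apply is_derive_unique).
    unfold prof_U', prof_dr. field. lra.
Qed.

Lemma prof_B_derive t : 0 < t < horizon ->
  is_derive (fun t => prof_B (z t) (q t)) t (- (q t * z t) * prof_B' k (z t) (q t)).
Proof.
  intros Ht. destruct (prof_facts k z q Hk HT t Ht) as (Hz & Hq & Hy & Hd & Dz & Dq).
  unfold prof_B, prof_r in *. auto_derive.
  - repeat split; try (eexists; eassumption). lra.
  - replace (Derive (fun x => z x) t) with (prof_g k (z t) (q t))
      by (symmetry; now apply is_derive_unique).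
    replace (Derive (fun x => q x) t) with (q t * prof_n k (z t) (q t))
      by (symmetry; now apply is_derive_unique).
    unfold prof_B', prof_dr, prof_r. field. lra.
Qed.

Lemma prof_U'_ex_derive t : 0 < t < horizon ->
  ex_derive (fun t => prof_U' k (z t) (q t)) t.
Proof.
  intros Ht. destruct (prof_facts k z q Hk HT t Ht) as (Hz & Hq & Hy & Hd & Dz & Dq).
  assert (Nz : q t * z t <> 0) by (apply Rgt_not_eq, Rmult_lt_0_compat; assumption).
  assert (Nz2 : z t * (z t * 1) <> 0)
    by (apply Rgt_not_eq; repeat apply Rmult_lt_0_compat; lra).
  unfold prof_U', prof_dr, prof_n, prof_g, prof_r in *. auto_derive.
  repeat split; try (eexists; eassumption); try assumption; try lra.
Qed.

Lemma prof_B'_ex_derive t : 0 < t < horizon ->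
  ex_derive (fun t => prof_B' k (z t) (q t)) t.
Proof.
  intros Ht. destruct (prof_facts k z q Hk HT t Ht) as (Hz & Hq & Hy & Hd & Dz & Dq).
  assert (Nz : q t * z t <> 0) by (apply Rgt_not_eq, Rmult_lt_0_compat; assumption).
  unfold prof_B', prof_dr, prof_n, prof_g, prof_r in *.
  assert (Ny : (1 - (- / 2 + q t * z t) * z t) * ((1 - (- / 2 + q t * z t) * z t) * 1) <> 0)
    by (apply Rgt_not_eq; repeat apply Rmult_lt_0_compat; lra).
  auto_derive.
  repeat split; try (eexists; eassumption); try assumption; try lra.
Qed.

Lemma Us_derive s : sim_range s -> is_derive Us s (Us' s).
Proof.
  intros Hs. pose proof (eta_of_range s Hs) as He.
  destruct (prof_facts k z q Hk HT _ He) as (Hz & Hq & _).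
  replace (Us' s) with (- / (q (eta_of s) * z (eta_of s)) *
    (- (q (eta_of s) * z (eta_of s)) * prof_U' k (z (eta_of s)) (q (eta_of s))))
    by (unfold Us'; field; lra).
  apply (is_derive_comp (fun t => prof_U (z t) (q t)) eta_of s);
    [now apply prof_U_derive | now apply eta_of_derive].
Qed.

Lemma Bs_derive s : sim_range s -> is_derive Bs s (Bs' s).
Proof.
  intros Hs. pose proof (eta_of_range s Hs) as He.
  destruct (prof_facts k z q Hk HT _ He) as (Hz & Hq & _).
  replace (Bs' s) with (- / (q (eta_of s) * z (eta_of s)) *
    (- (q (eta_of s) * z (eta_of s)) * prof_B' k (z (eta_of s)) (q (eta_of s))))
    by (unfold Bs'; field; lra).
  apply (is_derive_comp (fun t => prof_B (z t) (q t)) eta_of s);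
    [now apply prof_B_derive | now apply eta_of_derive].
Qed.

Lemma Us'_ex_derive s : sim_range s -> ex_derive Us' s.
Proof.
  intros Hs.
  apply (ex_derive_comp (fun t => prof_U' k (z t) (q t)) eta_of s).
  - now apply prof_U'_ex_derive, eta_of_range.
  - eexists. now apply eta_of_derive.
Qed.

Lemma Bs'_ex_derive s : sim_range s -> ex_derive Bs' s.
Proof.
  intros Hs.
  apply (ex_derive_comp (fun t => prof_B' k (z t) (q t)) eta_of s).
  - now apply prof_B'_ex_derive, eta_of_range.
  - eexists. now apply eta_of_derive.
Qed.

Lemma Bs_pos s : sim_range s -> 0 < Bs s.
Proof.
  intros Hs. destruct (prof_facts k z q Hk HT _ (eta_of_range s Hs)) as (Hz & Hq & Hy & _).
  unfold Bs, prof_B. apply Rdiv_lt_0_compat; lra.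
Qed.

Lemma sim_equations s : sim_range s ->
  Bs s + Bs' s / 2 + Us s * Bs' s + Bs s * Us' s + 4 * k * Bs s * Us s = 0 /\
  - Us s + Us' s / 2 + Us s * (Us s + Us' s) + (Bs' s - Bs s) / Bs s ^ 3 = 0.
Proof.
  intros Hs. destruct (prof_facts k z q Hk HT _ (eta_of_range s Hs)) as (Hz & Hq & Hy & _).
  split; [now apply prof_mass_equation | now apply prof_momentum_equation].
Qed.

Lemma sim_speeds s : sim_range s ->
  Us s + / Bs s = / z (eta_of s) /\
  Us s - / Bs s = prof_r (z (eta_of s)) (q (eta_of s)).
Proof.
  intros Hs. destruct (prof_facts k z q Hk HT _ (eta_of_range s Hs)) as (Hz & Hq & Hy & _).
  unfold Us, Bs, prof_U, prof_B. split; field; lra.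
Qed.

Definition known_u : R * R -> R := sim_u Us.
Definition known_rb : R * R -> R := sim_rb Bs.

Definition known_domain (p : R * R) : Prop :=
  0 < fst p /\ 0 < 1 + snd p /\ sim_range (sim_var p).

Lemma known_speeds p : known_domain p ->
  known_u p + / known_rb p = fst p / (1 + snd p) * / z (eta_of (sim_var p)) /\
  known_u p - / known_rb p = fst p / (1 + snd p) *
    prof_r (z (eta_of (sim_var p))) (q (eta_of (sim_var p))).
Proof.
  intros (Hx & Ht & Hs).
  destruct (sim_speeds _ Hs) as [E1 E2].
  pose proof (Bs_pos _ Hs) as HB.
  unfold known_u, known_rb, sim_u, sim_rb.
  rewrite <- E1, <- E2. split; field; lra.
Qed.

Lemma known_rb_pos p : known_domain p -> 0 < known_rb p.
Proof.
  intros (Hx & Ht & Hs). unfold known_rb, sim_rb.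
  apply Rmult_lt_0_compat; [|now apply Bs_pos].
  apply Rmult_lt_0_compat; [exact Ht | now apply Rinv_0_lt_compat].
Qed.

Definition known_rho0 (x : R) : R := rho m known_rb (x, 0).
Definition known_u0 (x : R) : R := known_u (x, 0).

Lemma known_classical D : (forall p, D p -> known_domain p) ->
  classical_solution m D known_rho0 known_u0 known_rb known_u.
Proof.
  intros HD. split; [|split; [|split]].
  - apply (sim_rb_C1 D _ Bs'). intros p Dp.
    destruct (HD p Dp) as (Hx & Ht & Hs). split; [exact Hx|]. split; [exact Ht|].
    split; [now apply Bs_derive | now apply Bs'_ex_derive].
  - apply (sim_u_C1 D _ Us'). intros p Dp.
    destruct (HD p Dp) as (Hx & Ht & Hs). split; [exact Hx|]. split; [exact Ht|].
    split; [now apply Us_derive | now apply Us'_ex_derive].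
  - intros p Dp. now apply known_rb_pos, HD.
  - assert (Bal := balance_of_primitive m D known_rb known_u Hm).
    destruct Bal as [B1 B2].
    + intros p Dp. specialize (HD p Dp). assert (HD' := HD).
      destruct HD' as (Hx & Ht & Hs).
      split; [exact Hx|]. split; [now apply known_rb_pos|].
      pose proof (Bs_derive _ Hs) as DB.
      pose proof (Us_derive _ Hs) as DU.
      pose proof (Bs_pos _ Hs) as HB.
      destruct (sim_equations _ Hs) as [E1 E2].
      eexists _, _, _, _.
      split; [exact (gradient_sim_rb D p _ _ Dp Hx Ht DB)|].
      split; [exact (gradient_sim_u D p _ _ Dp Hx Ht DU)|].
      unfold known_u, known_rb, sim_u, sim_rb.
      set (Bv := Bs (sim_var p)) in *. set (Uv := Us (sim_var p)) in *.
      set (B1 := Bs' (sim_var p)) in *. set (U1 := Us' (sim_var p)) in *.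
      set (x := fst p) in *. set (t := snd p) in *.
      split.
      * transitivity (/ x * (Bv + B1 / 2 + Uv * B1 + Bv * U1 + 4 * k * Bv * Uv)).
        -- unfold k. field. lra.
        -- rewrite E1. ring.
      * transitivity (x / (1 + t) ^ 2 * (- Uv + U1 / 2 + Uv * (Uv + U1) + (B1 - Bv) / Bv ^ 3)).
        -- field. lra.
        -- rewrite E2. ring.
    + split; [exact B1|]. split; [exact B2|]. intros x _. now split.
Qed.

Lemma known_initial_C1 a b : 0 < a ->
  (forall x, a <= x <= b -> sim_range (ln x)) ->
  C1_within (fun x => a <= x <= b) known_rho0 /\
  C1_within (fun x => a <= x <= b) known_u0.
Proof.
  intros Ha Hr.
  assert (E : forall x, sim_var (x, 0) = ln x).
  { intros x. unfold sim_var. simpl. rewrite Rplus_0_r, ln_1. lra. }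
  split.
  - apply (C1_within_of_derive _ _ (fun x =>
      (INR m * x ^ pred m * / x - c m x * / x ^ 2) * Bs (ln x)
        + c m x * / x ^ 2 * Bs' (ln x))).
    intros x Hx. specialize (Hr x Hx).
    pose proof (Bs_derive _ Hr) as DB.
    destruct (Bs'_ex_derive _ Hr) as [B2 DB'].
    split.
    + apply (is_derive_ext (fun y => c m y * (/ y * Bs (ln y)))).
      { intros y. unfold known_rho0, rho, known_rb, sim_rb. rewrite E. simpl.
        rewrite Rplus_0_r, Rmult_1_l. reflexivity. }
      unfold c. auto_derive.
      * repeat split; try lra. eexists; exact DB.
      * replace (Derive (fun y => Bs y) (ln x)) with (Bs' (ln x))
          by (symmetry; now apply is_derive_unique).
        field. lra.
    + unfold c. auto_derive.
      repeat split; try lra; try (eexists; eassumption);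
        apply Rgt_not_eq; repeat apply Rmult_lt_0_compat; lra.
  - apply (C1_within_of_derive _ _ (fun x =>
      Us (ln x) + Us' (ln x))).
    intros x Hx. specialize (Hr x Hx).
    pose proof (Us_derive _ Hr) as DU.
    destruct (Us'_ex_derive _ Hr) as [U2 DU'].
    split.
    + apply (is_derive_ext (fun y => y * Us (ln y))).
      { intros y. unfold known_u0, known_u, sim_u. rewrite E. simpl.
        rewrite Rplus_0_r, Rinv_1, Rmult_1_r. reflexivity. }
      auto_derive.
      * repeat split; try lra. eexists; exact DU.
      * replace (Derive (fun y => Us y) (ln x)) with (Us' (ln x))
          by (symmetry; now apply is_derive_unique).
        field. lra.
    + auto_derive.
      repeat split; try lra; eexists; eassumption.
Qed.

End Known.

(** * Restriction to smaller domains and preliminaries on characteristics *)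

Lemma filterdiff_filter_le {U : NormedModule R_AbsRing} (F G : (U -> Prop) -> Prop)
    (f : U -> R) (l : U -> R) x :
  ProperFilter G -> filter_le G F -> is_filter_lim F x ->
  @filterdiff R_AbsRing U R_NormedModule f F l ->
  @filterdiff R_AbsRing U R_NormedModule f G l.
Proof.
  intros PG HGF HFx [Hl H]. split; [exact Hl|].
  intros y Hy.
  assert (E : x = y).
  { apply (@is_filter_lim_unique R_AbsRing U G (Proper_StrongProper _ PG));
      [intros P HP; apply HGF, HFx, HP | exact Hy]. }
  subst y. intros e. apply HGF, (H x HFx).
Qed.

Lemma within_subset {T : UniformSpace} (D D' : T -> Prop) p :
  (forall y, D' y -> D y) -> filter_le (within D' (locally p)) (within D (locally p)).
Proof.
  intros H P [e He]. exists e. intros y Hy Dy. apply He; [exact Hy | now apply H].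
Qed.

Lemma gradient_subset (D D' : R * R -> Prop) f p fx ft :
  (forall y, D' y -> D y) -> D' p ->
  is_gradient_within D f p fx ft -> is_gradient_within D' f p fx ft.
Proof.
  intros H Dp Hf.
  apply (@filterdiff_filter_le plane (within D (locally p)) (within D' (locally p))
    f (fun h => fst h * fx + snd h * ft) p).
  - exact (@within_proper plane D' p Dp).
  - exact (@within_subset plane D D' p H).
  - exact (@within_lim plane D p).
  - exact Hf.
Qed.

Lemma derive_within_subset (D D' : R -> Prop) f x l :
  (forall y, D' y -> D y) -> D' x -> is_derive_within D f x l -> is_derive_within D' f x l.
Proof.
  intros H Dx Hf.
  apply (@filterdiff_filter_le R_NormedModule (within D (locally x)) (within D' (locally x))
    f (fun h => h * l) x).
  - exact (@within_proper R_UniformSpace D' x Dx).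
  - exact (@within_subset R_UniformSpace D D' x H).
  - exact (@within_lim R_UniformSpace D x).
  - exact Hf.
Qed.

Lemma derive_within_interior (D : R -> Prop) f x l :
  locally x D -> is_derive_within D f x l -> is_derive f x l.
Proof.
  intros HD Hf.
  apply (@filterdiff_filter_le R_NormedModule (within D (locally x)) (locally x)
    f (fun h => h * l) x).
  - apply locally_filter.
  - intros P HP. generalize (filter_and _ _ HD HP). apply filter_imp. tauto.
  - exact (@within_lim R_UniformSpace D x).
  - exact Hf.
Qed.

Lemma C1_within2_subset (D D' : R * R -> Prop) f :
  (forall y, D' y -> D y) -> C1_within2 D f -> C1_within2 D' f.
Proof.
  intros H (fx & ft & G & Cx & Ct). exists fx, ft. split; [|split].
  - intros p Dp. apply (gradient_subset D); auto.
  - intros p Dp P HP. apply (@within_subset _ D D' p H). apply Cx; auto.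
  - intros p Dp P HP. apply (@within_subset _ D D' p H). apply Ct; auto.
Qed.

Lemma balance_law_subset (D D' : R * R -> Prop) qq f s :
  (forall y, D' y -> D y) -> balance_law D qq f s -> balance_law D' qq f s.
Proof.
  intros H B p Dp. destruct (B p (H p Dp)) as (qx & qt & fx & ft & G1 & G2 & E).
  exists qx, qt, fx, ft. split; [|split; [|exact E]]; apply (gradient_subset D); auto.
Qed.

Lemma classical_solution_subset m (D D' : R * R -> Prop) rho0 u0 rb u :
  (forall y, D' y -> D y) ->
  classical_solution m D rho0 u0 rb u -> classical_solution m D' rho0 u0 rb u.
Proof.
  intros H (C1 & C2 & P & B1 & B2 & I).
  split; [now apply (C1_within2_subset D)|]. split; [now apply (C1_within2_subset D)|].
  split; [auto|]. split; [now apply (balance_law_subset D)|].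
  split; [now apply (balance_law_subset D) | exact I].
Qed.

Lemma speed_plus_eq m rb u p : 0 < fst p -> 0 < rb p ->
  speed_plus m rb u p = u p + / rb p.
Proof.
  intros Hx Hr. unfold speed_plus, rho.
  assert (0 < c m (fst p)) by (unfold c; now apply pow_lt). field. lra.
Qed.

Lemma speed_minus_eq m rb u p : 0 < fst p -> 0 < rb p ->
  speed_minus m rb u p = u p - / rb p.
Proof.
  intros Hx Hr. unfold speed_minus, rho.
  assert (0 < c m (fst p)) by (unfold c; now apply pow_lt). field. lra.
Qed.

(** After a contact the plus characteristic would overtake the minus one. *)
Lemma dependence_boundary_lt m T rho0 u0 rb u xp xm :
  solution_on_dependence_domain m T rho0 u0 rb u xp xm ->
  forall t, 0 <= t < T -> 0 < xp t < xm t /\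
     is_derive_within (fun s => 0 <= s < T) xp t (u (xp t, t) + / rb (xp t, t)) /\
     is_derive_within (fun s => 0 <= s < T) xm t (u (xm t, t) - / rb (xm t, t)).
Proof.
  intros [(Hp0 & Hm0 & Hb) (_ & _ & Pos & _)] t Ht.
  destruct (Hb t Ht) as (Hx & Dp & Dm).
  assert (Pp : 0 < rb (xp t, t)) by (apply Pos; split; simpl; lra).
  assert (Pm : 0 < rb (xm t, t)) by (apply Pos; split; simpl; lra).
  rewrite (speed_plus_eq) in Dp by (simpl; lra).
  rewrite (speed_minus_eq) in Dm by (simpl; lra).
  split; [|now split]. split; [lra|].
  destruct (Req_dec (xp t) (xm t)) as [E|]; [exfalso|lra].
  rewrite <- E in Dm.
  set (w := / rb (xp t, t)) in *. assert (Hw : 0 < w) by now apply Rinv_0_lt_compat.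
  destruct (derive_within_eps _ _ _ _ (Ht : (fun s => 0 <= s < T) t) Dp (w / 2))
    as (d1 & Hd1 & H1); [lra|].
  destruct (derive_within_eps _ _ _ _ (Ht : (fun s => 0 <= s < T) t) Dm (w / 2))
    as (d2 & Hd2 & H2); [lra|].
  set (h := Rmin (Rmin d1 d2) (T - t) / 2).
  assert (K : 0 < Rmin (Rmin d1 d2) (T - t)) by (repeat apply Rmin_glb_lt; lra).
  pose proof (Rmin_l (Rmin d1 d2) (T - t)). pose proof (Rmin_r (Rmin d1 d2) (T - t)).
  pose proof (Rmin_l d1 d2). pose proof (Rmin_r d1 d2).
  assert (Hh : 0 < h) by (unfold h; lra).
  assert (D' : 0 <= t + h < T) by (unfold h in *; lra).
  specialize (H1 (t + h) D'). specialize (H2 (t + h) D').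
  replace (t + h - t) with h in H1, H2 by ring.
  rewrite (Rabs_pos_eq h) in H1, H2 by lra.
  specialize (H1 ltac:(unfold h in *; lra)). specialize (H2 ltac:(unfold h in *; lra)).
  apply Rabs_le_between in H1. apply Rabs_le_between in H2.
  destruct (Hb (t + h) D') as (Hx' & _). nra.
Qed.

Lemma constant_on_segment (f : R -> R) a b : a <= b ->
  (forall t, a <= t <= b -> continuous f t) ->
  (forall t, a < t < b -> is_derive f t 0) -> f b = f a.
Proof.
  intros Hab Hc Hd. destruct (Req_dec a b) as [->|N]; [reflexivity|].
  destruct (MVT_gen f a b (fun _ => 0)) as [x [_ Hx]].
  - rewrite Rmin_left, Rmax_right by lra. exact Hd.
  - rewrite Rmin_left, Rmax_right by lra. intros t Ht. apply continuity_pt_filterlim, Hc, Ht.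
  - lra.
Qed.

(** Freezing time outside [[0, b]] turns relative continuity on the half-open interval into
    continuity on the whole line. *)
Lemma clip_continuous (f : R -> R) T b :
  0 <= b < T ->
  (forall t, 0 <= t < T -> exists l, is_derive_within (fun s => 0 <= s < T) f t l) ->
  forall s, continuous (fun s => f (clip 0 b s)) s.
Proof.
  intros Hb Hf s P [e He].
  pose proof (clip_bounds 0 b s ltac:(lra)) as Hc.
  assert (Ht : 0 <= clip 0 b s < T) by lra.
  destruct (Hf _ Ht) as [l Hl].
  destruct (derive_within_cont _ _ _ _ (Ht : (fun s => 0 <= s < T) (clip 0 b s)) Hl e
    (cond_pos e)) as (d & Hd & H).
  exists (mkposreal d Hd). intros y Hy. apply He.
  change (Rabs (y - s) < d) in Hy. change (Rabs (f (clip 0 b y) - f (clip 0 b s)) < e).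
  pose proof (clip_bounds 0 b y ltac:(lra)).
  apply H; [lra|]. eapply Rle_lt_trans; [apply clip_lipschitz; lra | exact Hy].
Qed.

Lemma sim_var_le x y t : 0 < x -> x <= y -> sim_var (x, t) <= sim_var (y, t).
Proof.
  intros Hx Hxy. unfold sim_var. simpl. apply Rplus_le_compat_r.
  destruct Hxy as [H| ->]; [apply Rlt_le, ln_increasing; lra | lra].
Qed.

(** * Characteristics of the self-similar solution *)

(** Data of the blow-up: [th] is [ln (1 + T)], [e1] the profile parameter of the
    left end point [x = 1] at [t = 0], [gp] the inverse of [plus_time]. *)
Definition blowup_data (z q g gp : R -> R) (th e1 : R) : Prop :=
  mass_inverse z q g /\
  (forall t, 0 <= t <= horizon -> gp (plus_time z q t) = t) /\
  (forall y, 0 < y < plus_time z q horizon ->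
      0 < gp y < horizon /\ plus_time z q (gp y) = y /\
      is_derive gp y (/ (q (gp y) * z (gp y) ^ 2 * / (1 + z (gp y) / 2)))) /\
  0 < th < 6 / 5 /\ th < e1 < horizon /\
  (forall t, 0 <= t <= th -> q t <= q_init /\ z t <= 4) /\
  th / 2 - mass_fun z q th = ln (3 / 2) /\
  mass_fun z q e1 = ln 2 + th / 2 /\
  th < plus_time z q e1.

Lemma blowup_data_exists k : / 4 <= k <= / 2 ->
  exists z q g gp th e1, prof_trajectory k z q /\ blowup_data z q g gp th e1.
Proof.
  intros Hk. destruct (prof_trajectory_exists k Hk) as (z & q & HT).
  destruct (mass_inverse_exists k z q Hk HT) as [g Hg].
  destruct (plus_inverse_exists k z q Hk HT) as (gp & G1 & G2).
  destruct (profile_times k z q Hk HT) as (a & th & e1 & H1 & H2 & H3 & H4 & H5 & H6 & H7).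
  exists z, q, g, gp, th, e1. split; [exact HT|].
  split; [exact Hg|]. split; [exact G1|]. split; [exact G2|]. split; [exact H1|].
  split; [lra|]. split; [intros; apply H4; lra|]. now split.
Qed.

Section Chars.

Variables (m : nat) (z q g gp : R -> R) (th e1 : R).
Let k := INR m / 4.
Hypothesis (Hm : (1 <= m)%nat) (Hk : / 4 <= k <= / 2).
Hypothesis (HT : prof_trajectory k z q) (HB : blowup_data z q g gp th e1).

Definition s_star : R := ln 2 + th / 2.

Local Notation A := (mass_fun z q).
Local Notation TP := (plus_time z q).

Definition eta_p (t : R) : R := gp (TP e1 - ln (1 + t)).

(** The invariant fixes the profile time, [th - ln (1 + t)] here and [eta_p t] for [char_p]; solving
    [sim_var (x, t) = s_star - mass_fun eta] for [x] gives the curve explicitly. *)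
Definition char_m (t : R) : R := exp (s_star - ln (1 + t) / 2 - A (th - ln (1 + t))).
Definition char_p (t : R) : R := exp (s_star - ln (1 + t) / 2 - A (eta_p t)).

Definition t_blow : R := exp th - 1.

Let T := t_blow.

Lemma horizon_pos : 0 < horizon.
Proof. pose proof horizon_gt. lra. Qed.

Lemma mass_mono s t : 0 <= s -> s < t -> t <= horizon -> A s < A t.
Proof.
  intros Hs Hst Ht. apply (strict_growth A (fun x => q x * z x)); [exact Hst| |].
  - apply (mass_continuous k z q HT).
  - intros x Hx. split; [apply (mass_derive k z q HT)|].
    destruct (prof_facts k z q Hk HT x ltac:(lra)) as (Z & Q & _).
    now apply Rmult_lt_0_compat.
Qed.

Lemma plus_mono s t : 0 <= s -> s < t -> t <= horizon -> TP s < TP t.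
Proof.
  intros Hs Hst Ht. apply (strict_growth TP (fun x => q x * z x ^ 2 * / (1 + z x / 2)));
    [exact Hst| |].
  - apply (plus_continuous k z q HT).
  - intros x Hx. split; [apply (plus_derive k z q HT); lra|].
    destruct (prof_facts k z q Hk HT x ltac:(lra)) as (Z & Q & _ & Hd & _).
    apply Rmult_lt_0_compat; [|now apply Rinv_0_lt_compat].
    apply Rmult_lt_0_compat; [assumption|]. now apply pow_lt.
Qed.

Lemma log_time t : 0 <= t < t_blow -> 0 <= ln (1 + t) < th.
Proof.
  unfold t_blow. intros Ht. split.
  - rewrite <- ln_1. destruct (Req_dec t 0) as [->|N]; [rewrite Rplus_0_r; lra|].
    apply Rlt_le, ln_increasing; lra.
  - rewrite <- (ln_exp th). apply ln_increasing; lra.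
Qed.

(** On the head [plus_time] grows with slope at most 1, so its value at [th - ln (1 + t)] is at most
    [th - ln (1 + t)], which is less than [plus_time e1 - ln (1 + t)]. Thus the plus characteristic
    stays farther from the singularity than the minus one, that is, to its left. *)
Lemma eta_p_facts t : 0 <= t < t_blow ->
  th - ln (1 + t) < eta_p t <= e1 /\ TP (eta_p t) = TP e1 - ln (1 + t).
Proof.
  intros Ht. pose proof (log_time t Ht) as Hl.
  destruct HB as (Hg & G1 & G2 & Hth & He1 & Hhead & E1 & E2 & E3).
  pose proof horizon_pos.
  pose proof (plus_mono e1 horizon ltac:(lra) ltac:(lra) ltac:(lra)) as M1.
  destruct (G2 (TP e1 - ln (1 + t))) as (R1 & R2 & _); [lra|].
  change (gp (TP e1 - ln (1 + t))) with (eta_p t) in *.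
  split; [|exact R2]. split.
  - apply Rnot_le_lt. intros K.
    assert (TP (eta_p t) <= TP (th - ln (1 + t))).
    { destruct K as [K| ->]; [|lra]. apply Rlt_le, plus_mono; lra. }
    assert (TP (th - ln (1 + t)) - TP 0 <= 1 * (th - ln (1 + t) - 0)).
    { apply (growth_le TP (fun x => q x * z x ^ 2 * / (1 + z x / 2))); [lra| |].
      - apply (plus_continuous k z q HT).
      - intros x Hx. split; [apply (plus_derive k z q HT); lra|].
        destruct (prof_facts k z q Hk HT x ltac:(lra)) as (Z & Q & _ & Hd & _).
        destruct (Hhead x ltac:(lra)) as [Q1 Z1].
        assert (0 < / (1 + z x / 2) <= 1).
        { split; [now apply Rinv_0_lt_compat|]. rewrite <- Rinv_1.
          apply Rinv_le_contravar; lra. }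
        assert (q x * z x ^ 2 <= 1) by (unfold q_init in *; nra).
        assert (0 <= q x * z x ^ 2) by (apply Rmult_le_pos; [lra | apply pow2_ge_0]).
        nra. }
    pose proof (plus_0 z q). lra.
  - apply Rnot_lt_le. intros K.
    assert (TP e1 < TP (eta_p t)) by (apply plus_mono; lra). lra.
Qed.

Lemma char_m_sim t : sim_var (char_m t, t) = s_star - A (th - ln (1 + t)).
Proof. unfold sim_var, char_m. simpl. rewrite ln_exp. ring. Qed.

Lemma char_p_sim t : sim_var (char_p t, t) = s_star - A (eta_p t).
Proof. unfold sim_var, char_p. simpl. rewrite ln_exp. ring. Qed.

Lemma eta_of_mass t : 0 <= t <= horizon -> eta_of g s_star (s_star - A t) = t.
Proof.
  intros Ht. unfold eta_of. replace (s_star - (s_star - A t)) with (A t) by ring.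
  destruct HB as ((Hg & _) & _). now apply Hg.
Qed.

Lemma sim_range_mass t : 0 < t < horizon -> sim_range z q s_star (s_star - A t).
Proof.
  intros Ht. unfold sim_range. replace (s_star - (s_star - A t)) with (A t) by ring.
  pose proof (mass_mono 0 t ltac:(lra) ltac:(lra) ltac:(lra)).
  pose proof (mass_mono t horizon ltac:(lra) ltac:(lra) ltac:(lra)).
  pose proof (mass_0 z q). lra.
Qed.

Lemma char_lt t : 0 <= t < t_blow -> char_p t < char_m t.
Proof.
  intros Ht. destruct (eta_p_facts t Ht) as [H1 _]. pose proof (log_time t Ht).
  destruct HB as (_ & _ & _ & Hth & He1 & _).
  unfold char_p, char_m. apply exp_increasing.
  pose proof (mass_mono (th - ln (1 + t)) (eta_p t) ltac:(lra) ltac:(lra) ltac:(lra)) as M.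
  lra.
Qed.

Let rb := known_rb z q g s_star.
Let u := known_u z q g s_star.

Lemma char_domain x t eta : 0 <= t -> 0 < x -> 0 < eta < horizon ->
  sim_var (x, t) = s_star - A eta -> known_domain z q s_star (x, t) /\
  eta_of g s_star (sim_var (x, t)) = eta.
Proof.
  intros Ht Hx He E. split.
  - split; [exact Hx|]. split; [simpl; lra|]. rewrite E. now apply sim_range_mass.
  - rewrite E. apply eta_of_mass. lra.
Qed.

Lemma char_m_derive t : 0 <= t < t_blow ->
  is_derive char_m t (speed_minus m rb u (char_m t, t)).
Proof.
  intros Ht. pose proof (log_time t Ht) as Hl.
  pose proof HB as (Hg & _ & _ & Hth & He1 & _).
  destruct (char_domain (char_m t) t (th - ln (1 + t))) as [Dm Em];
    [lra | apply exp_pos | lra | apply char_m_sim |].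
  rewrite speed_minus_eq; [|apply exp_pos | now apply (known_rb_pos m z q g s_star Hk HT Hg)].
  unfold u, rb. destruct (known_speeds m z q g s_star Hk HT Hg _ Dm) as [_ ->].
  rewrite Em. simpl fst. simpl snd.
  set (eta := th - ln (1 + t)).
  pose proof (mass_derive k z q HT eta) as DA.
  unfold char_m. auto_derive.
  - split; [lra|]. split; [|split; [lra | trivial]].
    exists (q eta * z eta). exact DA.
  - replace (Derive (fun x => A x) (th + - ln (1 + t))) with (q eta * z eta)
      by (symmetry; now apply is_derive_unique).
    unfold eta, prof_r, Rminus, Rdiv. field. lra.
Qed.

Lemma char_p_derive t : 0 <= t < t_blow ->
  is_derive char_p t (speed_plus m rb u (char_p t, t)).
Proof.
  intros Ht. pose proof (log_time t Ht) as Hl.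
  pose proof HB as (Hg & _ & G2 & Hth & He1 & _ & _ & _ & E3).
  destruct (eta_p_facts t Ht) as [H1 H2].
  destruct (char_domain (char_p t) t (eta_p t)) as [Dm Em];
    [lra | apply exp_pos | lra | apply char_p_sim |].
  rewrite speed_plus_eq; [|apply exp_pos | now apply (known_rb_pos m z q g s_star Hk HT Hg)].
  unfold u, rb. destruct (known_speeds m z q g s_star Hk HT Hg _ Dm) as [-> _].
  rewrite Em. simpl fst. simpl snd.
  pose proof (mass_derive k z q HT (eta_p t)) as DA.
  destruct (G2 (TP e1 - ln (1 + t))) as (_ & _ & DG).
  { pose proof (plus_mono e1 horizon ltac:(lra) ltac:(lra) ltac:(lra)) as M1.
    lra. }
  change (gp (TP e1 - ln (1 + t))) with (eta_p t) in DG.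
  destruct (prof_facts k z q Hk HT (eta_p t) ltac:(lra)) as (Z & Q & _ & Hd & _).
  assert (DE : is_derive eta_p t (- / (1 + t) *
    / (q (eta_p t) * z (eta_p t) ^ 2 * / (1 + z (eta_p t) / 2)))).
  { apply (is_derive_comp gp (fun t => TP e1 - ln (1 + t)) t); [exact DG|].
    auto_derive; [lra|]. field. lra. }
  unfold char_p. auto_derive.
  - split; [lra|]. split; [|split; [eexists; exact DE|trivial]].
    eexists. exact DA.
  - replace (Derive (fun x => A x) (eta_p t)) with (q (eta_p t) * z (eta_p t))
      by (symmetry; now apply is_derive_unique).
    replace (Derive (fun x => eta_p x) t) with (- / (1 + t) *
      / (q (eta_p t) * z (eta_p t) ^ 2 * / (1 + z (eta_p t) / 2)))
      by (symmetry; now apply is_derive_unique).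
    unfold Rminus, Rdiv. field. lra.
Qed.

Lemma char_m_0 : char_m 0 = 3.
Proof.
  unfold char_m, s_star. rewrite Rplus_0_r, ln_1.
  destruct HB as (_ & _ & _ & _ & _ & _ & E & _).
  replace (ln 2 + th / 2 - 0 / 2 - A (th - 0)) with (ln 2 + ln (3 / 2))
    by (rewrite <- E, Rminus_0_r; field).
  rewrite <- ln_mult by lra. rewrite exp_ln by lra. field.
Qed.

Lemma char_p_0 : char_p 0 = 1.
Proof.
  pose proof HB as (_ & G1 & _ & Hth & He1 & _ & _ & E & _).
  unfold char_p, eta_p, s_star. rewrite Rplus_0_r, ln_1, Rminus_0_r, G1 by lra.
  replace (ln 2 + th / 2 - 0 / 2 - A e1) with 0 by (rewrite E; field).
  apply exp_0.
Qed.

Lemma t_blow_pos : 0 < t_blow.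
Proof.
  unfold t_blow. destruct HB as (_ & _ & _ & Hth & _).
  assert (exp 0 < exp th) by (apply exp_increasing; lra). rewrite exp_0 in H. lra.
Qed.

Lemma char_boundary : dependence_boundary m t_blow rb u char_p char_m.
Proof.
  split; [exact char_p_0|]. split; [exact char_m_0|].
  intros t Ht. split; [split; [apply exp_pos | now apply Rlt_le, char_lt]|].
  split; apply is_derive_is_derive_within; try exact Ht.
  - now apply char_p_derive.
  - now apply char_m_derive.
Qed.

(** At fixed time [sim_var] increases with [x], so the gap [s_star - s] is squeezed between its
    values on the boundaries, which are positive and at most [mass_fun e1]. *)
Lemma region_domain p : region t_blow char_p char_m p ->
  known_domain z q s_star p /\ 0 < eta_of g s_star (sim_var p) <= e1.
Proof.
  destruct p as [x t]. intros [Ht Hx]. simpl in *.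
  destruct (eta_p_facts t Ht) as [H1 _]. pose proof (log_time t Ht) as Hl.
  pose proof HB as (Hg & _ & _ & Hth & He1 & _).
  assert (Px : 0 < char_p t) by apply exp_pos.
  pose proof (sim_var_le (char_p t) x t Px ltac:(lra)) as S1. rewrite char_p_sim in S1.
  pose proof (sim_var_le x (char_m t) t ltac:(lra) ltac:(lra)) as S2. rewrite char_m_sim in S2.
  pose proof (sim_range_mass (eta_p t) ltac:(lra)) as R1.
  pose proof (sim_range_mass (th - ln (1 + t)) ltac:(lra)) as R2.
  assert (R : sim_range z q s_star (sim_var (x, t))) by (unfold sim_range in *; lra).
  split.
  - split; [simpl; lra|]. split; [simpl; lra | exact R].
  - destruct Hg as [_ Hg]. destruct (Hg _ R) as (Q1 & Q2 & _). unfold eta_of.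
    split; [apply Q1|]. apply Rnot_lt_le. intros K.
    assert (A e1 < A (g (s_star - sim_var (x, t)))) by (apply mass_mono; lra).
    assert (A (eta_p t) <= A e1).
    { destruct (proj2 H1) as [L| ->]; [|lra]. apply Rlt_le, mass_mono; lra. }
    lra.
Qed.

(** * Blow-up at the corner *)

Definition eta_2 (t : R) : R := eta_of g s_star (sim_var (2, t)).

(** On the vertical line [x = 2] the gap is linear in the remaining logarithmic time, so it vanishes
    exactly at [T]. *)
Lemma gap_2 t : s_star - sim_var (2, t) = (th - ln (1 + t)) / 2.
Proof. unfold s_star, sim_var. simpl. field. Qed.

Lemma at_left_time (P : R -> Prop) d : 0 < d ->
  (forall t, 0 <= t < T -> th - ln (1 + t) < d -> P t) -> at_left T P.
Proof.
  intros Hd H.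
  pose proof t_blow_pos as HT0. fold T in HT0.
  assert (Hr : 0 < Rmin T (exp th - exp (th - d))).
  { apply Rmin_glb_lt; [exact HT0|].
    assert (exp (th - d) < exp th) by (apply exp_increasing; lra). lra. }
  exists (mkposreal _ Hr). intros t Ht HtT.
  change (Rabs (t - T) < Rmin T (exp th - exp (th - d))) in Ht.
  assert (H1 := Rlt_le_trans _ _ _ Ht (Rmin_l _ _)).
  assert (H2 := Rlt_le_trans _ _ _ Ht (Rmin_r _ _)).
  apply Rabs_lt_between in H1. apply Rabs_lt_between in H2.
  apply H; [lra|].
  assert (th - d < ln (1 + t)); [|lra].
  rewrite <- (ln_exp (th - d)). apply ln_increasing; [apply exp_pos|].
  unfold T, t_blow in *. lra.
Qed.

Lemma eta_2_small e : 0 < e <= horizon ->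
  at_left T (fun t => known_domain z q s_star (2, t) /\ 0 < eta_2 t < e).
Proof.
  intros He. pose proof HB as (Hg & _).
  assert (HA : 0 < A e).
  { pose proof (mass_mono 0 e ltac:(lra) ltac:(lra) ltac:(lra)) as M.
    pose proof (mass_0 z q). lra. }
  apply (at_left_time _ (2 * A e)); [lra|]. intros t Ht Hd.
  pose proof (log_time t Ht) as Hl.
  assert (R : sim_range z q s_star (sim_var (2, t))).
  { unfold sim_range. rewrite gap_2. split; [lra|].
    destruct (proj2 He) as [L|E]; [|subst e; lra].
    pose proof (mass_mono e horizon ltac:(lra) ltac:(lra) ltac:(lra)).
    lra. }
  split; [split; [simpl; lra|]; split; [simpl; lra | exact R]|].
  destruct Hg as [_ Hg]. destruct (Hg _ R) as (Q1 & Q2 & _).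
  change (g (s_star - sim_var (2, t))) with (eta_2 t) in *.
  split; [lra|]. apply Rnot_le_lt. intros K.
  assert (A e <= A (eta_2 t)).
  { destruct K as [K| ->]; [|lra]. apply Rlt_le, mass_mono; lra. }
  rewrite gap_2 in Q2. lra.
Qed.

Lemma eta_2_lim : filterlim eta_2 (at_left T) (locally 0).
Proof.
  intros P [d Hd]. pose proof horizon_gt as Hh.
  assert (He : 0 < Rmin d horizon <= horizon).
  { pose proof (cond_pos d). split; [apply Rmin_glb_lt; lra | apply Rmin_r]. }
  unfold filtermap. generalize (eta_2_small _ He). apply filter_imp.
  intros t [_ Ht]. apply Hd. change (Rabs (eta_2 t - 0) < d).
  pose proof (Rmin_l d horizon). rewrite Rabs_pos_eq; lra.
Qed.

Local Notation z_2 t := (z (eta_2 t)).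
Local Notation X_2 t := (prof_r (z (eta_2 t)) (q (eta_2 t)) * z (eta_2 t)).

Lemma z_2_lim : filterlim (fun t => z_2 t) (at_left T) (locally 0).
Proof.
  pose proof HT as (Cz & _ & z0 & _). rewrite <- z0.
  apply (filterlim_comp _ _ _ eta_2 z _ (locally 0)); [exact eta_2_lim | apply Cz].
Qed.

Lemma X_2_lim : filterlim (fun t => X_2 t)
  (at_left T) (locally 0).
Proof.
  pose proof HT as (Cz & Cq & z0 & _).
  replace 0 with (prof_r (z 0) (q 0) * z 0) by (rewrite z0; ring).
  apply (filterlim_comp _ _ _ eta_2 (fun s => prof_r (z s) (q s) * z s) _ (locally 0));
    [exact eta_2_lim|].
  assert (C : continuous (fun s => prof_r (z s) (q s) * z s) 0); [|exact C].
  unfold prof_r. apply (continuous_mult (fun s => - / 2 + q s * z s)); [|apply Cz].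
  apply (continuous_plus (fun _ => - / 2)); [apply continuous_const|].
  apply (continuous_mult q); [apply Cq | apply Cz].
Qed.

Lemma pos_tau t : 0 <= t < T -> 1 <= 1 + t <= exp th.
Proof. unfold T, t_blow. lra. Qed.

Lemma z_2_small e : 0 < e -> at_left T (fun t => known_domain z q s_star (2, t) /\
  0 <= t < T /\ 0 < eta_2 t < horizon /\ 0 < z_2 t < e /\
  - e < X_2 t < e).
Proof.
  intros He. pose proof horizon_gt as Hh.
  assert (E1 := eta_2_small horizon ltac:(lra)).
  assert (E2 := z_2_lim (ball 0 (mkposreal e He)) (locally_ball _ _)).
  assert (E3 := X_2_lim (ball 0 (mkposreal e He)) (locally_ball _ _)).
  assert (E4 : at_left T (fun t => 0 <= t < T)).
  { apply (at_left_time _ 1); [lra|]. intros; assumption. }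
  unfold filtermap in *.
  generalize (filter_and _ _ (filter_and _ _ E1 E2) (filter_and _ _ E3 E4)).
  apply filter_imp. intros t [[[H1 H2] H3] [H4 H5]].
  change (Rabs (z_2 t - 0) < e) in H3.
  change (Rabs (X_2 t - 0) < e) in H4.
  rewrite Rminus_0_r in H3, H4. apply Rabs_lt_between in H3. apply Rabs_lt_between in H4.
  destruct (prof_facts k z q Hk HT (eta_2 t) H2) as (Z & _).
  tauto.
Qed.

(** With [X = r z], the factor [1 / z] of the velocity and the factor [z] of the density cancel in
    the momentum, which leaves a function of [X] that is regular at [X = 0]. *)
Lemma fields_at_2 t : known_domain z q s_star (2, t) -> 0 < z_2 t ->
  0 < 1 - X_2 t ->
  u (2, t) = / (1 + t) * ((1 + X_2 t) / z_2 t) /\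
  rho m rb (2, t) = 2 ^ m * ((1 + t) * (z_2 t /
    (1 - X_2 t))) /\
  rho m rb (2, t) * u (2, t) = 2 ^ m *
    ((1 + X_2 t) /
     (1 - X_2 t)).
Proof.
  intros (_ & Ht & Hr) Hz Hy. simpl in Ht.
  assert (Eu : u (2, t) = / (1 + t) *
    ((1 + X_2 t) / z_2 t)).
  { unfold u, known_u, sim_u, Us. simpl fst. simpl snd.
    change (eta_of g s_star (sim_var (2, t))) with (eta_2 t). unfold prof_U. field. lra. }
  assert (Er : rho m rb (2, t) = 2 ^ m * ((1 + t) * (z_2 t /
    (1 - X_2 t)))).
  { unfold rho, c, rb, known_rb, sim_rb, Bs. simpl fst. simpl snd.
    change (eta_of g s_star (sim_var (2, t))) with (eta_2 t). unfold prof_B. field. lra. }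
  split; [exact Eu|]. split; [exact Er|]. rewrite Eu, Er. field. lra.
Qed.

Lemma u_blowup : filterlim (fun t => u (2, t)) (at_left T) (Rbar_locally p_infty).
Proof.
  intros P [M HM].
  set (e := / (2 * (1 + Rabs M) * exp th)).
  pose proof (Rabs_pos M) as HM0. pose proof (exp_pos th) as Hth.
  assert (D0 : 0 < 2 * (1 + Rabs M) * exp th) by (repeat apply Rmult_lt_0_compat; lra).
  assert (He : 0 < Rmin e (/ 2)).
  { apply Rmin_glb_lt; [apply Rinv_0_lt_compat, D0 | lra]. }
  unfold filtermap. generalize (z_2_small _ He). apply filter_imp.
  intros t (Dt & Ht & Heta & Hz & HX). apply HM.
  pose proof (Rmin_l e (/ 2)). pose proof (Rmin_r e (/ 2)).
  destruct (fields_at_2 t Dt) as (-> & _); [lra|lra|].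
  set (X := X_2 t) in *.
  set (y := z_2 t) in *. pose proof (pos_tau t Ht) as Htau.
  assert (Hy : 2 * (1 + Rabs M) * exp th < / y).
  { rewrite <- (Rinv_inv (2 * (1 + Rabs M) * exp th)). fold e. apply Rinv_lt_contravar; [|lra].
    apply Rmult_lt_0_compat; [lra|]. unfold e. apply Rinv_0_lt_compat, D0. }
  apply (Rmult_lt_reg_l (1 + t)); [lra|].
  replace ((1 + t) * (/ (1 + t) * ((1 + X) / y))) with ((1 + X) * / y) by (field; lra).
  pose proof (Rle_abs M).
  assert ((1 + t) * M <= exp th * (1 + Rabs M)).
  { apply Rle_trans with ((1 + t) * (1 + Rabs M)); [apply Rmult_le_compat_l; lra|].
    apply Rmult_le_compat_r; lra. }
  assert (/ 2 * / y <= (1 + X) * / y).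
  { apply Rmult_le_compat_r; [|lra]. apply Rlt_le, Rinv_0_lt_compat. lra. }
  lra.
Qed.

Lemma momentum_limit :
  filterlim (fun t => rho m rb (2, t) * u (2, t)) (at_left T) (locally (2 ^ m)).
Proof.
  apply (filterlim_ext_loc (fun t => (fun X => 2 ^ m * ((1 + X) / (1 - X)))
    (X_2 t))).
  - generalize (z_2_small (/ 2) ltac:(lra)). apply filter_imp.
    intros t (Dt & Ht & Heta & Hz & HX).
    destruct (fields_at_2 t Dt) as (_ & _ & ->); [lra|lra|]. reflexivity.
  - apply (filterlim_comp _ _ _ _ (fun X => 2 ^ m * ((1 + X) / (1 - X))) _ (locally 0));
      [exact X_2_lim|].
    assert (C : continuous (fun X => 2 ^ m * ((1 + X) / (1 - X))) 0).
    { apply (ex_derive_continuous (fun X => 2 ^ m * ((1 + X) / (1 - X)))).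
      auto_derive. lra. }
    unfold continuous in C.
    replace (2 ^ m * ((1 + 0) / (1 - 0))) with (2 ^ m) in C by field.
    exact C.
Qed.

Lemma rho_vanishes : filterlim (fun t => rho m rb (2, t)) (at_left T) (locally 0).
Proof.
  apply (filterlim_ext_loc (fun t => rho m rb (2, t) * u (2, t) * / u (2, t))).
  - apply (filter_imp (fun t => 0 < u (2, t))); [intros t Ht; field; lra|].
    apply (u_blowup (fun y => 0 < y)). now exists 0.
  - replace 0 with (2 ^ m * 0) by ring.
    apply (filterlim_comp_2 _ (fun t => / u (2, t)) Rmult momentum_limit
      (filterlim_comp _ _ _ (fun t => u (2, t)) Rinv _ _ _ u_blowup
        (filterlim_Rbar_inv p_infty ltac:(discriminate)))).
    now apply (filterlim_Rbar_mult (2 ^ m) 0 (2 ^ m * 0)).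
Qed.

(** The kinetic part suffices: it is half the momentum times [u], and the momentum tends to
    [2 ^ m >= 1], so it is eventually at least [u / 4]. *)
Lemma energy_blowup :
  filterlim (fun t => energy m rb u (2, t)) (at_left T) (Rbar_locally p_infty).
Proof.
  intros P [M HM].
  assert (H2m : 1 <= 2 ^ m) by (apply pow_R1_Rle; lra).
  assert (E1 := u_blowup (fun y => 4 * Rabs M < y) ltac:(now exists (4 * Rabs M))).
  assert (E2 := momentum_limit (ball (2 ^ m) (mkposreal (/ 2) ltac:(lra))) (locally_ball _ _)).
  assert (E3 := z_2_small (/ 2) ltac:(lra)).
  unfold filtermap in *.
  generalize (filter_and _ _ (filter_and _ _ E1 E2) E3). apply filter_imp.
  intros t [[H1 H2] (Dt & _)]. apply HM.
  change (Rabs (rho m rb (2, t) * u (2, t) - 2 ^ m) < / 2) in H2.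
  apply Rabs_lt_between in H2. unfold energy.
  assert (0 < rho m rb (2, t)).
  { unfold rho. apply Rmult_lt_0_compat.
    - unfold c. apply pow_lt. simpl. lra.
    - now apply (known_rb_pos m z q g s_star Hk HT (proj1 HB)). }
  assert (0 <= / 2 * c m (fst (2, t)) ^ 2 * / rho m rb (2, t)).
  { apply Rmult_le_pos; [|now apply Rlt_le, Rinv_0_lt_compat].
    apply Rmult_le_pos; [lra | apply pow2_ge_0]. }
  pose proof (Rabs_pos M). pose proof (Rle_abs M).
  assert (/ 2 * (rho m rb (2, t) * u (2, t)) * u (2, t) >= / 4 * u (2, t)) by nra.
  replace (/ 2 * rho m rb (2, t) * u (2, t) ^ 2) with
    (/ 2 * (rho m rb (2, t) * u (2, t)) * u (2, t)) by ring.
  lra.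
Qed.

(** On the left, [eta_p] stays above the positive value [eb] it would take at [T], so its gap
    eventually exceeds that of [x = 2], which tends to 0. On the right, the gap of [char_m] is at
    most [4 / 1000] of the remaining time, against [1 / 2] of it for [x = 2]. *)
Lemma region_at_2 : at_left T (fun t => region T char_p char_m (2, t)).
Proof.
  pose proof HB as (Hg & G1 & G2 & Hth & He1 & Hhead & F1 & F2 & F3).
  pose proof horizon_pos as Hh.
  set (eb := gp (TP e1 - th)).
  pose proof (plus_mono e1 horizon ltac:(lra) ltac:(lra) ltac:(lra)) as M1.
  destruct (G2 (TP e1 - th)) as (B1 & B2 & _); [lra|]. fold eb in B1, B2.
  assert (HA : 0 < A eb).
  { pose proof (mass_mono 0 eb ltac:(lra) ltac:(lra) ltac:(lra)) as M.
    pose proof (mass_0 z q). lra. }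
  apply (at_left_time _ (2 * A eb)); [lra|]. intros t Ht Hd.
  pose proof (log_time t Ht) as Hl.
  destruct (eta_p_facts t Ht) as [E1 E2].
  split; [exact Ht|]. simpl.
  assert (E3 : exp (ln 2) = 2) by (apply exp_ln; lra).
  rewrite <- E3. unfold char_p, char_m, s_star.
  split; apply exp_mono.
  - assert (A eb <= A (eta_p t)).
    { assert (eb <= eta_p t).
      { apply Rnot_lt_le. intros K.
        pose proof (plus_mono (eta_p t) eb ltac:(lra) K ltac:(lra)). lra. }
      destruct H as [L| ->]; [|lra]. apply Rlt_le, mass_mono; lra. }
    lra.
  - assert (A (th - ln (1 + t)) - A 0 <=
      4 / 1000 * (th - ln (1 + t) - 0)).
    { apply (growth_le _ (fun s => q s * z s)); [lra| |].
      - apply (mass_continuous k z q HT).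
      - intros s Hs. split; [apply (mass_derive k z q HT)|].
        destruct (Hhead s ltac:(lra)) as [Q Z].
        destruct (prof_facts k z q Hk HT s ltac:(lra)) as (Z' & Q' & _).
        unfold q_init in *. nra. }
    rewrite (mass_0 z q) in H. lra.
Qed.

(** The density profile extends continuously to [eta = 0], so it is bounded on [[0, e1]]. The
    velocity profile is bounded below since [1 / z > 0] and [r >= - 1 / 2]. The radius is at most
    [exp s_star] because [s < s_star] and [t >= 0]. *)
Lemma uniform_bounds : exists M, forall p, region T char_p char_m p ->
  rho m rb p <= M /\ - u p <= M.
Proof.
  pose proof HB as (Hg & G1 & G2 & Hth & He1 & _).
  pose proof HT as (Cz & Cq & z0 & _ & _ & P & _).
  pose proof horizon_pos as Hh.
  assert (Hy : forall s, 0 <= s <= e1 -> 0 < 1 - prof_r (z s) (q s) * z s)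
    by (intros s Hs; apply P; lra).
  destruct (continuity_ab_maj (fun s => prof_B (z s) (q s)) 0 e1) as [mx [Hmx _]]; [lra| |].
  { intros s Hs. specialize (Hy s Hs). apply continuity_pt_filterlim.
    apply (continuous_mult (fun s => 2 * z s) (fun s => / (1 - prof_r (z s) (q s) * z s))).
    - apply (continuous_mult (fun _ => 2) z); [apply continuous_const | apply Cz].
    - apply (continuous_comp (fun s => 1 - prof_r (z s) (q s) * z s) (fun y => / y)).
      + apply (continuous_minus (fun _ => 1)); [apply continuous_const|]. unfold prof_r.
        apply (continuous_mult (fun s => - / 2 + q s * z s)); [|apply Cz].
        apply (continuous_plus (fun _ => - / 2)); [apply continuous_const|].
        apply (continuous_mult q); [apply Cq | apply Cz].
      + apply (ex_derive_continuous (fun y => / y)). auto_derive. lra. }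
  set (Bm := Rabs (prof_B (z mx) (q mx))). pose proof (Rabs_pos (prof_B (z mx) (q mx))) as HBm.
  fold Bm in HBm.
  set (E := exp s_star). assert (HE : 0 < E) by apply exp_pos.
  pose proof (exp_pos th) as Hexp.
  set (M1 := (1 + E) ^ pred m * exp th * Bm).
  assert (HM1 : 0 <= M1).
  { unfold M1. apply Rmult_le_pos; [|exact HBm]. apply Rmult_le_pos; [|lra].
    apply pow_le. lra. }
  exists (M1 + E). intros p Dp.
  destruct (region_domain p Dp) as [Kp Ep].
  destruct p as [x t]. destruct Dp as [Ht _]. simpl in Ht.
  pose proof Kp as (Hx & Htau & Hs). simpl in Hx, Htau.
  pose proof (pos_tau t Ht) as Ht2. pose proof (log_time t Ht) as Hl.
  assert (Hx2 : x <= E).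
  { rewrite <- (exp_ln x Hx). unfold E. apply exp_mono.
    unfold sim_range, sim_var in Hs. simpl in Hs. lra. }
  set (eta := eta_of g s_star (sim_var (x, t))) in *.
  split.
  - assert (rho m rb (x, t) <= M1); [|lra].
    unfold rho, rb, known_rb, sim_rb, Bs. simpl fst. simpl snd.
    fold eta. rewrite (c_pred m x Hm).
    replace (x * x ^ pred m * ((1 + t) * / x * prof_B (z eta) (q eta))) with
      (x ^ pred m * (1 + t) * prof_B (z eta) (q eta)) by (field; lra).
    assert (B1 : prof_B (z eta) (q eta) <= Bm).
    { eapply Rle_trans; [apply (Hmx eta); lra | apply Rle_abs]. }
    assert (B0 : 0 <= prof_B (z eta) (q eta)).
    { destruct (P eta ltac:(lra)) as (_ & Z & Y & _). unfold prof_B.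
      apply Rdiv_le_0_compat; lra. }
    unfold M1. apply Rmult_le_compat; [|exact B0| |exact B1].
    + apply Rmult_le_pos; [apply pow_le; lra | lra].
    + apply Rmult_le_compat; [apply pow_le; lra|lra| |lra].
      apply pow_incr. lra.
  - assert (- u (x, t) <= E); [|lra].
    unfold u, known_u, sim_u, Us. simpl fst. simpl snd. fold eta.
    destruct (P eta ltac:(lra)) as (_ & _ & _ & R0).
    destruct (prof_facts k z q Hk HT eta ltac:(lra)) as (Z & _).
    assert (HU : - / 4 <= prof_U (z eta) (q eta)).
    { unfold prof_U. assert (0 < / z eta) by now apply Rinv_0_lt_compat. lra. }
    assert (Hf : 0 < x * / (1 + t) <= E).
    { assert (0 < / (1 + t) <= 1).
      { split; [apply Rinv_0_lt_compat; lra|]. rewrite <- Rinv_1.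
        apply Rinv_le_contravar; lra. }
      nra. }
    nra.
Qed.

(** * Uniqueness of the domain of dependence *)

(** By the chain rule the last hypothesis says that [F eta + ln (1 + t)] has derivative zero along
    [y]. Clipping the time gives continuity up to [t = 0], where only a one-sided derivative is
    available. *)
Lemma char_invariant (T1 : R) (y v F F' : R -> R) :
  (forall t, 0 <= t < T1 -> is_derive_within (fun s => 0 <= s < T1) y t (v t)) ->
  (forall t, 0 <= t < T1 -> known_domain z q s_star (y t, t)) ->
  (forall e, 0 < e < horizon -> is_derive F e (F' e)) ->
  (forall t, 0 <= t < T1 -> let e := eta_of g s_star (sim_var (y t, t)) in
     F' e * (- / (q e * z e) * (v t / y t + / (2 * (1 + t)))) + / (1 + t) = 0) ->
  forall t, 0 <= t < T1 ->
    F (eta_of g s_star (sim_var (y t, t))) + ln (1 + t) = F (eta_of g s_star (sim_var (y 0, 0))).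
Proof.
  intros Hy Hdom HF Hzero b Hb.
  set (Phi := fun t => F (eta_of g s_star (sim_var (y t, t))) + ln (1 + t)).
  assert (E : (fun t => Phi (clip 0 b t)) b = (fun t => Phi (clip 0 b t)) 0).
  { apply (constant_on_segment (fun t => Phi (clip 0 b t)) 0 b); [lra| |].
    - intros t Ht. unfold Phi.
      pose proof (clip_bounds 0 b t ltac:(lra)) as Hc.
      destruct (Hdom (clip 0 b t) ltac:(lra)) as (D1 & D2 & D3). simpl in D1, D2.
      assert (Cc : continuous (clip 0 b) t).
      { apply (clip_continuous (fun s => s) T1 b Hb).
        intros s Hs. exists 1. apply is_derive_is_derive_within; [exact Hs|].
        apply (@is_derive_id R_AbsRing). }
      assert (Cy : continuous (fun s => y (clip 0 b s)) t).
      { apply (clip_continuous y T1 b Hb). intros s Hs. exists (v s). now apply Hy. }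
      assert (Cl : continuous (fun s => ln (1 + clip 0 b s)) t).
      { apply (continuous_comp (clip 0 b) (fun s => ln (1 + s))); [exact Cc|].
        apply (ex_derive_continuous (fun s => ln (1 + s))). auto_derive. lra. }
      apply (continuous_plus (fun s => F (eta_of g s_star (sim_var (y (clip 0 b s), clip 0 b s))))
        (fun s => ln (1 + clip 0 b s))); [|exact Cl].
      apply (continuous_comp (fun s => eta_of g s_star (sim_var (y (clip 0 b s), clip 0 b s))) F).
      + apply (continuous_comp (fun s => sim_var (y (clip 0 b s), clip 0 b s)) (eta_of g s_star)).
        * unfold sim_var. simpl.
          apply (continuous_plus (fun s => ln (y (clip 0 b s)))).
          -- apply (continuous_comp (fun s => y (clip 0 b s)) ln); [exact Cy|].
             apply (ex_derive_continuous ln). auto_derive. exact D1.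
          -- apply (continuous_mult (fun s => ln (1 + clip 0 b s)) (fun _ => / 2));
               [exact Cl | apply continuous_const].
        * eapply is_derive_continuous. apply (eta_of_derive z q g s_star (proj1 HB)). exact D3.
      + eapply is_derive_continuous. apply HF.
        apply (eta_of_range z q g s_star (proj1 HB)). exact D3.
    - intros t Ht.
      destruct (Hdom t ltac:(lra)) as (D1 & D2 & D3). simpl in D1, D2.
      apply (is_derive_ext_loc Phi).
      { assert (Hr : 0 < Rmin t (b - t)) by (apply Rmin_glb_lt; lra).
        exists (mkposreal _ Hr). intros s Hs. change (Rabs (s - t) < Rmin t (b - t)) in Hs.
        pose proof (Rmin_l t (b - t)). pose proof (Rmin_r t (b - t)).
        apply Rabs_lt_between in Hs. rewrite clip_id by lra. reflexivity. }
      assert (Dy : is_derive y t (v t)).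
      { apply (derive_within_interior (fun s => 0 <= s < T1)); [|apply Hy; lra].
        assert (Hr : 0 < Rmin t (T1 - t)) by (apply Rmin_glb_lt; lra).
        exists (mkposreal _ Hr). intros s Hs. change (Rabs (s - t) < Rmin t (T1 - t)) in Hs.
        pose proof (Rmin_l t (T1 - t)). pose proof (Rmin_r t (T1 - t)).
        apply Rabs_lt_between in Hs. lra. }
      set (e := eta_of g s_star (sim_var (y t, t))).
      assert (Ds : is_derive (fun s => sim_var (y s, s)) t (v t / y t + / (2 * (1 + t)))).
      { unfold sim_var. simpl. auto_derive.
        - repeat split; try lra. eexists; exact Dy.
        - replace (Derive (fun x => y x) t) with (v t) by (symmetry; now apply is_derive_unique).
          field. lra. }
      assert (De : is_derive (fun s => F (eta_of g s_star (sim_var (y s, s)))) t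
        ((v t / y t + / (2 * (1 + t))) * - / (q e * z e) * F' e)).
      { replace ((v t / y t + / (2 * (1 + t))) * - / (q e * z e) * F' e) with
          ((v t / y t + / (2 * (1 + t))) * (- / (q e * z e) * F' e)) by ring.
        apply (is_derive_comp (fun s => F (eta_of g s_star s)) (fun s => sim_var (y s, s)) t);
          [|exact Ds].
        apply (is_derive_comp F (eta_of g s_star)).
        - apply HF. apply (eta_of_range z q g s_star (proj1 HB)). exact D3.
        - apply (eta_of_derive z q g s_star (proj1 HB)). exact D3. }
      assert (Dl : is_derive (fun s => ln (1 + s)) t (/ (1 + t))).
      { auto_derive; [lra|]. ring. }
      replace 0 with ((v t / y t + / (2 * (1 + t))) * - / (q e * z e) * F' e + / (1 + t)).
      + exact (is_derive_plus _ _ t _ _ De Dl).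
      + rewrite <- (Hzero t ltac:(lra)). cbv zeta. fold e. ring. }
  cbv beta in E. rewrite !clip_id in E by lra. unfold Phi in E.
  rewrite Rplus_0_r, ln_1, Rplus_0_r in E. exact E.
Qed.

Lemma char_p_unique T1 y : T1 <= T -> y 0 = 1 ->
  (forall t, 0 <= t < T1 -> known_domain z q s_star (y t, t) /\
     is_derive_within (fun s => 0 <= s < T1) y t (u (y t, t) + / rb (y t, t))) ->
  forall t, 0 <= t < T1 -> y t = char_p t.
Proof.
  intros HT1 Hy0 H t Ht.
  pose proof HB as (Hg & G1 & _ & Hth & He1 & _ & _ & E2 & _).
  pose proof horizon_pos as Hh.
  assert (I := char_invariant T1 y (fun t => u (y t, t) + / rb (y t, t)) (TP)
    (fun e => q e * z e ^ 2 * / (1 + z e / 2))).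
  specialize (I ltac:(intros; now apply H) ltac:(intros; now apply H)
    ltac:(intros e He; apply (plus_derive k z q HT); lra)).
  assert (I' : forall t, 0 <= t < T1 ->
    TP (eta_of g s_star (sim_var (y t, t))) + ln (1 + t) =
    TP (eta_of g s_star (sim_var (y 0, 0)))).
  { apply I. intros s Hs. cbv zeta. destruct (H s Hs) as [Kd _].
    destruct (known_speeds m z q g s_star Hk HT Hg _ Kd) as [S _]. fold u rb in S. rewrite S.
    destruct Kd as (D1 & D2 & D3). simpl in D1, D2. simpl fst. simpl snd.
    destruct (prof_facts k z q Hk HT _ (eta_of_range z q g s_star Hg _ D3)) as (Z & Q & _ & Hd & _).
    field. lra. }
  clear I. specialize (I' t Ht).
  assert (E0 : sim_var (y 0, 0) = s_star - A e1).
  { unfold sim_var, s_star. simpl. rewrite Hy0, Rplus_0_r, ln_1, E2. field. }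
  pose proof (eta_of_mass e1 ltac:(lra)) as Em.
  rewrite E0, Em in I'.
  destruct (H t Ht) as [(D1 & D2 & D3) _]. simpl in D1, D2.
  pose proof (eta_of_range z q g s_star Hg _ D3) as He.
  set (e := eta_of g s_star (sim_var (y t, t))) in *.
  assert (Ee : eta_p t = e).
  { unfold eta_p. replace (TP e1 - ln (1 + t)) with (TP e) by lra.
    apply G1. lra. }
  unfold char_p. rewrite Ee.
  destruct Hg as [_ Hg]. destruct (Hg _ D3) as (_ & M & _).
  change (g (s_star - sim_var (y t, t))) with e in M. rewrite M.
  unfold sim_var. simpl.
  replace (s_star - ln (1 + t) / 2 - (s_star - (ln (y t) + ln (1 + t) / 2))) with (ln (y t)) by field.
  now rewrite exp_ln.
Qed.

Lemma char_m_unique T1 y : T1 <= T -> y 0 = 3 ->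
  (forall t, 0 <= t < T1 -> known_domain z q s_star (y t, t) /\
     is_derive_within (fun s => 0 <= s < T1) y t (u (y t, t) - / rb (y t, t))) ->
  forall t, 0 <= t < T1 -> y t = char_m t.
Proof.
  intros HT1 Hy0 H t Ht.
  pose proof HB as (Hg & G1 & _ & Hth & He1 & _ & E1 & _).
  pose proof horizon_pos as Hh.
  assert (I := char_invariant T1 y (fun t => u (y t, t) - / rb (y t, t)) (fun e => e)
    (fun _ => 1)).
  specialize (I ltac:(intros; now apply H) ltac:(intros; now apply H)
    ltac:(intros e He; apply (@is_derive_id R_AbsRing))).
  assert (I' : forall t, 0 <= t < T1 ->
    eta_of g s_star (sim_var (y t, t)) + ln (1 + t) = eta_of g s_star (sim_var (y 0, 0))).
  { apply I. intros s Hs. cbv zeta. destruct (H s Hs) as [Kd _].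
    destruct (known_speeds m z q g s_star Hk HT Hg _ Kd) as [_ S]. fold u rb in S. rewrite S.
    destruct Kd as (D1 & D2 & D3). simpl in D1, D2. simpl fst. simpl snd.
    destruct (prof_facts k z q Hk HT _ (eta_of_range z q g s_star Hg _ D3)) as (Z & Q & _ & Hd & _).
    unfold prof_r. field. lra. }
  clear I. specialize (I' t Ht).
  assert (E0 : sim_var (y 0, 0) = s_star - A th).
  { unfold sim_var, s_star. simpl. rewrite Hy0, Rplus_0_r, ln_1.
    replace 3 with (2 * (3 / 2)) by field. rewrite ln_mult by lra. rewrite <- E1. field. }
  pose proof (eta_of_mass th ltac:(lra)) as Em.
  rewrite E0, Em in I'.
  destruct (H t Ht) as [(D1 & D2 & D3) _]. simpl in D1, D2.
  set (e := eta_of g s_star (sim_var (y t, t))) in *.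
  assert (Ee : th - ln (1 + t) = e) by lra.
  unfold char_m. rewrite Ee.
  destruct Hg as [_ Hg]. destruct (Hg _ D3) as (_ & M & _).
  change (g (s_star - sim_var (y t, t))) with e in M. rewrite M.
  unfold sim_var. simpl.
  replace (s_star - ln (1 + t) / 2 - (s_star - (ln (y t) + ln (1 + t) / 2))) with (ln (y t)) by field.
  now rewrite exp_ln.
Qed.

Lemma known_on_region :
  solution_on_dependence_domain m T (known_rho0 m z q g s_star) (known_u0 z q g s_star)
    rb u char_p char_m.
Proof.
  split.
  - exact char_boundary.
  - apply (known_classical m z q g s_star Hm Hk HT (proj1 HB)).
    intros p Dp. now apply region_domain.
Qed.

(** Between the foreign boundaries the self-similar fields form a classical solution too, so
    [classical_unique] applies with the foreign solution as the first one. Its boundaries then solve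
    the characteristic equations of the self-similar fields, and the invariants determine them. *)
Lemma coincide_on_prefix rb' u' xp' xm' T1 :
  solution_on_dependence_domain m T (known_rho0 m z q g s_star) (known_u0 z q g s_star)
    rb' u' xp' xm' ->
  0 <= T1 <= T ->
  (forall t, 0 <= t < T1 ->
     known_domain z q s_star (xp' t, t) /\ known_domain z q s_star (xm' t, t)) ->
  (forall t, 0 <= t < T1 -> xp' t = char_p t /\ xm' t = char_m t) /\
  (forall p, region T1 xp' xm' p -> rb' p = rb p /\ u' p = u p).
Proof.
  intros HS HT1 Hdom.
  pose proof (dependence_boundary_lt _ _ _ _ _ _ _ _ HS) as Hlt.
  destruct HS as [(Hp0 & Hm0 & _) HC].
  assert (Sub : forall p, region T1 xp' xm' p -> region T xp' xm' p)
    by (intros p [A B]; split; [lra | exact B]).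
  assert (Dom : forall p, region T1 xp' xm' p -> known_domain z q s_star p).
  { intros [x t] [A B]. simpl in A, B.
    destruct (Hdom t A) as [(P1 & P2 & P3) (Q1 & Q2 & Q3)]. simpl in P1, P2, Q1.
    split; [simpl; lra|]. split; [simpl; lra|].
    pose proof (sim_var_le (xp' t) x t P1 ltac:(lra)).
    pose proof (sim_var_le x (xm' t) t ltac:(lra) ltac:(lra)).
    unfold sim_range in *. lra. }
  assert (Eq : forall p, region T1 xp' xm' p -> rb' p = rb p /\ u' p = u p).
  { apply (classical_unique m T1 xp' xm' (known_rho0 m z q g s_star) (known_u0 z q g s_star));
      try assumption.
    - intros t Ht. destruct (Hlt t ltac:(lra)) as (B & Dp & Dm).
      split; [exact B|].
      split; apply (derive_within_subset (fun s => 0 <= s < T)); try assumption; intros; lra.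
    - apply (classical_solution_subset m (region T xp' xm')); assumption.
    - apply (known_classical m z q g s_star Hm Hk HT (proj1 HB)). exact Dom. }
  split; [|exact Eq].
  intros t Ht. split.
  - apply (char_p_unique T1 xp' ltac:(lra) Hp0); [|exact Ht].
    intros s Hs. split; [now apply Hdom|].
    destruct (Hlt s ltac:(lra)) as (B & Dp & _).
    destruct (Eq (xp' s, s)) as [<- <-]; [split; simpl; lra|].
    apply (derive_within_subset (fun s => 0 <= s < T)); try assumption. intros; lra.
  - apply (char_m_unique T1 xm' ltac:(lra) Hm0); [|exact Ht].
    intros s Hs. split; [now apply Hdom|].
    destruct (Hlt s ltac:(lra)) as (B & _ & Dm).
    destruct (Eq (xm' s, s)) as [<- <-]; [split; simpl; lra|].
    apply (derive_within_subset (fun s => 0 <= s < T)); try assumption. intros; lra.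
Qed.

Lemma within_left_limit (f h : R -> R) t a b :
  0 < t < T -> is_derive_within (fun s => 0 <= s < T) f t a ->
  is_derive_within (fun s => 0 <= s < T) h t b ->
  (forall s, 0 <= s < t -> f s = h s) -> f t = h t.
Proof.
  intros Ht Hf Hh E.
  apply Rminus_diag_uniq, abs_le_all_eq_0. intros e He.
  assert (Dt : (fun s => 0 <= s < T) t) by (simpl; lra).
  destruct (derive_within_cont _ _ _ _ Dt Hf (e / 2)) as (d1 & Hd1 & H1); [lra|].
  destruct (derive_within_cont _ _ _ _ Dt Hh (e / 2)) as (d2 & Hd2 & H2); [lra|].
  set (w := Rmin (Rmin d1 d2) t / 2).
  assert (K : 0 < Rmin (Rmin d1 d2) t) by (repeat apply Rmin_glb_lt; lra).
  pose proof (Rmin_l (Rmin d1 d2) t). pose proof (Rmin_r (Rmin d1 d2) t).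
  pose proof (Rmin_l d1 d2). pose proof (Rmin_r d1 d2).
  assert (A : Rabs (t - w - t) = w).
  { replace (t - w - t) with (- w) by ring. rewrite Rabs_Ropp. apply Rabs_pos_eq.
    unfold w. lra. }
  specialize (H1 (t - w) ltac:(simpl; unfold w; lra) ltac:(rewrite A; unfold w; lra)).
  specialize (H2 (t - w) ltac:(simpl; unfold w; lra) ltac:(rewrite A; unfold w; lra)).
  rewrite (E (t - w)) in H1 by (unfold w; lra).
  replace (f t - h t) with ((h (t - w) - h t) - (h (t - w) - f t)) by ring.
  eapply Rle_trans; [apply Rabs_triang|]. rewrite Rabs_Ropp. lra.
Qed.

Lemma known_domain_open (y : R -> R) t l : 0 <= t < T ->
  is_derive_within (fun s => 0 <= s < T) y t l -> known_domain z q s_star (y t, t) ->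
  exists d, 0 < d /\ forall s, t < s < t + d -> s < T -> known_domain z q s_star (y s, s).
Proof.
  intros Ht Hy (D1 & D2 & D3). simpl in D1, D2.
  assert (C : continuity_2d_pt (fun x s => sim_var (x, s)) (y t) t).
  { unfold sim_var. simpl.
    apply continuity_2d_pt_plus.
    - apply (continuity_1d_2d_pt_comp ln (fun x _ => x) (y t) t).
      + apply continuity_pt_filterlim. apply (ex_derive_continuous ln). auto_derive. exact D1.
      + apply continuity_2d_pt_id1.
    - apply (continuity_1d_2d_pt_comp (fun s => ln (1 + s) / 2) (fun _ s => s) (y t) t).
      + apply continuity_pt_filterlim. apply (ex_derive_continuous (fun s => ln (1 + s) / 2)).
        auto_derive. lra.
      + apply continuity_2d_pt_id2. }
  set (a := s_star - sim_var (y t, t)) in *. unfold sim_range in D3. fold a in D3.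
  set (e := Rmin a (A horizon - a)).
  assert (He : 0 < e) by (apply Rmin_glb_lt; lra).
  assert (He1 : e <= a) by apply Rmin_l.
  assert (He2 : e <= A horizon - a) by apply Rmin_r.
  destruct (C (mkposreal e He)) as [d Hd]. simpl in Hd.
  assert (Hm2 : 0 < Rmin d (y t)) by (apply Rmin_glb_lt; [apply cond_pos | exact D1]).
  pose proof (Rmin_l d (y t)). pose proof (Rmin_r d (y t)).
  destruct (derive_within_cont _ _ _ _ (Ht : (fun s => 0 <= s < T) t) Hy _ Hm2)
    as (d1 & Hd1 & H1).
  exists (Rmin d d1). split; [apply Rmin_glb_lt; [apply cond_pos | exact Hd1]|].
  intros s Hs HsT.
  pose proof (Rmin_l d d1). pose proof (Rmin_r d d1).
  assert (As : Rabs (s - t) = s - t) by (apply Rabs_pos_eq; lra).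
  specialize (H1 s ltac:(simpl; lra) ltac:(lra)).
  specialize (Hd (y s) s ltac:(lra) ltac:(lra)).
  apply Rabs_lt_between in Hd. apply Rabs_lt_between in H1.
  split; [simpl; lra|]. split; [simpl; lra|]. unfold sim_range. unfold a in *. lra.
Qed.

(** Agreement of the boundaries before a time passes to that time by continuity from the left. There
    they lie on the self-similar characteristics, hence in [known_domain], which they cannot leave
    immediately afterwards. The induction runs on [[0, h]] for every [h < T]. *)
Lemma domain_uniqueness rb' u' xp' xm' :
  solution_on_dependence_domain m T (known_rho0 m z q g s_star) (known_u0 z q g s_star)
    rb' u' xp' xm' ->
  (forall t, 0 <= t < T -> xp' t = char_p t /\ xm' t = char_m t) /\
  (forall p, region T char_p char_m p -> rb' p = rb p /\ u' p = u p).
Proof.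
  intros HS.
  pose proof (dependence_boundary_lt _ _ _ _ _ _ _ _ HS) as Hlt.
  pose proof (dependence_boundary_lt _ _ _ _ _ _ _ _ known_on_region) as Hlt0.
  assert (Hin : forall t, 0 <= t < T ->
    known_domain z q s_star (char_p t, t) /\ known_domain z q s_star (char_m t, t)).
  { intros t Ht. destruct (Hlt0 t Ht) as (B & _).
    split; apply region_domain; split; simpl; try exact Ht;
      lra. }
  assert (Q : forall h, 0 <= h < T -> forall t, 0 <= t <= h ->
    known_domain z q s_star (xp' t, t) /\ known_domain z q s_star (xm' t, t)).
  { intros h Hh. apply continuous_induction. intros t Ht Hbefore.
    assert (Et : xp' t = char_p t /\ xm' t = char_m t).
    { destruct (coincide_on_prefix rb' u' xp' xm' t HS ltac:(lra) Hbefore) as [E _].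
      destruct (Req_dec t 0) as [->|N].
      - destruct HS as [(-> & -> & _) _]. destruct known_on_region as [(-> & -> & _) _]. tauto.
      - destruct (Hlt t ltac:(lra)) as (_ & A1 & A2).
        destruct (Hlt0 t ltac:(lra)) as (_ & A3 & A4).
        split; eapply within_left_limit; try eassumption; try lra; intros; now apply E. }
    destruct Et as [E1 E2].
    destruct (Hin t ltac:(lra)) as [K1 K2]. rewrite <- E1 in K1. rewrite <- E2 in K2.
    split; [now split|].
    destruct (Hlt t ltac:(lra)) as (_ & A1 & A2).
    destruct (known_domain_open xp' t _ ltac:(lra) A1 K1) as (d1 & Hd1 & O1).
    destruct (known_domain_open xm' t _ ltac:(lra) A2 K2) as (d2 & Hd2 & O2).
    exists (Rmin (Rmin d1 d2) (T - t)). split; [repeat apply Rmin_glb_lt; lra|].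
    intros s Hs.
    pose proof (Rmin_l (Rmin d1 d2) (T - t)). pose proof (Rmin_r (Rmin d1 d2) (T - t)).
    pose proof (Rmin_l d1 d2). pose proof (Rmin_r d1 d2).
    split; [apply O1 | apply O2]; lra. }
  destruct (coincide_on_prefix rb' u' xp' xm' T HS) as [E F].
  - pose proof t_blow_pos. unfold T. lra.
  - intros t Ht. apply (Q t Ht). lra.
  - split; [exact E|]. intros [x t] [Ht Hx]. apply F. split; [exact Ht|].
    simpl in *. destruct (E t Ht) as [-> ->]. exact Hx.
Qed.

Lemma field_uniqueness rb' u' :
  classical_solution m (region T char_p char_m) (known_rho0 m z q g s_star) (known_u0 z q g s_star)
    rb' u' ->
  forall p, region T char_p char_m p -> rb' p = rb p /\ u' p = u p.
Proof.
  intros HC p Dp. pose proof known_on_region as HS.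
  pose proof (dependence_boundary_lt _ _ _ _ _ _ _ _ HS) as Hlt.
  destruct HS as [(Hp0 & Hm0 & _) HC0].
  destruct (classical_unique m T char_p char_m _ _ rb u rb' u' Hm Hp0 Hm0 Hlt HC0 HC p Dp) as [E1 E2].
  now rewrite E1, E2.
Qed.

End Chars.

Theorem theorem1p7 (m : nat) (hm : m = 1%nat \/ m = 2%nat) :
  exists eps0 KT Kx : R, 0 < eps0 /\
  forall eps : R, 0 < eps < eps0 ->
  exists (rho0 u0 : R -> R) (T : R),
    C1_within (fun x => 1 <= x <= 3) rho0 /\
    C1_within (fun x => 1 <= x <= 3) u0 /\
    0 < T <= KT /\
    exists (rb u : R * R -> R) (xp xm : R -> R),
      solution_on_dependence_domain m T rho0 u0 rb u xp xm /\
      unique_solution m T rho0 u0 rb u xp xm /\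
      (exists (xs B : R),
         Rabs (xs - 2) <= Kx * sqrt eps /\
         at_left T (fun t => region T xp xm (xs, t)) /\
         filterlim (fun t => u (xs, t)) (at_left T) (Rbar_locally p_infty) /\
         filterlim (fun t => rho m rb (xs, t)) (at_left T) (locally 0) /\
         filterlim (fun t => rho m rb (xs, t) * u (xs, t)) (at_left T) (locally B) /\
         filterlim (fun t => energy m rb u (xs, t)) (at_left T) (Rbar_locally p_infty)) /\
      (exists M : R, forall p, region T xp xm p ->
         rho m rb p <= M /\ - u p <= M).
Proof.
  assert (Hm : (1 <= m)%nat) by lia.
  assert (Hk : / 4 <= INR m / 4 <= / 2) by (destruct hm as [-> | ->]; simpl; lra).
  destruct (blowup_data_exists _ Hk) as (z & q & g & gp & th & e1 & HT & HB).
  (* [T = exp th - 1] with [th < 6 / 5] is below [exp 2]; the factor 0 reflects that the blow-up is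
     exactly at [x = 2]. *)
  exists 1, (exp 2), 0. split; [lra|]. intros eps _.
  exists (known_rho0 m z q g (s_star th)), (known_u0 z q g (s_star th)), (t_blow th).
  assert (Hini : C1_within (fun x => 1 <= x <= 3) (known_rho0 m z q g (s_star th)) /\
    C1_within (fun x => 1 <= x <= 3) (known_u0 z q g (s_star th))).
  { apply (known_initial_C1 m z q g (s_star th) Hk HT (proj1 HB)); [lra|].
    intros x Hx.
    destruct (region_domain m z q g gp th e1 Hk HT HB (x, 0)) as [(_ & _ & R) _].
    - pose proof (t_blow_pos z q g gp th e1 HB). split; simpl; [lra|].
      rewrite (char_p_0 z q g gp th e1 HB), (char_m_0 z q g gp th e1 HB). exact Hx.
    - unfold sim_var in R. simpl in R. rewrite Rplus_0_r, ln_1 in R.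
      replace (ln x) with (ln x + 0 / 2) by field. exact R. }
  split; [apply Hini|]. split; [apply Hini|].
  split.
  { split; [exact (t_blow_pos z q g gp th e1 HB)|]. unfold t_blow.
    pose proof HB as (_ & _ & _ & Hth & _).
    assert (exp th <= exp 2) by (apply exp_mono; lra). lra. }
  exists (known_rb z q g (s_star th)), (known_u z q g (s_star th)),
    (char_p z q gp th e1), (char_m z q th).
  split; [exact (known_on_region m z q g gp th e1 Hm Hk HT HB)|].
  split.
  { split.
    - intros rb' u'. exact (field_uniqueness m z q g gp th e1 Hm Hk HT HB rb' u').
    - intros rb' u' xp' xm'. exact (domain_uniqueness m z q g gp th e1 Hm Hk HT HB rb' u' xp' xm'). }
  split; [|exact (uniform_bounds m z q g gp th e1 Hm Hk HT HB)].
  exists 2, (2 ^ m).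
  split; [rewrite Rminus_diag, Rabs_R0; lra|].
  split; [exact (region_at_2 m z q g gp th e1 Hk HT HB)|].
  split; [exact (u_blowup m z q g gp th e1 Hk HT HB)|].
  split; [exact (rho_vanishes m z q g gp th e1 Hk HT HB)|].
  split; [exact (momentum_limit m z q g gp th e1 Hk HT HB)|].
  exact (energy_blowup m z q g gp th e1 Hk HT HB).
Qed.
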